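(* Let $S$ be an $\mathcal{F}$-stable subset of $L^{\phi^\ast}_{\mathcal{F}}(\mathcal{E})$. Suppose that for every sequence $(x_n)_{n\in\mathbb{N}}$ in $L^\phi_{\mathcal{F}}(\mathcal{E})$ with $x_n\downarrow 0$ a.s. one has $$\operatorname*{ess.sup}_{y\in S}\mathbb{E}\left[|x_n y|\,\middle|\,\mathcal{F}\right]\to 0\quad\text{a.s.}$$ Then $S$ is relatively stably $w_s^\#$-compact, i.e. the closure of $S$ in $L^{\phi^\ast}_{\mathcal{F}}(\mathcal{E})$ with respect to the $w^\#_s$-topology is stably compact for the $w_s^\#$-topology.
   Context: $(\Omega,\mathcal{E},\mathbb{P})$ is a probability space and $\mathcal{F}\subset\mathcal{E}$ a sub-$\sigma$-algebra. Random variables and sets that coincide a.s. are identified; all (in)equalities between $\mathbb{R}\cup\{\pm\infty\}$-valued random variables are in the a.s. sense. $L^0(\mathcal{E})$ and $L^0(\mathcal{F})$ are the spaces of (classes of) real-valued $\mathcal{E}$-, resp. $\mathcal{F}$-measurable random variables; $L^0_{++}(\mathcal{F})$ is the set of $\eta\in L^0(\mathcal{F})$ with $\eta>0$ a.s. The conditional expectation is generalized: for $\eta\ge 0$, $\mathbb{E}[\eta|\mathcal{F}]:=\lim_n\mathbb{E}[\eta\wedge n|\mathcal{F}]$ (possibly $+\infty$), and $\mathbb{E}[\eta|\mathcal{F}]:=\mathbb{E}[\eta^+|\mathcal{F}]-\mathbb{E}[\eta^-|\mathcal{F}]$ with $+\infty-\infty=+\infty$. $\phi\colon[0,+\infty)\to[0,+\infty]$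 is a Young function: increasing, left-continuous, convex, finite on a neighborhood of $0$, $\phi(0)=0$, $\lim_{x\to+\infty}\phi(x)=+\infty$. Its conjugate Young function is $\phi^\ast(s):=\sup_{r\ge0}\{rs-\phi(r)\}$, $s\ge 0$. For a Young function $\psi$, $L^\psi_{\mathcal{F}}(\mathcal{E}):=\{x\in L^0(\mathcal{E}) : \exists\,\eta\in L^0_{++}(\mathcal{F}),\ \mathbb{E}[\psi(\eta|x|)|\mathcal{F}]\in L^0(\mathcal{F})\}$, an $L^0(\mathcal{F})$-submodule of $L^0(\mathcal{E})$. For $x\in L^\phi_{\mathcal{F}}(\mathcal{E})$, $y\in L^{\phi^\ast}_{\mathcal{F}}(\mathcal{E})$, $\mathbb{E}[|xy||\mathcal{F}]<+\infty$. Mixtures and stability: for a sequence $(x_k)$ in $L^0(\mathcal{E})$ and a countable partition $(A_k)\subset\mathcal{F}$ of $\Omega$, the mixture $\sum_k 1_{A_k}x_k$ is the a.s. limit of the partial sums. A non-empty set $S$ is $\mathcal{F}$-stable if it contains all mixtures $\sum_k1_{A_k}x_k$ with $(x_k)\subset S$ and $(A_k)\subset\mathcal{F}$ a countable partition of $\Omega$. For sets $U_k$, $\sum_k1_{A_k}U_k:=\{\sum_k1_{A_k}y_k : y_k\in U_k\ \forall k\}$. The $w_s^\#$-topology is the topology on $L^{\phi^\ast}_{\mathcal{F}}(\mathcal{E})$ having as base the sets $y_0+U$, where $y_0\in L^{\phi^\ast}_{\mathcal{F}}(\mathcal{E})$ and $U=\{y\in L^{\phi^\ast}_{\mathcal{F}}(\mathcal{E})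 : \sum_{k}1_{A_k}\operatorname{ess.sup}_{x\in F_k}|\mathbb{E}[xy|\mathcal{F}]|<\varepsilon\}$, with $(F_k)_{k\in\mathbb{N}}$ a sequence of non-empty finite subsets of $L^\phi_{\mathcal{F}}(\mathcal{E})$, $(A_k)_{k\in\mathbb{N}}\subset\mathcal{F}$ a countable partition of $\Omega$, and $\varepsilon\in L^0_{++}(\mathcal{F})$. An $\mathcal{F}$-stable filter base is a non-empty collection $\mathcal{B}$ of non-empty sets such that (i) for $U,V\in\mathcal{B}$ there is $W\in\mathcal{B}$ with $W\subset U\cap V$; (ii) each $U\in\mathcal{B}$ is $\mathcal{F}$-stable; (iii) $\sum_k1_{A_k}U_k\in\mathcal{B}$ whenever $(U_k)\subset\mathcal{B}$ and $(A_k)\subset\mathcal{F}$ is a countable partition of $\Omega$. A point $x$ is a cluster point of $\mathcal{B}$ if $x\in\mathrm{cl}(U)$ for every $U\in\mathcal{B}$. An $\mathcal{F}$-stable set $K$ is stably compact if every $\mathcal{F}$-stable filter base consisting of subsets of $K$ has a cluster point in $K$. *)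

(* Defs.v *)
From HB Require Import structures.
From mathcomp Require Import all_boot all_order all_algebra.
From mathcomp Require Import all_classical all_reals all_analysis.
From mathcomp Require Import measurable_realfun.

Set Implicit Arguments.
Unset Strict Implicit.
Unset Printing Implicit Defensive.

Import Order.TTheory GRing.Theory Num.Theory.
Import numFieldNormedType.Exports.

Local Open Scope classical_set_scope.
Local Open Scope ring_scope.

(* Only the restriction of [phi] to [0, +oo[ is meaningful: its values at
   negative arguments are never constrained nor used. *)
Record is_young (R : realType) (phi : R -> \bar R) : Prop := IsYoung {
  young_ge0 : forall x, 0 <= x -> (0 <= phi x)%E ;
  young_nd : forall x y, 0 <= x -> x <= y -> (phi x <= phi y)%E ;
  young_left_continuous : forall x, 0 < x -> phi y @[y --> x^'-] --> phi x ;
  young_convex : forall x y t, 0 <= x -> 0 <= y -> 0 <= t <= 1 ->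
    (phi (t * x + (1 - t) * y)%R <= t%:E * phi x + (1 - t)%:E * phi y)%E ;
  young_finite_near0 : \forall x \near 0^'+, (phi x < +oo)%E ;
  young0 : phi 0 = 0%E ;
  young_infty : phi x @[x --> +oo] --> +oo%E
}.

Definition young_conjugate (R : realType) (phi : R -> \bar R) (s : R) : \bar R :=
  ereal_sup [set ((r * s)%:E - phi r)%E | r in [set r : R | 0 <= r]].

(* [g_sigma_algebraType F] is T equipped with the sigma-algebra generated by F,
   which is F itself when F is a sigma-algebra *)
Definition measurable_wrt (T : pointedType) (F : set_system T) (d : measure_display)
    (U : measurableType d) (f : T -> U) : Prop :=
  measurable_fun [set: g_sigma_algebraType F] (f : g_sigma_algebraType F -> U).

Section conditional_expectation.
Context (R : realType) (d : measure_display) (T : measurableType d).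
Variables (P : probability T R) (F : set_system T).

Definition is_cond_exp (X Z : T -> \bar R) :=
  [/\ measurable_wrt F Z,
      P.-integrable [set: T] Z &
      forall A, F A -> (\int[P]_(t in A) Z t = \int[P]_(t in A) X t)%E].

(* a version of E[X | F] for an integrable X; one exists, and it is unique up to
   a.s. equality, when F is a sub-sigma-algebra *)
Definition cond_exp_integrable (X : T -> \bar R) : T -> \bar R :=
  xget (cst 0%E) [set Z | is_cond_exp X Z].

(* the a.s. limit of E[X /\ n | F] as n goes to infinity, for X >= 0 *)
Definition cond_exp_ge0 (X : T -> \bar R) (t : T) : \bar R :=
  limn (fun n => cond_exp_integrable (fun u => Order.min (X u) n%:R%:E) t).

(* [dual_adde] is the addition of \bar R such that +oo - oo = +oo *)
Definition cond_exp (X : T -> \bar R) (t : T) : \bar R :=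
  dual_adde (cond_exp_ge0 X^\+%E t) (- cond_exp_ge0 X^\-%E t)%E.

End conditional_expectation.

Section random_variables.
Context (R : realType) (d : measure_display) (T : measurableType d).
Variable P : probability T R.

(* a class modulo a.s. equality coerces to one of its representatives *)
Definition L0 : Type := {mfun_ P, T >-> R}.
HB.instance Definition _ := Choice.on L0.
Definition L0_fun (x : L0) : T -> R := aqEqMfun_to_fun x.
Coercion L0_fun : L0 >-> Funclass.

Definition is_ess_sup (G : set (T -> \bar R)) (Z : T -> \bar R) :=
  [/\ measurable_fun [set: T] Z,
      forall g, G g -> \forall t \ae P, (g t <= Z t)%E &
      forall Z', measurable_fun [set: T] Z' ->
        (forall g, G g -> \forall t \ae P, (g t <= Z' t)%E) ->
        \forall t \ae P, (Z t <= Z' t)%E].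

(* Extended real-valued families always have an essential supremum, unique up to
   a.s. equality. *)
Definition ess_sup_family (G : set (T -> \bar R)) : T -> \bar R :=
  xget (cst -oo%E) [set Z | is_ess_sup G Z].

Variable F : set_system T.

Definition L0F : set L0 :=
  [set x : L0 | exists2 f : T -> R,
     measurable_wrt F f &
     \forall t \ae P, x t = f t].

Definition L0Fpp : set L0 := [set x : L0 | L0F x /\ \forall t \ae P, 0 < x t].

(* The absolute value is taken around the whole product eta x because the
   chosen representative of eta may be negative on a null set, where
   eta |x| would leave the domain of psi. *)
Definition orlicz (psi : R -> \bar R) : set L0 :=
  [set x : L0 | exists2 eta : L0, L0Fpp eta &
    exists2 z : L0, L0F z &
      \forall t \ae P, cond_exp P F (fun u => psi `|eta u * x u|) t = (z t)%:E].

(* Blocks may be empty, so that finite partitions are included. *)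
Definition is_partition (A : nat -> set T) :=
  [/\ forall k, F (A k), trivIset [set: nat] A & \bigcup_k A k = [set: T]].

Definition is_mixture (A : nat -> set T) (x : nat -> L0) (z : L0) :=
  \forall t \ae P,
    (\sum_(0 <= k < n) \1_(A k) t * x k t) @[n --> \oo] --> (z t : R).

Definition mixture_set (A : nat -> set T) (U : nat -> set L0) : set L0 :=
  [set z : L0 | exists2 y : nat -> L0, forall k, U k (y k) & is_mixture A y z].

Definition is_stable (S : set L0) :=
  S !=set0 /\ forall A, is_partition A -> mixture_set A (fun=> S) `<=` S.

Definition is_stable_filter_base (B : set (set L0)) :=
  [/\ B !=set0,
      forall U, B U -> U !=set0,
      forall U V, B U -> B V -> exists2 W, B W & W `<=` U `&` V,
      forall U, B U -> is_stable U &
      forall A U, is_partition A -> (forall k, B (U k)) -> B (mixture_set A U)].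

End random_variables.

Section stable_weak_topology.
Context (R : realType) (d : measure_display) (T : measurableType d).
Variables (P : probability T R) (F : set_system T) (phi : R -> \bar R).

Local Notation Lphi := (@orlicz R d T P F phi).
Local Notation Lphi_conj := (@orlicz R d T P F (young_conjugate phi)).

Definition w_ball (G : nat -> set (L0 P)) (A : nat -> set T) (eps : L0 P)
    : set (L0 P) :=
  [set y : L0 P | Lphi_conj y /\ \forall t \ae P,
    (\sum_(k <oo) (\1_(A k) t)%:E *
       ess_sup_family P
         [set (fun u => `|cond_exp P F (fun v => (x v * y v)%:E) u|) | x in G k] t
     < (eps t)%:E)%E].

Definition translate (y0 : L0 P) (U : set (L0 P)) : set (L0 P) :=
  [set y : L0 P | exists2 u : L0 P, U u & \forall t \ae P, y t = y0 t + u t].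

Definition w_space : Type := {y : L0 P | y \in Lphi_conj}.

Definition w_base : set (set w_space) :=
  [set B | exists (y0 : w_space) G A eps,
    [/\ forall k, [/\ finite_set (G k), G k !=set0 & G k `<=` Lphi],
        is_partition F A, L0Fpp F eps &
        B = val @^-1` translate (val y0) (w_ball G A eps)]].

HB.instance Definition _ := Choice.on w_space.

(* The topology generated by [w_base]: the library's subbase construction does
   not require a proof that [w_base] is closed under local intersections. As
   [w_base] is a base, this is the topology whose open sets are the unions of
   its members. *)
HB.instance Definition _ :=
  @isSubBaseTopological.Build w_space (set w_space) w_base id.

Definition w_closure (S : set (L0 P)) : set (L0 P) :=
  val @` closure (val @^-1` S : set w_space).

Definition is_stably_compact (K : set (L0 P)) :=
  [/\ K `<=` Lphi_conj, is_stable F K &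
      forall B, is_stable_filter_base F B -> (forall U, B U -> U `<=` K) ->
        exists2 x, K x & forall U, B U -> w_closure U x].

Definition is_relatively_stably_compact (S : set (L0 P)) :=
  is_stably_compact (w_closure S).

End stable_weak_topology.

(* Main.v *)
(* Enlarge a stable filter base on the closure of [S] to a maximal stable one.
   Along the latter, each [y |-> E[x y | F]] converges to an F-measurable [f x],
   uniformly up to any strictly positive F-measurable error: the limit is the
   upper limit, because by maximality the stable set of those [y] for which
   [E[x y | F]] is close to it belongs to the filter. The map [f] is linear, local,
   and dominated by [Pi x], the essential supremum of [E[|x y| | F]] over [S], which
   vanishes along sequences decreasing to 0. Hence [A |-> E[f 1_A / (1 + Pi 1)]] is
   a finite signed measure absolutely continuous with respect to [P], and its
   Radon-Nikodym density times [1 + Pi 1] is a random variable [y] such that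
   [f x = E[x y | F]]. Such a [y] lies in the conditional Orlicz space of the
   conjugate function by a gliding hump argument: otherwise some [x] would have
   [E[|x y| | F] = +oo] with positive probability. This [y] is a cluster point. *)
Require Import Defs.
From HB Require Import structures.
From mathcomp Require Import all_boot all_order all_algebra.
From mathcomp Require Import all_classical all_reals all_analysis.
From mathcomp Require Import measurable_realfun ring lra.
Set Implicit Arguments.
Unset Strict Implicit.
Unset Printing Implicit Defensive.
Import Order.TTheory GRing.Theory Num.Theory.
Import numFieldNormedType.Exports.
Import HBNNSimple.
Local Open Scope classical_set_scope.
Local Open Scope ring_scope.

(** * Conditional expectation of nonnegative random variables *)

(** The obstacle throughout is null sets: an identity between pairings fails on a null set that
    depends on its arguments, while stable sets and filter bases are uncountable. Essential suprema
    are therefore attained along sequences, and the successes of countably many candidates are glued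
    over a partition in [F]; stability of sets and closure of the filter base under mixtures keep
    the glued objects inside. Identities for the limit are read along a sequence taken from the
    filter. Most computations use functions defined everywhere and an everywhere nonnegative version
    [CE] of the conditional expectation. Finiteness of [Pi x] comes from the hypothesis itself,
    applied to |x|/(n+1). The representation climbs from indicators by monotone convergence on the
    parts where y keeps its sign, because y is not yet known to lie in the dual space; the same
    argument shows that E[x|y| | F] is finite for every x >= 0 in the Orlicz space, which is the
    input of the gliding hump. *)

Lemma nnsfun_rect_indic d (T : measurableType d) (R : realType) (Q : (T -> R) -> Prop) :
  Q (cst 0) ->
  (forall (c : R) (A : set T) (g : T -> R), 0 <= c -> measurable A -> measurable_fun [set: T] g ->
    (forall t, 0 <= g t) -> Q g -> Q (fun t => c * \1_A t + g t)) ->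
  forall g : {nnsfun T >-> R}, Q g.
Proof.
move=> Q0 QD g.
have [s gE s0] : exists2 s : seq R,
    (g = (fun t => \sum_(y <- s) y * \1_(g @^-1` [set y]) t) :> (T -> R)) &
    forall y, y \in s -> 0 <= y.
  exists (finmap.enum_fset (fset_set (range g))).
    by apply/funext => t; rewrite {1}(fimfunE g t) fsbig_finite.
  by move=> y; rewrite in_fset_set// inE => -[t _ <-].
rewrite gE; elim: s s0 {gE} => [|y s ih] s0.
  by rewrite (_ : (fun _ => _) = cst 0)//; apply/funext => t; rewrite big_nil.
rewrite (_ : (fun _ => _) = (fun t => y * \1_(g @^-1` [set y]) t +
    \sum_(y <- s) y * \1_(g @^-1` [set y]) t)); last first.
  by apply/funext => t; rewrite big_cons.
apply: QD => //.
- by apply: s0; rewrite mem_head.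
- by apply: measurable_sum => z; apply: measurable_funM.
- move=> t; rewrite big_seq sumr_ge0// => z zs; rewrite mulr_ge0//.
  by apply: s0; rewrite inE zs orbT.
- by apply: ih => z zs; apply: s0; rewrite inE zs orbT.
Qed.

Section conditional_expectation_definition.
Context (R : realType) (d : measure_display) (T : measurableType d).
Variables (P : probability T R) (F : set_system T).
Local Open Scope ereal_scope.

(* an everywhere nonnegative and [F]-measurable version of [cond_exp_ge0] *)
Definition CE (X : T -> \bar R) : T -> \bar R :=
  xget (cst 0) [set Z | [/\ measurable_wrt F Z, forall t, 0 <= Z t &
    forall A, F A -> \int[P]_(t in A) Z t = \int[P]_(t in A) X t]].

End conditional_expectation_definition.

Section conditional_expectation.
Context (R : realType) (d : measure_display) (T : measurableType d).
Variables (P : probability T R) (F : set_system T).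
Hypotheses (sF : sigma_algebra [set: T] F) (FE : F `<=` measurable).
Local Notation mF := (measurable_wrt F).
Local Notation TF := (g_sigma_algebraType F).
Local Open Scope ereal_scope.

Lemma measurable_FE (A : set T) : (measurable (A : set TF)) = F A.
Proof. by rewrite -[in RHS](measurable_g_measurableTypeE sF). Qed.

Lemma measurable_fun_idF : measurable_fun [set: T] (id : T -> TF).
Proof. by move=> _ Y mY; rewrite setTI; apply: FE; rewrite -measurable_FE. Qed.

Lemma measurable_wrtW d' (U : measurableType d') (f : T -> U) :
  mF f -> measurable_fun [set: T] f.
Proof.
by move=> mf; apply: (@measurable_comp _ _ _ _ _ _ [set: TF]) mf measurable_fun_idF.
Qed.

(** Radon-Nikodym on [TF]: pushed forward along the identity from [T] to [TF], the probability and
    the charge with density [X] become their restrictions to [F], so the derivative is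
    [F]-measurable. *)
Lemma is_cond_exp_ex (X : T -> \bar R) : P.-integrable [set: T] X ->
  exists Z, is_cond_exp P F X Z.
Proof.
move=> iX.
pose idF : {mfun T >-> TF} := mfun_Sub (mem_set measurable_fun_idF).
pose nu' : {charge set TF -> \bar R} := pushforward (induced_charge iX) idF.
pose nu := nu' (measurable_funP idF).
pose mu : probability TF R := distribution P idF.
have numu : nu `<< mu.
  apply/null_content_dominatesP => A; rewrite measurable_FE => FA A0.
  apply: null_set_integral => //; first exact: FE.
  exact: measurable_funTS (measurable_int _ iX).
have iZ := Radon_Nikodym_integrable numu.
have mZ := measurable_int _ iZ.
set Z := Radon_Nikodym _ _ in iZ mZ.
have iZP : P.-integrable setT Z.
  apply/integrableP; split; first exact: measurable_wrtW.
  case/integrableP : iZ => _; rewrite ge0_integral_pushforward //.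
  by apply: measurableT_comp.
exists Z; split => // A FA.
have mA : measurable (A : set TF) by rewrite measurable_FE.
have := Radon_Nikodym_integral numu mA.
rewrite -/Z /mu /distribution integral_pushforward//=; last by apply: integrableS iZP => //; exact: FE.
exact: measurable_fun_idF.
Qed.

(** The event {Z' < Z} belongs to [F]; on it [Z - Z'] is positive with nonpositive integral, so the
    event is null. *)
Lemma integral_le_ae_le (Z Z' : T -> \bar R) :
  mF Z -> mF Z' -> P.-integrable [set: T] Z -> P.-integrable [set: T] Z' ->
  (forall A, F A -> \int[P]_(t in A) Z t <= \int[P]_(t in A) Z' t) ->
  \forall t \ae P, Z t <= Z' t.
Proof.
move=> mZ mZ' iZ iZ' ZZ'.
pose A := [set t | Z' t < Z t].
have FA : F A.
  rewrite -measurable_FE /A -[X in measurable X]setTI.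
  exact: (measurable_lte measurableT mZ' mZ).
have mA := FE FA.
have {}iZ : P.-integrable A Z by exact: integrableS iZ.
have {}iZ' : P.-integrable A Z' by exact: integrableS iZ'.
have /(ae_eq_integral_abs P mA) : \int[P]_(t in A) `|Z t - Z' t| = 0.
  apply/eqP; rewrite eq_le integral_ge0// andbT.
  rewrite (_ : \int[P]_(t in A) _ = \int[P]_(t in A) (Z \- Z') t); last first.
    apply: eq_integral => t /set_mem At /=; rewrite gee0_abs//.
    by rewrite ltW// sube_gt0.
  rewrite integralB// sube_le0 ?ZZ'//; exact: integrable_fin_num.
move=> /(_ (emeasurable_funB (measurable_int _ iZ) (measurable_int _ iZ'))).
apply: filterS => t h; rewrite leNgt; apply/negP => h2; have /eqP := h h2.
by apply/negP; rewrite gt_eqF// sube_gt0.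
Qed.

(** Reduces to the integrable case on the events {Z' <= n}, where both integrals are finite; where
    [Z'] is infinite there is nothing to show. *)
Lemma ge0_integral_le_ae_le (Z Z' : T -> \bar R) : mF Z -> mF Z' ->
  (forall t, 0 <= Z t) -> (forall t, 0 <= Z' t) ->
  (forall A, F A -> \int[P]_(t in A) Z t <= \int[P]_(t in A) Z' t) ->
  \forall t \ae P, Z t <= Z' t.
Proof.
move=> mZ mZ' Z0 Z'0 ZZ'.
pose B (n : nat) := [set t | Z' t <= n%:R%:E].
have FB n : F (B n).
  rewrite -measurable_FE -[X in measurable X]setTI.
  exact: (measurable_lee measurableT mZ' (measurable_cst _)).
have mB n := FE (FB n).
have iB n : \int[P]_(t in B n) Z' t < +oo.
  apply: (@le_lt_trans _ _ (\int[P]_(t in B n) cst n%:R%:E t)).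
    by apply: ge0_le_integral => //; exact/measurable_funTS/measurable_wrtW.
  by rewrite integral_cst// lte_mul_pinfty// -ge0_fin_numE// fin_num_measure.
have resB n g : mF g -> mF (g \_ (B n)).
  by move=> mg; apply/(measurable_restrictT _ _).1; [rewrite measurable_FE|exact: measurable_funTS].
have irB n g : mF g -> (forall t, 0 <= g t) -> \int[P]_(t in B n) g t < +oo ->
    P.-integrable setT (g \_ (B n)).
  move=> mg g0 ig; apply/integrableP; split; first by apply: measurable_wrtW; exact: resB.
  rewrite (_ : integral _ _ _ = \int[P]_(t in B n) g t)// [RHS]integral_mkcond.
  by apply: eq_integral => t _; rewrite gee0_abs// erestrict_ge0.
have aen n : \forall t \ae P, B n t -> Z t <= Z' t.
  have : \forall t \ae P, (Z \_ (B n)) t <= (Z' \_ (B n)) t.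
    apply: integral_le_ae_le; [exact: resB|exact: resB|apply: irB => //|exact: irB|].
      by rewrite (le_lt_trans _ (iB n))// ZZ'.
    move=> A FA; rewrite -!integral_mkcondr; apply: ZZ'.
    by rewrite -measurable_FE; apply: measurableI; rewrite measurable_FE.
  by apply: filterS => t + Bt; rewrite !patchE mem_set.
apply: filterS (ae_foralln aen) => t h.
have [|] := ltP (Z' t) +oo; last by rewrite leye_eq => /eqP ->; rewrite leey.
rewrite -ge0_fin_numE// => /fineK Z't.
apply: (h (Num.bound (fine (Z' t)))); rewrite /B /= -Z't lee_fin ltW//.
exact/archi_boundP/fine_ge0.
Qed.

(** The sequence increases only almost surely. Its running maxima [W], started at 0, increase
    everywhere, stay [F]-measurable and differ from it on a null set, so ordinary monotone
    convergence applies to them. *)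
Lemma ae_nondecreasing_limit (C : (T -> \bar R)^nat) : (forall n, mF (C n)) ->
  (\forall t \ae P, forall n, 0 <= C n t <= C n.+1 t) ->
  exists Z, [/\ mF Z, forall t, 0 <= Z t,
    \forall t \ae P, C ^~ t @ \oo --> Z t &
    forall A, F A ->
      \int[P]_(t in A) C n t @[n --> \oo] --> \int[P]_(t in A) Z t].
Proof.
move=> mC Cnd.
pose fix W (n : nat) t {struct n} := if n is m.+1 then maxe (W m t) (C n t) else maxe 0 (C 0%N t).
have WS n t : W n.+1 t = maxe (W n t) (C n.+1 t) by [].
have W_ge0 n t : 0 <= W n t.
  by elim: n => [|n ih]; rewrite ?WS le_max ?lexx// ih.
have W_nd t : nondecreasing_seq (W ^~ t).
  by apply/nondecreasing_seqP => n; rewrite WS le_max lexx.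
have WC : \forall t \ae P, forall n, W n t = C n t.
  apply: filterS Cnd => t h; elim => [|n ih]; apply/max_r.
    by have /andP[] := h 0%N.
  by rewrite -/W ih; have /andP[] := h n.
have mW n : mF (W n).
  elim: n => [|n ih]; apply: measurable_maxe;
    [exact: measurable_cst|exact: mC|exact: ih|exact: mC].
pose Z t := ereal_sup (range (W ^~ t)).
have cvgW t : W ^~ t @ \oo --> Z t by exact: ereal_nondecreasing_cvgn.
exists Z; split.
- by apply: (@emeasurable_fun_cvg _ TF R setT W) => // t _; exact: cvgW.
- by move=> t; apply: le_trans (W_ge0 0%N t) _; apply: ereal_sup_ubound; exists 0%N.
- by apply: filterS WC => t h; under eq_fun do rewrite -h; exact: cvgW.
move=> A FA; have mA := FE FA.
rewrite (_ : (fun n => _) = (fun n => \int[P]_(t in A) W n t)); last first.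
  apply/funext => n; apply: ae_eq_integral => //.
  - by apply: measurable_funTS; exact: measurable_wrtW.
  - by apply: measurable_funTS; exact: measurable_wrtW.
  - by apply: filterS WC => t h _; rewrite h.
rewrite (_ : Z = fun t => limn (W ^~ t)); last first.
  by apply/funext => t; apply/esym/cvg_lim => //; exact: cvgW.
apply: cvg_monotone_convergence => //.
by move=> n; apply: measurable_funTS; exact: measurable_wrtW.
Qed.

Section existence.
Variable X : T -> \bar R.
Hypotheses (mX : measurable_fun [set: T] X) (X0 : forall t, 0 <= X t).

Let Xn n u := mine (X u) n%:R%:E.
Let Z n := cond_exp_integrable P F (Xn n).

Let mXn n : measurable_fun [set: T] (Xn n).
Proof. exact: measurable_mine. Qed.

Let Xn0 n t : 0 <= Xn n t.
Proof. by rewrite le_min X0/= lee_fin. Qed.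

Let iXn n : P.-integrable [set: T] (Xn n).
Proof.
apply: (le_integrable measurableT _ _ (finite_measure_integrable_cst P n%:R measurableT)) => //.
by move=> t _; rewrite !gee0_abs ?lee_fin// ge_min lexx orbT.
Qed.

Let ceZ n : is_cond_exp P F (Xn n) (Z n).
Proof. exact: (xgetPex (cst 0) (is_cond_exp_ex (iXn n))). Qed.

Let Z_ge0 : \forall t \ae P, forall n, 0 <= Z n t.
Proof.
apply: ae_foralln => n; have [mZ iZ ZE] := ceZ n.
apply: (integral_le_ae_le (measurable_cst 0) mZ (integrable0 _ _) iZ) => A FA.
by rewrite (ZE _ FA) integral0 integral_ge0.
Qed.

Let Z_nd : \forall t \ae P, forall n, Z n t <= Z n.+1 t.
Proof.
apply: ae_foralln => n; have [mZ iZ ZE] := ceZ n; have [mZ' iZ' ZE'] := ceZ n.+1.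
apply: (integral_le_ae_le mZ mZ' iZ iZ') => A FA; rewrite (ZE _ FA) (ZE' _ FA).
apply: ge0_le_integral => //; [exact: FE|exact: measurable_funTS|exact: measurable_funTS|].
by move=> t _; rewrite le_min !ge_min lexx/= lee_fin ler_nat leqnSn orbT.
Qed.

(** Monotone convergence is used twice, for the truncations of [X] and for their conditional
    expectations: the limit in [cond_exp_ge0] thus has the integrals of [X] over [F]. *)
Let exCE : exists Z, [/\ mF Z, forall t, 0 <= Z t,
  \forall t \ae P, cond_exp_ge0 P F X t = Z t &
  forall A, F A -> \int[P]_(t in A) Z t = \int[P]_(t in A) X t].
Proof.
have [||Z' [mZ Z0 ZZ' iZ]] := @ae_nondecreasing_limit Z.
- by move=> n; have [] := ceZ n.
- by apply: filterS2 Z_ge0 Z_nd => t h0 h1 n; rewrite h0 h1.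
exists Z'; split => //.
  by apply: filterS ZZ' => t h; exact/cvg_lim.
move=> A FA; have mA := FE FA.
have hX : \int[P]_(t in A) Xn n t @[n --> \oo] --> \int[P]_(t in A) X t.
  rewrite [in X in _ --> X](_ : X = fun t => limn (Xn ^~ t)); last first.
    apply/funext => t; apply/esym/cvg_lim => //.
    have [|] := ltP (X t) +oo; last first.
      rewrite leye_eq => /eqP Xt; rewrite /Xn Xt.
      rewrite (_ : (fun _ => _) = (fun n => n%:R%:E)); first exact/cvgenyP.
      by apply/funext => n; apply/min_r; rewrite leey.
    rewrite -ge0_fin_numE// => /fineK Xt.
    apply: cvg_near_cst; near=> n; apply/min_l; rewrite -Xt lee_fin.
    by near: n; exact: nbhs_infty_ger.
  apply: cvg_monotone_convergence => //.
  - by move=> n; apply: measurable_funTS.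
  - move=> t _; apply/nondecreasing_seqP => n.
    by rewrite le_min !ge_min lexx/= lee_fin ler_nat leqnSn orbT.
apply: cvg_unique (iZ _ FA) _ => //.
rewrite (_ : (fun n => _) = (fun n => \int[P]_(t in A) Xn n t))//.
by apply/funext => n; have [_ _ ->] := ceZ n.
Unshelve. all: by end_near.
Qed.

Let CEspec : [/\ mF (CE P F X), forall t, 0 <= CE P F X t &
    forall A, F A -> \int[P]_(t in A) CE P F X t = \int[P]_(t in A) X t].
Proof.
have [Y [mY Y0 _ YX]] := exCE.
pose G := [set Z | [/\ mF Z, forall t, 0 <= Z t &
    forall A, F A -> \int[P]_(t in A) Z t = \int[P]_(t in A) X t]].
have : G (CE P F X) by apply: xgetPex; exists Y.
by [].
Qed.

Lemma measurable_CE : mF (CE P F X). Proof. by case: CEspec. Qed.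

Lemma CE_ge0 t : 0 <= CE P F X t. Proof. by case: CEspec. Qed.

Lemma integral_CE A : F A -> \int[P]_(t in A) CE P F X t = \int[P]_(t in A) X t.
Proof. by case: CEspec => _ _; exact. Qed.

Lemma CE_unique (Y : T -> \bar R) : mF Y -> (forall t, 0 <= Y t) ->
  (forall A, F A -> \int[P]_(t in A) Y t = \int[P]_(t in A) X t) ->
  \forall t \ae P, CE P F X t = Y t.
Proof.
move=> mY Y0 YX; have [mC C0 CX] := CEspec.
have le1 : \forall t \ae P, CE P F X t <= Y t.
  by apply: ge0_integral_le_ae_le => // A FA; rewrite CX// YX.
have le2 : \forall t \ae P, Y t <= CE P F X t.
  by apply: ge0_integral_le_ae_le => // A FA; rewrite CX// YX.
by apply: filterS2 le1 le2 => t h1 h2; apply/eqP; rewrite eq_le h1.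
Qed.

Lemma cond_exp_ge0E : \forall t \ae P, cond_exp_ge0 P F X t = CE P F X t.
Proof.
have [Y [mY Y0 + YX]] := exCE; have := CE_unique mY Y0 YX.
by apply: filterS2 => t -> ->.
Qed.

End existence.

Lemma CE_le (X Y : T -> \bar R) : measurable_fun [set: T] X ->
  measurable_fun [set: T] Y -> (forall t, 0 <= X t) -> (forall t, 0 <= Y t) ->
  (\forall t \ae P, X t <= Y t) -> \forall t \ae P, CE P F X t <= CE P F Y t.
Proof.
move=> mX mY X0 Y0 XY; apply: ge0_integral_le_ae_le;
  [exact: measurable_CE|exact: measurable_CE|exact: CE_ge0|exact: CE_ge0|].
move=> A FA; have mA := FE FA; rewrite !integral_CE//.
apply: ae_ge0_le_integral => //; [exact: measurable_funTS|exact: measurable_funTS|].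
by apply: filterS XY.
Qed.

Lemma CE_ae_eq (X Y : T -> \bar R) : measurable_fun [set: T] X ->
  measurable_fun [set: T] Y -> (forall t, 0 <= X t) -> (forall t, 0 <= Y t) ->
  (\forall t \ae P, X t = Y t) -> \forall t \ae P, CE P F X t = CE P F Y t.
Proof.
move=> mX mY X0 Y0 XY.
have h1 : \forall t \ae P, CE P F X t <= CE P F Y t.
  by apply: CE_le => //; apply: filterS XY => t ->.
have h2 : \forall t \ae P, CE P F Y t <= CE P F X t.
  by apply: CE_le => //; apply: filterS XY => t ->.
by apply: filterS2 h1 h2 => t a b; apply/eqP; rewrite eq_le a.
Qed.

Lemma CE_add (X Y : T -> \bar R) : measurable_fun [set: T] X ->
  measurable_fun [set: T] Y -> (forall t, 0 <= X t) -> (forall t, 0 <= Y t) ->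
  \forall t \ae P, CE P F (fun u => X u + Y u) t = CE P F X t + CE P F Y t.
Proof.
move=> mX mY X0 Y0; apply: CE_unique.
- exact: emeasurable_funD.
- by move=> t; rewrite adde_ge0.
- by apply: emeasurable_funD; exact: measurable_CE.
- by move=> t; rewrite adde_ge0// CE_ge0.
move=> A FA; have mA := FE FA.
rewrite !ge0_integralD//; first by rewrite !integral_CE.
all: try by [move=> t _; exact: CE_ge0|exact: measurable_funTS].
all: by apply: measurable_funTS; apply: measurable_wrtW; exact: measurable_CE.
Qed.

(* integrals against an F-measurable weight only depend on the restriction of
   the integrating measure to F *)
Lemma CE_pull (h X : T -> \bar R) : measurable_fun [set: T] X ->
  (forall t, 0 <= X t) -> mF h -> (forall t, 0 <= h t) ->
  \forall t \ae P, CE P F (fun u => h u * X u) t = h t * CE P F X t.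
Proof.
move=> mX X0 mh h0.
have mC := measurable_CE mX X0; have C0 := CE_ge0 mX X0.
have mh' := measurable_wrtW mh; have mC' := measurable_wrtW mC.
apply: CE_unique.
- exact: emeasurable_funM.
- by move=> t; rewrite mule_ge0.
- exact: emeasurable_funM.
- by move=> t; rewrite mule_ge0.
move=> A FA; have mA := FE FA.
(* [F]-measurable simple functions increasing to [h] reduce the claim, on both sides, to weights c
   1_B with B in [F], where it is the defining property of [CE] on the intersection of A and B. *)
pose g := nnsfun_approx (@measurableT _ TF) mh.
have mg n : mF (g n) by exact: measurable_funP.
have gcvg (Y : T -> \bar R) : measurable_fun setT Y -> (forall t, 0 <= Y t) ->
    \int[P]_(t in A) ((g n t)%:E * Y t) @[n --> \oo] -->
    \int[P]_(t in A) (h t * Y t).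
  move=> mY Y0.
  have nd t : nondecreasing_seq (fun n => (g n t)%:E * Y t).
    move=> a b ab; rewrite lee_wpmul2r// lee_fin.
    exact/lefP/nd_nnsfun_approx.
  rewrite (_ : (fun t => h t * Y t) = (fun t => limn (fun n => (g n t)%:E * Y t))).
    apply: cvg_monotone_convergence => //.
    - move=> n; apply: measurable_funTS; apply: emeasurable_funM => //.
      by apply/measurable_EFinP; exact: measurable_wrtW.
    - by move=> n t _; rewrite mule_ge0// lee_fin.
  apply/funext => t; apply/esym/cvg_lim => //.
  have gh : (g n t)%:E @[n --> \oo] --> h t by exact: cvg_nnsfun_approx.
  (* Multiplication of extended reals is not continuous at 0 times infinity, so the points where a
     factor vanishes are treated apart. *)
  have [Yt|Yt] := eqVneq (Y t) 0.
    by rewrite Yt mule0; under eq_fun do rewrite mule0; exact: cvg_cst.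
  have [ht|ht] := eqVneq (h t) 0.
    rewrite ht mul0e (_ : (fun n => _) = cst 0); first exact: cvg_cst.
    apply/funext => n /=; rewrite (_ : (g n t)%:E = 0) ?mul0e//.
    apply/eqP; rewrite eq_le; apply/andP; split; last by rewrite lee_fin.
    have := @le_approx _ TF R setT h n t (fun t _ => h0 t) Logic.I.
    by rewrite ht -nnsfun_approxE.
  apply: (cvgeM _ gh (cvg_cst (Y t))).
  by rewrite mule_defE (negbTE Yt) (negbTE ht).

apply: cvg_unique (gcvg _ mC' C0) _ => //.
rewrite (_ : (fun n => _) = (fun n => \int[P]_(t in A) ((g n t)%:E * X t))).
  exact: gcvg.
apply/funext => n; move: A FA mA {gcvg}.
pose Q (u : T -> R) := forall A, F A -> measurable A ->
  \int[P]_(t in A) ((u t)%:E * CE P F X t) = \int[P]_(t in A) ((u t)%:E * X t).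
have : Q (g n); last by [].
apply: (@nnsfun_rect_indic _ TF).
  by move=> A FA mA; apply: eq_integral => t _; rewrite !mul0e.
move=> c B u c0; rewrite measurable_FE => FB /measurable_wrtW mu u0 ih A FA mA.
have step (Y : T -> \bar R) : measurable_fun setT Y -> (forall t, 0 <= Y t) ->
    \int[P]_(t in A) ((c * \1_B t + u t)%:E * Y t) =
    c%:E * \int[P]_(t in A `&` B) Y t + \int[P]_(t in A) ((u t)%:E * Y t).
  move=> mY Y0.
  have mB := FE FB.
  have mYB : measurable_fun A (Y \_ B).
    by apply: measurable_funTS; apply/(measurable_restrictT _ _).1 => //; exact: measurable_funTS.
  have YB0 t : 0 <= (Y \_ B) t by exact: erestrict_ge0.
  rewrite integral_mkcondr -ge0_integralZl// -ge0_integralD//.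
  - apply: eq_integral => t _; rewrite EFinD ge0_muleDl ?lee_fin ?mulr_ge0//.
    congr (_ + _); rewrite patchE indicE; case: ifPn => tB; first by rewrite mulr1.
    by rewrite mulr0 mul0e mule0.
  - by move=> t _; rewrite mule_ge0// lee_fin.
  - by apply: measurable_funeM.
  - by move=> t _; rewrite mule_ge0// lee_fin.
  - apply: emeasurable_funM; last exact: measurable_funTS.
    by apply/measurable_EFinP; exact: measurable_funTS.
rewrite !step// ih// integral_CE//.
by rewrite -measurable_FE; apply: measurableI; rewrite measurable_FE.
Qed.

(** Multiplied by the indicator of [A] the two functions coincide, and [CE_pull] takes the indicator
    out. *)
Lemma CE_local (X Y : T -> \bar R) A : measurable_fun [set: T] X ->
  measurable_fun [set: T] Y -> (forall t, 0 <= X t) -> (forall t, 0 <= Y t) ->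
  F A -> (forall t, A t -> X t = Y t) ->
  \forall t \ae P, A t -> CE P F X t = CE P F Y t.
Proof.
move=> mX mY X0 Y0 FA XY.
have mI : mF (fun t => (\1_A t)%:E : \bar R).
  by apply/measurable_EFinP; apply: measurable_indic; rewrite measurable_FE.
have I0 t : 0 <= (\1_A t)%:E :> \bar R by rewrite lee_fin.
have := CE_pull mX X0 mI I0; have := CE_pull mY Y0 mI I0.
apply: filterS2 => t.
rewrite (_ : (fun u => (\1_A u)%:E * X u) = (fun u => (\1_A u)%:E * Y u)); last first.
  apply/funext => u; rewrite indicE; case: (boolP (u \in A)) => uA; last by rewrite !mul0e.
  by rewrite XY//; exact: set_mem.
by move=> -> + At; rewrite indicE mem_set// !mul1e.
Qed.

(** The a.s. limit of the conditional expectations has the integrals of [Y] over [F], so uniqueness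
    identifies it. *)
Lemma CE_sup (X : (T -> \bar R)^nat) (Y : T -> \bar R) :
  (forall n, measurable_fun [set: T] (X n)) -> measurable_fun [set: T] Y ->
  (forall n t, 0 <= X n t) -> (forall t, nondecreasing_seq (X ^~ t)) ->
  (forall t, X ^~ t @ \oo --> Y t) ->
  \forall t \ae P, CE P F (X n) t @[n --> \oo] --> CE P F Y t.
Proof.
move=> mX mY X0 ndX XY.
have Y0 t : 0 <= Y t.
  by apply: cvge_ge (XY t); apply: nearW.
have [||Z [mZ Z0 XZ iZ]] := @ae_nondecreasing_limit (fun n => CE P F (X n)).
- by move=> n; exact: measurable_CE.
- apply: ae_foralln => n.
  have : \forall t \ae P, CE P F (X n) t <= CE P F (X n.+1) t.
    by apply: CE_le => //; apply: aeW => t; exact: ndX.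
  by apply: filterS => t ->; rewrite CE_ge0.
have : \forall t \ae P, CE P F Y t = Z t.
  apply: CE_unique => // A FA.
  apply: cvg_unique (iZ _ FA) _ => //.
  rewrite (_ : (fun n => _) = (fun n => \int[P]_(t in A) X n t)); last first.
    by apply/funext => n; rewrite integral_CE.
  rewrite (_ : Y = fun t => limn (X ^~ t)); last first.
    by apply/funext => t; apply/esym/cvg_lim => //; exact: XY.
  apply: cvg_monotone_convergence => //; first exact: FE.
  by move=> n; exact: measurable_funTS.
by apply: filterS2 XZ => t + ->.
Qed.

End conditional_expectation.

(** * Real-valued conditional expectation *)

(** The map r |-> psi (max r 0) is monotone on the whole line, so preimages of rays are intervals.
    The truncation is there because [psi] is controlled on nonnegative arguments only. *)
Lemma measurable_comp_nondecreasing d (T : measurableType d) (R : realType)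
    (psi : R -> \bar R) (g : T -> R) :
  (forall x y, 0 <= x -> x <= y -> (psi x <= psi y)%E) ->
  measurable_fun [set: T] g ->
  measurable_fun [set: T] (fun t => psi `|g t|).
Proof.
move=> nd mg.
suff mpsi : measurable_fun [set: R] (fun r => psi (Num.max r 0)).
  rewrite (_ : (fun t => _) = (fun r => psi (Num.max r 0)) \o (fun t => `|g t|)).
    by apply: measurableT_comp => //; exact: measurableT_comp.
  by apply/funext => t /=; rewrite max_l.
move=> mD; apply: (measurability _ (ErealGenOInfty.measurableE R)) => //.
move=> _ [_ [x ->] <-]; rewrite setTI; apply: is_interval_measurable.
move=> a b /= xa _ c /andP[ac _]; move: xa; rewrite /= !in_itv/= !andbT.
move=> /lt_le_trans; apply; apply: nd; first by rewrite le_max lexx orbT.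
by rewrite ge_max !le_max ac lexx !orbT.
Qed.

(** * Countable partitions and pasting of functions *)

Section partition.
Context (d : measure_display) (T : measurableType d).
Variable F : set_system T.
Implicit Types A : nat -> set T.

Definition block A (t : T) : nat := xget 0%N [set k | A k t].

Lemma block_mem A t : is_partition F A -> A (block A t) t.
Proof.
move=> [_ _ cA]; have [k _ Akt] : (\bigcup_k A k) t by rewrite cA.
exact: (xgetPex 0%N (ex_intro [set k | A k t] k Akt)).
Qed.

Lemma block_uniq A t k : is_partition F A -> A k t -> block A t = k.
Proof.
move=> pA Akt; have [_ tA _] := pA.
by apply: (tA _ _ Logic.I Logic.I); exists t; split => //; exact: block_mem.
Qed.

(** Pointwise counterpart of a mixture, defined at every point without a series or an exceptional
    null set. *)
Definition paste A (U : Type) (g : nat -> T -> U) (t : T) : U := g (block A t) t.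

Lemma pasteE A (U : Type) (g : nat -> T -> U) k t :
  is_partition F A -> A k t -> paste A g t = g k t.
Proof. by move=> pA Akt; rewrite /paste (block_uniq pA Akt). Qed.

Lemma preimage_paste A (U : Type) (g : nat -> T -> U) (B : set U) :
  is_partition F A -> paste A g @^-1` B = \bigcup_k (A k `&` g k @^-1` B).
Proof.
move=> pA; apply/seteqP; split => t /=.
  by move=> Bg; exists (block A t) => //; split => //; exact: block_mem.
by move=> [k _ [Akt /= Bg]]; rewrite (pasteE _ pA Akt).
Qed.

End partition.

(** * Real-valued conditional expectation and its additivity *)

Section real_conditional_expectation.
Context (R : realType) (d : measure_display) (T : measurableType d).
Variables (P : probability T R) (F : set_system T).
Hypotheses (sF : sigma_algebra [set: T] F) (FE : F `<=` measurable).
Local Notation mF := (measurable_wrt F).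
Local Notation TF := (g_sigma_algebraType F).
Local Notation CE := (CE P F).
Implicit Types (X Y U V : T -> R) (A : nat -> set T).

Lemma measurable_paste d' (S : measurableType d') A (g : nat -> T -> S) :
  is_partition F A -> (forall k, measurable_fun [set: T] (g k)) ->
  measurable_fun [set: T] (paste A g).
Proof.
move=> pA mg _ B mB; rewrite setTI (preimage_paste _ _ pA).
apply: bigcup_measurable => k _; apply: measurableI; first by have [FA _ _] := pA; exact/FE.
by rewrite -[X in measurable X]setTI; exact: mg.
Qed.

Lemma measurable_wrt_paste d' (S : measurableType d') A (g : nat -> T -> S) :
  is_partition F A -> (forall k, mF (g k)) -> mF (paste A g).
Proof.
move=> pA mg _ B mB; rewrite setTI (preimage_paste _ _ pA).
apply: bigcup_measurable => k _; apply: measurableI.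
  by have [FA _ _] := pA; rewrite measurable_FE.
by rewrite -[X in measurable X]setTI; exact: mg.
Qed.

(* [A] selects the first of the events [C k] that occurs. *)
Lemma first_partition (C : nat -> set T) : (forall k, F (C k)) ->
  (\forall t \ae P, exists k, C k t) ->
  exists2 A, is_partition F A & \forall t \ae P, forall k, A k t -> C k t.
Proof.
(* The blocks have to exhaust the whole space, so the null set missed by all [C k] is added to the
   first event. *)
move=> FC cC; pose C' k := if k is 0%N then C 0%N `|` ~` \bigcup_k C k else C k.
have FC' k : F (C' k).
  rewrite -(measurable_FE sF); have mC j : measurable (C j : set TF) by rewrite measurable_FE.
  case: k => [|k]//=; apply: measurableU => //; apply: measurableC.
  by apply: bigcup_measurable => j _.
exists (seqDU C').
  split => [k||].
  - rewrite -(measurable_FE sF); apply: measurableD; first by rewrite measurable_FE.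
    by apply: bigsetU_measurable => j _; rewrite measurable_FE.
  - exact: trivIset_seqDU.
  - rewrite -seqDU_bigcup_eq; apply/seteqP; split => // t _.
    have [[k _ Ckt]|nC] := pselect ((\bigcup_k C k) t).
      by exists k => //; case: k Ckt => //= C0; left.
    by exists 0%N => //; right.
apply: filterS cC => t [j Cjt] k; rewrite /seqDU => -[C'k _].
by case: k C'k => //= -[//|]; case; exists j.
Qed.

Lemma measurable_EFin_abs X : measurable_fun [set: T] X ->
  measurable_fun [set: T] (fun t => `|X t|%:E).
Proof. by move=> mX; apply/measurable_EFinP; exact: measurableT_comp. Qed.

Lemma measurable_EFin_pos X : measurable_fun [set: T] X ->
  measurable_fun [set: T] (fun t => (Num.max (X t) 0)%:E).
Proof. by move=> mX; apply/measurable_EFinP; exact: measurable_maxr. Qed.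

(** [fine] makes this real at every point; it is the conditional expectation, almost surely, when
    [X] is [cond_integrable]. *)
Definition condR X t := fine (CE (fun u => (Num.max (X u) 0)%:E) t) -
  fine (CE (fun u => (Num.max (- X u) 0)%:E) t).

Definition cond_integrable X := measurable_fun [set: T] X /\
  \forall t \ae P, (CE (fun u => `|X u|%:E) t < +oo)%E.

Local Notation CEr U := (CE (fun u => (U u)%:E)).

Lemma cond_integrableW X Y : measurable_fun [set: T] X ->
  (\forall t \ae P, `|X t| <= `|Y t|) -> cond_integrable Y -> cond_integrable X.
Proof.
move=> mX XY [mY iY]; split => //.
have : \forall t \ae P, (CE (fun u => `|X u|%:E) t <= CE (fun u => `|Y u|%:E) t)%E.
  by apply: CE_le => //; exact: measurable_EFin_abs.
by apply: filterS2 iY => t iY /le_lt_trans; apply.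
Qed.

(** From X = U - V follows X^+ + V = U + X^-, a relation between nonnegative functions; additivity
    of [CE] and finiteness of the four terms allow it to be rearranged. So any such decomposition
    computes [condR], not only the one into positive and negative parts. *)
Lemma condR_diff X U V : measurable_fun [set: T] X -> measurable_fun [set: T] U ->
  measurable_fun [set: T] V -> (forall t, 0 <= U t) -> (forall t, 0 <= V t) ->
  (\forall t \ae P, (CEr U t < +oo)%E) -> (\forall t \ae P, (CEr V t < +oo)%E) ->
  (\forall t \ae P, X t = U t - V t) ->
  \forall t \ae P, condR X t = fine (CEr U t) - fine (CEr V t).
Proof.
move=> mX mU mV U0 V0 iU iV XE.
have U0' t : (0 <= (U t)%:E)%E by rewrite lee_fin.
have V0' t : (0 <= (V t)%:E)%E by rewrite lee_fin.
have mP := measurable_EFin_pos mX.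
have mN := measurable_EFin_pos (measurableT_comp (@oppr_measurable R setT) mX).
have {}mU : measurable_fun [set: T] (fun t => (U t)%:E) by apply/measurable_EFinP.
have {}mV : measurable_fun [set: T] (fun t => (V t)%:E) by apply/measurable_EFinP.
have P0 t : (0 <= (Num.max (X t) 0)%:E)%E by rewrite lee_fin le_max lexx orbT.
have N0 t : (0 <= (Num.max (- X t) 0)%:E)%E by rewrite lee_fin le_max lexx orbT.
have lP : \forall t \ae P, (CE (fun u => (Num.max (X u) 0)%:E) t <= CEr U t)%E.
  apply: CE_le => //; apply: filterS XE => t ->; rewrite lee_fin ge_max U0 andbT.
  by rewrite lerBlDr lerDl.
have lN : \forall t \ae P, (CE (fun u => (Num.max (- X u) 0)%:E) t <= CEr V t)%E.
  apply: CE_le => //; apply: filterS XE => t ->; rewrite lee_fin ge_max V0 andbT.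
  by rewrite opprB lerBlDr lerDl.
have hE : \forall t \ae P, ((Num.max (X t) 0)%:E + (V t)%:E = (U t)%:E + (Num.max (- X t) 0)%:E)%E.
  apply: filterS XE => t h; rewrite -!EFinD; congr EFin.
  have [X0|X0] := leP 0 (X t).
    by rewrite max_r ?oppr_le0// addr0 h subrK.
  by rewrite max_l ?oppr_ge0 ?ltW// add0r h opprB addrC subrK.
have hCE := CE_ae_eq sF FE (emeasurable_funD mP mV) (emeasurable_funD mU mN)
  (fun t => adde_ge0 (P0 t) (V0' t)) (fun t => adde_ge0 (U0' t) (N0 t)) hE.
have hPV := CE_add P sF FE mP mV P0 V0'.
have hUN := CE_add P sF FE mU mN U0' N0.
near=> t.
have : (CE (fun u => (Num.max (X u) 0)%:E) t + CEr V t =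
    CEr U t + CE (fun u => (Num.max (- X u) 0)%:E) t)%E.
  transitivity (CE (fun u => (Num.max (X u) 0)%:E + (V u)%:E)%E t).
    by apply/esym; near: t.
  transitivity (CE (fun u => (U u)%:E + (Num.max (- X u) 0)%:E)%E t); last by near: t.
  by near: t.
have fU : CEr U t \is a fin_num.
  by rewrite ge0_fin_numE; [near: t|exact: CE_ge0].
have fV : CEr V t \is a fin_num.
  by rewrite ge0_fin_numE; [near: t|exact: CE_ge0].
have fP : CE (fun u => (Num.max (X u) 0)%:E) t \is a fin_num.
  rewrite ge0_fin_numE; last exact: CE_ge0.
  by apply: (@le_lt_trans _ _ (CEr U t)); [near: t; exact: lP|near: t; exact: iU].
have fN : CE (fun u => (Num.max (- X u) 0)%:E) t \is a fin_num.
  rewrite ge0_fin_numE; last exact: CE_ge0.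
  by apply: (@le_lt_trans _ _ (CEr V t)); [near: t; exact: lN|near: t; exact: iV].
rewrite /condR -(fineK fU) -(fineK fV) -(fineK fP) -(fineK fN) -!EFinD /= => -[].
lra.
Unshelve. all: by end_near.
Qed.

Lemma fine_CE_le X Y : (forall t, 0 <= X t) -> (forall t, 0 <= Y t) ->
  measurable_fun [set: T] X -> measurable_fun [set: T] Y ->
  (\forall t \ae P, (CEr Y t < +oo)%E) -> (\forall t \ae P, X t <= Y t) ->
  (\forall t \ae P, fine (CEr X t) <= fine (CEr Y t)).
Proof.
move=> X0 Y0 mX mY iY XY.
have X0' t : (0 <= (X t)%:E)%E by rewrite lee_fin.
have Y0' t : (0 <= (Y t)%:E)%E by rewrite lee_fin.
have {}mX : measurable_fun [set: T] (fun t => (X t)%:E) by apply/measurable_EFinP.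
have {}mY : measurable_fun [set: T] (fun t => (Y t)%:E) by apply/measurable_EFinP.
have XY' : \forall t \ae P, ((X t)%:E <= (Y t)%:E)%E.
  by apply: filterS XY => t; rewrite lee_fin.
have := CE_le sF FE mX mY X0' Y0' XY'.
apply: filterS2 iY => t iY XYt.
have Xt := CE_ge0 P sF FE mX X0' t; have Yt := CE_ge0 P sF FE mY Y0' t.
by rewrite fine_le// ge0_fin_numE// (le_lt_trans XYt).
Qed.

Lemma cond_integrable_pos X : cond_integrable X ->
  \forall t \ae P, (CE (fun u => (Num.max (X u) 0)%:E) t < +oo)%E.
Proof.
move=> iX; have [mX _] := iX.
have [] : cond_integrable (fun t => Num.max (X t) 0).
  apply: cond_integrableW iX; first exact: measurable_maxr.
  apply: aeW => t; rewrite ger0_norm ?le_max ?lexx ?orbT//.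
  by rewrite ge_max ler_norm normr_ge0.
move=> _; rewrite (_ : (fun u => `|Num.max (X u) 0|%:E) = (fun u => (Num.max (X u) 0)%:E))//.
by apply/funext => t; rewrite ger0_norm// le_max lexx orbT.
Qed.

Lemma cond_integrableN X : cond_integrable X -> cond_integrable (fun t => - X t).
Proof.
move=> iX; have [mX _] := iX; apply: cond_integrableW iX; first exact: measurable_funN.
by apply: aeW => t; rewrite normrN.
Qed.

Lemma cond_integrable_neg X : cond_integrable X ->
  \forall t \ae P, (CE (fun u => (Num.max (- X u) 0)%:E) t < +oo)%E.
Proof. by move/cond_integrableN/cond_integrable_pos. Qed.

Lemma cond_integrableD X Y : cond_integrable X -> cond_integrable Y ->
  cond_integrable (fun t => X t + Y t).
Proof.
move=> [mX iX] [mY iY]; split; first exact: measurable_funD.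
have mx := measurable_EFin_abs mX; have my := measurable_EFin_abs mY.
have x0 t : (0 <= `|X t|%:E)%E by rewrite lee_fin.
have y0 t : (0 <= `|Y t|%:E)%E by rewrite lee_fin.
have h1 := CE_add P sF FE mx my x0 y0.
have h2 : \forall t \ae P, (CE (fun u => `|X u + Y u|%:E) t <=
    CE (fun u => `|X u|%:E + `|Y u|%:E) t)%E.
  apply: CE_le => //.
  - exact/measurable_EFin_abs/measurable_funD.
  - exact: emeasurable_funD.
  - by move=> t; rewrite adde_ge0.
  - by apply: aeW => t; rewrite -EFinD lee_fin ler_normD.
near=> t; apply: (@le_lt_trans _ _ (CE (fun u => `|X u|%:E + `|Y u|%:E) t)%E).
  by near: t; exact: h2.
rewrite (_ : CE _ t = CE (fun u => `|X u|%:E) t + CE (fun u => `|Y u|%:E) t)%E.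
  by rewrite lte_add_pinfty//; near: t; [exact: iX|exact: iY].
by near: t; exact: h1.
Unshelve. all: by end_near.
Qed.

Lemma cond_integrableZ X (a : R) : cond_integrable X ->
  cond_integrable (fun t => a * X t).
Proof.
move=> [mX iX]; split; first exact: measurable_funM.
have a0 (t : T) : (0 <= cst `|a|%:E t)%E by rewrite lee_fin.
have x0 t : (0 <= `|X t|%:E)%E by rewrite lee_fin.
have := CE_pull P sF FE (measurable_EFin_abs mX) x0 (measurable_cst `|a|%:E) a0.
apply: filterS2 iX => t iX.
rewrite (_ : (fun u => _) = (fun u => `|a * X u|%:E)) => [->|].
  by rewrite lte_mul_pinfty.
by apply/funext => u /=; rewrite normrM EFinM.
Qed.

Lemma measurable_condR X : measurable_fun [set: T] X -> mF (condR X).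
Proof.
move=> mX.
have mfine (Z : T -> \bar R) : mF Z -> mF (fine \o Z).
  by move=> mZ; exact: (measurableT_comp (fine_measurable measurableT) mZ).
apply: (@measurable_funB _ TF); apply: mfine.
- apply: measurable_CE => //; first exact: measurable_EFin_pos.
  by move=> t; rewrite lee_fin le_max lexx orbT.
- apply: measurable_CE => //; first exact/measurable_EFin_pos/measurable_funN.
  by move=> t; rewrite lee_fin le_max lexx orbT.
Qed.

Lemma ge0_condR X : measurable_fun [set: T] X -> (forall t, 0 <= X t) ->
  (\forall t \ae P, (CEr X t < +oo)%E) ->
  \forall t \ae P, condR X t = fine (CEr X t).
Proof.
move=> mX X0 iX.
have c0 : \forall t \ae P, CE (cst 0%E) t = 0%E.
  by apply: CE_unique => //; exact: measurable_cst.
have : \forall t \ae P, condR X t = fine (CEr X t) - fine (CEr (cst 0) t).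
  apply: condR_diff => //.
    by apply: filterS c0 => t; rewrite [CEr _ t](_ : _ = CE (cst 0%E) t)// => ->.
  by apply: aeW => t; rewrite subr0.
by apply: filterS2 c0 => t c0 ->; rewrite [CEr (cst 0) t](_ : _ = CE (cst 0%E) t)// c0 subr0.
Qed.

Lemma condR_ae_eq X Y : cond_integrable X -> measurable_fun [set: T] Y ->
  (\forall t \ae P, X t = Y t) -> \forall t \ae P, condR X t = condR Y t.
Proof.
move=> iX mY XY; have [mX _] := iX.
have : \forall t \ae P, condR Y t = condR X t.
  apply: condR_diff => //.
  - exact: measurable_maxr.
  - by apply: measurable_maxr => //; exact: measurable_funN.
  - by move=> t; rewrite le_max lexx orbT.
  - by move=> t; rewrite le_max lexx orbT.
  - exact: cond_integrable_pos.
  - exact: cond_integrable_neg.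
  - apply: filterS XY => t <-; have [X0|X0] := leP 0 (X t).
      by rewrite max_r ?oppr_le0// subr0.
    by rewrite max_l ?oppr_ge0 ?ltW// sub0r opprK.
by apply: filterS => t ->.
Qed.

(** [condR_diff] for X - Y = (X^+ + Y^-) - (X^- + Y^+). Opposites and sums are then deduced from
    differences. *)
Lemma condRB X Y : cond_integrable X -> cond_integrable Y ->
  \forall t \ae P, condR (fun u => X u - Y u) t = condR X t - condR Y t.
Proof.
move=> iX iY; have [mX _] := iX; have [mY _] := iY.
have maxr0 (Z : T -> R) t : 0 <= Num.max (Z t) 0 by rewrite le_max lexx orbT.
have mp (Z : T -> R) : measurable_fun [set: T] Z -> measurable_fun [set: T] (fun t => Num.max (Z t) 0).
  by move=> mZ; exact: measurable_maxr.
have mXn := measurable_funN mX; have mYn := measurable_funN mY.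
have pX := cond_integrable_pos iX; have nX := cond_integrable_neg iX.
have pY := cond_integrable_pos iY; have nY := cond_integrable_neg iY.
have add (U V : T -> R) : measurable_fun [set: T] U -> measurable_fun [set: T] V ->
    (forall t, 0 <= U t) -> (forall t, 0 <= V t) ->
    \forall t \ae P, CEr (fun u => U u + V u) t = (CEr U t + CEr V t)%E.
  move=> mU mV U0 V0.
  have := @CE_add _ _ _ P _ sF FE (EFin \o U) (EFin \o V).
  by apply; [exact/measurable_EFinP|exact/measurable_EFinP|move=> t; rewrite lee_fin..].
have h1 := add _ _ (mp _ mX) (mp _ mYn) (maxr0 X) (maxr0 (fun t => - Y t)).
have h2 := add _ _ (mp _ mXn) (mp _ mY) (maxr0 (fun t => - X t)) (maxr0 Y).
have ge0 (U : T -> R) t : measurable_fun [set: T] U -> (forall t, 0 <= U t) -> (0 <= CEr U t)%E.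
  by move=> mU U0; apply: CE_ge0 => //; exact/measurable_EFinP.
have : \forall t \ae P, condR (fun u => X u - Y u) t =
   fine (CEr (fun u => Num.max (X u) 0 + Num.max (- Y u) 0) t) -
   fine (CEr (fun u => Num.max (- X u) 0 + Num.max (Y u) 0) t).
  apply: condR_diff.
  - exact: measurable_funB.
  - by apply: measurable_funD; exact: mp.
  - by apply: measurable_funD; exact: mp.
  - by move=> t; rewrite addr_ge0// le_max lexx orbT.
  - by move=> t; rewrite addr_ge0// le_max lexx orbT.
  - by apply: filterS3 h1 pX nY => t -> ? ?; rewrite lte_add_pinfty.
  - by apply: filterS3 h2 nX pY => t -> ? ?; rewrite lte_add_pinfty.
  - apply: aeW => t.
    by rewrite /Num.max; do 4 case: ifPn; rewrite -?leNgt; lra.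
move=> hB; near=> t.
transitivity (fine (CEr (fun u => Num.max (X u) 0 + Num.max (- Y u) 0) t) -
   fine (CEr (fun u => Num.max (- X u) 0 + Num.max (Y u) 0) t)).
  by near: t; exact: hB.
rewrite (_ : CEr (fun u => Num.max (X u) 0 + Num.max (- Y u) 0) t =
  CEr (fun u => Num.max (X u) 0) t + CEr (fun u => Num.max (- Y u) 0) t)%E.
rewrite (_ : CEr (fun u => Num.max (- X u) 0 + Num.max (Y u) 0) t =
  CEr (fun u => Num.max (- X u) 0) t + CEr (fun u => Num.max (Y u) 0) t)%E.
- have gfin (U : T -> R) : measurable_fun [set: T] U ->
      (CEr (fun u => Num.max (U u) 0) t < +oo)%E ->
      CEr (fun u => Num.max (U u) 0) t \is a fin_num.
    by move=> mU; rewrite ge0_fin_numE// ge0//; exact: mp.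
  have f1 : CEr (fun u => Num.max (X u) 0) t \is a fin_num.
    by apply: gfin; [exact: mX|near: t; exact: pX].
  have f2 : CEr (fun u => Num.max (- X u) 0) t \is a fin_num.
    by apply: (gfin (fun t => - X t)); [exact: mXn|near: t; exact: nX].
  have f3 : CEr (fun u => Num.max (Y u) 0) t \is a fin_num.
    by apply: gfin; [exact: mY|near: t; exact: pY].
  have f4 : CEr (fun u => Num.max (- Y u) 0) t \is a fin_num.
    by apply: (gfin (fun t => - Y t)); [exact: mYn|near: t; exact: nY].
  rewrite (fineD f1 f4) (fineD f2 f3) /condR.
  by move: (fine _) (fine _) (fine _) (fine _) => a b c e; ring.
- by near: t; exact: h2.
- by near: t; exact: h1.
Unshelve. all: by end_near.
Qed.

End real_conditional_expectation.

(** * Locality, pulling out and uniqueness for the real-valued conditional expectation *)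

Section real_conditional_expectation_theory.
Context (R : realType) (d : measure_display) (T : measurableType d).
Variables (P : probability T R) (F : set_system T).
Hypotheses (sF : sigma_algebra [set: T] F) (FE : F `<=` measurable).
Local Notation mF := (measurable_wrt F).
Local Notation TF := (g_sigma_algebraType F).
Local Notation CE := (CE P F).
Local Notation CEr U := (CE (fun u => (U u)%:E)).
Local Notation condR := (condR P F).
Local Notation cond_integrable := (cond_integrable P F).
Implicit Types (X Y : T -> R).

Let condRE X t : condR X t =
  fine (CEr (fun u => Num.max (X u) 0) t) - fine (CEr (fun u => Num.max (- X u) 0) t).
Proof. by []. Qed.

Lemma condR_local X Y B : measurable_fun [set: T] X -> measurable_fun [set: T] Y ->
  F B -> (forall t, B t -> X t = Y t) -> \forall t \ae P, B t -> condR X t = condR Y t.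
Proof.
move=> mX mY FB XY.
have max0 (Z : T -> R) t : (0 <= (Num.max (Z t) 0)%:E)%E by rewrite lee_fin le_max lexx orbT.
have h1 := CE_local P sF FE (measurable_EFin_pos mX) (measurable_EFin_pos mY)
  (max0 X) (max0 Y) FB (fun t Bt => congr1 (fun x => (Num.max x 0)%:E) (XY t Bt)).
have h2 := CE_local P sF FE (measurable_EFin_pos (measurable_funN mX))
  (measurable_EFin_pos (measurable_funN mY)) (max0 (fun t => - X t)) (max0 (fun t => - Y t))
  FB (fun t Bt => congr1 (fun x => (Num.max (- x) 0)%:E) (XY t Bt)).
by apply: filterS2 h1 h2 => t h1 h2 Bt; rewrite /condR h1// h2.
Qed.

Lemma condR0 : \forall t \ae P, condR (cst 0) t = 0.
Proof.
have c0 : \forall t \ae P, CE (cst 0%E) t = 0%E.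
  by apply: CE_unique => //; exact: measurable_cst.
have : \forall t \ae P, condR (cst 0) t = fine (CEr (cst 0) t).
  apply: ge0_condR => //; apply: filterS c0 => t.
  by rewrite [CEr _ t](_ : _ = CE (cst 0%E) t)// => ->.
by apply: filterS2 c0 => t c0 ->; rewrite [CEr (cst 0) t](_ : _ = CE (cst 0%E) t)// c0.
Qed.

Lemma cond_integrable_cst0 : cond_integrable (cst 0).
Proof.
split=> //; have c0 : \forall t \ae P, CE (cst 0%E) t = 0%E.
  by apply: CE_unique => //; exact: measurable_cst.
rewrite (_ : (fun u => `|(cst 0 : T -> R) u|%:E) = cst 0%E).
  by apply: filterS c0 => t ->.
by apply/funext => u /=; rewrite normr0.
Qed.

Lemma condRN X : cond_integrable X -> \forall t \ae P, condR (fun u => - X u) t = - condR X t.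
Proof.
move=> iX; rewrite (_ : (fun u => - X u) = (fun u => (cst 0 : T -> R) u - X u)); last first.
  by apply/funext => t; rewrite sub0r.
have := condRB sF FE cond_integrable_cst0 iX.
by apply: filterS2 condR0 => t -> ->; rewrite sub0r.
Qed.

Lemma condRD X Y : cond_integrable X -> cond_integrable Y ->
  \forall t \ae P, condR (fun u => X u + Y u) t = condR X t + condR Y t.
Proof.
move=> iX iY.
rewrite (_ : (fun u => X u + Y u) = (fun u => X u - (- Y u))); last first.
  by apply/funext => t; rewrite opprK.
have := condRB sF FE iX (cond_integrableN sF FE iY).
by apply: filterS2 (condRN iY) => t -> ->; rewrite opprK.
Qed.

Lemma fin_num_CE (X : T -> R) t : measurable_fun [set: T] X -> (forall t, 0 <= X t) ->
  (CEr X t < +oo)%E -> CEr X t \is a fin_num.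
Proof.
move=> mX X0 h; rewrite ge0_fin_numE//; apply: CE_ge0 => //; exact/measurable_EFinP.
Qed.

Lemma ge0_CEr_pull (h X : T -> R) : measurable_fun [set: T] X -> (forall t, 0 <= X t) ->
  mF h -> (forall t, 0 <= h t) ->
  \forall t \ae P, CEr (fun u => h u * X u) t = ((h t)%:E * CEr X t)%E.
Proof.
move=> mX X0 mh h0.
have := @CE_pull _ _ _ P _ sF FE (EFin \o h) (EFin \o X); apply.
- exact/measurable_EFinP.
- by move=> t; rewrite lee_fin.
- exact/measurable_EFinP.
- by move=> t; rewrite lee_fin.
Qed.

Lemma condR_pull (h X : T -> R) : cond_integrable X -> mF h -> (forall t, 0 <= h t) ->
  \forall t \ae P, condR (fun u => h u * X u) t = h t * condR X t.
Proof.
move=> iX mh h0; have [mX _] := iX.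
have mXp : measurable_fun [set: T] (fun t => Num.max (X t) 0) by exact: measurable_maxr.
have mXn : measurable_fun [set: T] (fun t => Num.max (- X t) 0).
  by apply: measurable_maxr => //; exact: measurable_funN.
have Xp0 t : 0 <= Num.max (X t) 0 by rewrite le_max lexx orbT.
have Xn0 t : 0 <= Num.max (- X t) 0 by rewrite le_max lexx orbT.
have h1 := ge0_CEr_pull mXp Xp0 mh h0.
have h2 := ge0_CEr_pull mXn Xn0 mh h0.
have maxM a b : 0 <= a -> Num.max (a * b) 0 = a * Num.max b 0 :> R.
  by move=> a0; rewrite maxr_pMr// mulr0.
have h3 := cond_integrable_pos sF FE iX; have h4 := cond_integrable_neg sF FE iX.
near=> t; rewrite !condRE.
rewrite (_ : (fun u => (Num.max (h u * X u) 0)%:E) = (fun u => (h u * Num.max (X u) 0)%:E)); last first.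
  by apply/funext => u; rewrite maxM.
rewrite (_ : (fun u => (Num.max (- (h u * X u)) 0)%:E) = (fun u => (h u * Num.max (- X u) 0)%:E)); last first.
  by apply/funext => u; rewrite -mulrN maxM.
have f1 : CEr (fun u => Num.max (X u) 0) t \is a fin_num.
  by apply: fin_num_CE => //; near: t; exact: h3.
have f2 : CEr (fun u => Num.max (- X u) 0) t \is a fin_num.
  by apply: fin_num_CE => //; near: t; exact: h4.
rewrite (_ : CEr (fun u => h u * Num.max (X u) 0) t = (h t)%:E * CEr (fun u => Num.max (X u) 0) t)%E.
rewrite (_ : CEr (fun u => h u * Num.max (- X u) 0) t = (h t)%:E * CEr (fun u => Num.max (- X u) 0) t)%E.
- by rewrite fineM// fineM// mulrBr.
- by near: t; exact: h2.
- by near: t; exact: h1.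
Unshelve. all: by end_near.
Qed.

Lemma cond_integrable_pull (h X : T -> R) : cond_integrable X -> mF h ->
  cond_integrable (fun u => h u * X u).
Proof.
move=> [mX iX] mh.
have mh' := measurable_wrtW sF FE mh.
split; first exact: measurable_funM.
have mXp : measurable_fun [set: T] (fun t => `|X t|) by exact: measurableT_comp.
have mha : mF (fun t => `|h t|) by exact: measurableT_comp.
have := ge0_CEr_pull mXp (fun t => normr_ge0 _) mha (fun t => normr_ge0 _).
apply: filterS2 iX => t iX h1.
rewrite (_ : (fun u => `|h u * X u|%:E) = (fun u => (`|h u| * `|X u|)%:E)).
  by rewrite h1 lte_mul_pinfty.
by apply/funext => u; rewrite normrM.
Qed.

Lemma condRZ (a : R) X : cond_integrable X ->
  \forall t \ae P, condR (fun u => a * X u) t = a * condR X t.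
Proof.
move=> iX; have ca (b : R) : mF (cst b) by exact: measurable_cst.
have [a0|a0] := leP 0 a; first exact: (condR_pull iX (ca a)).
have := condRN iX.
have := @condR_pull (cst (- a)) _ (cond_integrableN sF FE iX) (ca (- a)).
rewrite (_ : (fun u => cst (- a) u * - X u) = (fun u => a * X u)); last first.
  by apply/funext => u /=; rewrite mulrNN.
have na0 (t : T) : 0 <= cst (- a) t by rewrite oppr_ge0 ltW.
by move=> /(_ na0); apply: filterS2 => t -> ->; rewrite /= mulrNN.
Qed.

Lemma ge0_condR_fine X : measurable_fun [set: T] X -> (forall t, 0 <= X t) ->
  (\forall t \ae P, (CEr X t < +oo)%E) ->
  \forall t \ae P, (condR X t)%:E = CEr X t.
Proof.
move=> mX X0 iX; have := ge0_condR sF FE mX X0 iX.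
by apply: filterS2 iX => t iX ->; rewrite fineK// fin_num_CE.
Qed.

Lemma condR_abs X : cond_integrable X ->
  \forall t \ae P, (`|condR X t|%:E <= CE (fun u => `|X u|%:E) t)%E.
Proof.
move=> iX; have [mX iX'] := iX.
have mXa : measurable_fun [set: T] (fun t => `|X t|) by exact: measurableT_comp.
have mXp : measurable_fun [set: T] (fun t => Num.max (X t) 0) by exact: measurable_maxr.
have mXn : measurable_fun [set: T] (fun t => Num.max (- X t) 0).
  by apply: measurable_maxr => //; exact: measurable_funN.
have Xp0 t : 0 <= Num.max (X t) 0 by rewrite le_max lexx orbT.
have Xn0 t : 0 <= Num.max (- X t) 0 by rewrite le_max lexx orbT.
have l1 : \forall t \ae P, fine (CEr (fun u => Num.max (X u) 0) t) <= fine (CE (fun u => `|X u|%:E) t).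
  apply: fine_CE_le => //.
  by apply: aeW => t; rewrite ge_max ler_norm normr_ge0.
have l2 : \forall t \ae P, fine (CEr (fun u => Num.max (- X u) 0) t) <= fine (CE (fun u => `|X u|%:E) t).
  apply: fine_CE_le => //.
  by apply: aeW => t; rewrite ge_max normr_ge0 -normrN ler_norm.
have ge0 (U : T -> R) t : measurable_fun [set: T] U -> (forall t, 0 <= U t) -> 0 <= fine (CEr U t).
  by move=> mU U0; apply: fine_ge0; apply: CE_ge0 => //; exact/measurable_EFinP.
apply: filterS3 l1 l2 iX' => t l1 l2 iX't.
rewrite -(fineK (fin_num_CE mXa (fun t => normr_ge0 _) iX't)) lee_fin condRE.
have := ge0 _ t mXp Xp0; have := ge0 _ t mXn Xn0.
move: l1 l2; move: (fine _) (fine _) (fine _) => a b c l1 l2 c0 a0.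
by rewrite ler_norml; apply/andP; split; lra.
Qed.

(* the value [+oo] of [dual_adde] plays no role when the negative part vanishes *)
Lemma cond_exp_ge0_CE (X : T -> \bar R) : measurable_fun [set: T] X ->
  (forall t, (0 <= X t)%E) -> \forall t \ae P, cond_exp P F X t = CE X t.
Proof.
move=> mX X0; have X0' (t : T) : (0 <= cst 0 t :> \bar R)%E by [].
have h1 := cond_exp_ge0E P sF FE mX X0.
have h2 := cond_exp_ge0E P sF FE (measurable_cst (0%E : \bar R)) X0'.
have c0 : \forall t \ae P, CE (cst 0%E) t = 0%E.
  by apply: CE_unique => //; exact: measurable_cst.
rewrite /cond_exp (_ : X^\+%E = X); last by apply/funext => t; rewrite funeposE max_l.
rewrite (_ : X^\-%E = cst 0%E); last first.
  by apply/funext => t; rewrite funenegE max_r// oppe_le0.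
apply: filterS3 h1 h2 c0 => t -> -> ->.
by rewrite oppe0; case: (CE X t) => [r||]; rewrite /dual_adde//= addr0.
Qed.

Lemma cond_exp_condR X : cond_integrable X ->
  \forall t \ae P, cond_exp P F (fun u => (X u)%:E) t = (condR X t)%:E.
Proof.
move=> iX; have [mX _] := iX.
have mp := measurable_EFin_pos mX; have mn := measurable_EFin_pos (measurable_funN mX).
have maxr0 (Z : T -> R) t : (0 <= (Num.max (Z t) 0)%:E)%E by rewrite lee_fin le_max lexx orbT.
have h1 := cond_exp_ge0E P sF FE mp (maxr0 X).
have h2 := cond_exp_ge0E P sF FE mn (maxr0 (fun t => - X t)).
rewrite /cond_exp.
rewrite (_ : (fun u => (X u)%:E)^\+%E = (fun t => (Num.max (X t) 0)%:E)); last first.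
  by apply/funext => t; rewrite funeposE -EFin_max.
rewrite (_ : (fun u => (X u)%:E)^\-%E = (fun t => (Num.max (- X t) 0)%:E)); last first.
  by apply/funext => t; rewrite funenegE -EFinN -EFin_max.
near=> t.
rewrite (_ : cond_exp_ge0 P F (fun t => (Num.max (X t) 0)%:E) t = CEr (fun u => Num.max (X u) 0) t); last first.
  by near: t; exact: h1.
rewrite (_ : cond_exp_ge0 P F (fun t => (Num.max (- X t) 0)%:E) t = CEr (fun u => Num.max (- X u) 0) t); last first.
  by near: t; exact: h2.
have mpr : measurable_fun [set: T] (fun u => Num.max (X u) 0) by exact: measurable_maxr.
have mnr : measurable_fun [set: T] (fun u => Num.max (- X u) 0).
  by apply: measurable_maxr => //; exact: measurable_funN.
have Xp0 u : 0 <= Num.max (X u) 0 by rewrite le_max lexx orbT.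
have Xn0 u : 0 <= Num.max (- X u) 0 by rewrite le_max lexx orbT.
have f1 : CEr (fun u => Num.max (X u) 0) t \is a fin_num.
  by apply: fin_num_CE => //; near: t; exact: cond_integrable_pos.
have f2 : CEr (fun u => Num.max (- X u) 0) t \is a fin_num.
  by apply: fin_num_CE => //; near: t; exact: cond_integrable_neg.
by rewrite condRE EFinB !fineK// -(fineK f1) -(fineK f2).
Unshelve. all: by end_near.
Qed.

Lemma integrable_cond_integrable X : P.-integrable [set: T] (EFin \o X) -> cond_integrable X.
Proof.
move=> iX; have mX : measurable_fun [set: T] X by apply/measurable_EFinP; exact: measurable_int iX.
split => //; have x0 t : (0 <= `|X t|%:E)%E by rewrite lee_fin.
have mXa := measurable_EFin_abs mX.
have mC := measurable_wrtW sF FE (measurable_CE P sF FE mXa x0).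
have iC : P.-integrable [set: T] (CE (fun u => `|X u|%:E)).
  apply/integrableP; split => //.
  rewrite (_ : (\int[P]_t _ = \int[P]_t CE (fun u => `|X u|%:E) t)%E); last first.
    by apply: eq_integral => t _; rewrite gee0_abs// CE_ge0.
  rewrite integral_CE//; first by case/integrableP : iX.
  by rewrite -(measurable_FE sF).
have := integrable_ae measurableT iC.
by apply: filterS => t /(_ Logic.I); rewrite ge0_fin_numE// CE_ge0.
Qed.

(** Integrability allows the integrals of the two parts to be subtracted, so the difference [C] of
    their conditional expectations has the integrals of [Z] over [F]. This later links the
    Radon-Nikodym density to the limit functional. *)
Lemma condR_unique X (Z : T -> R) : P.-integrable [set: T] (EFin \o X) ->
  mF Z -> P.-integrable [set: T] (EFin \o Z) ->
  (forall A, F A -> \int[P]_(t in A) (Z t)%:E = \int[P]_(t in A) (X t)%:E)%E ->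
  \forall t \ae P, condR X t = Z t.
Proof.
move=> iX mZ iZ ZX; have iX' := integrable_cond_integrable iX; have [mX _] := iX'.
have mp := measurable_EFin_pos mX; have mn := measurable_EFin_pos (measurable_funN mX).
have mpr : measurable_fun [set: T] (fun u => Num.max (X u) 0) by exact: measurable_maxr.
have mnr : measurable_fun [set: T] (fun u => Num.max (- X u) 0).
  by apply: measurable_maxr => //; exact: measurable_funN.
have Xp0 u : (0 <= (Num.max (X u) 0)%:E)%E by rewrite lee_fin le_max lexx orbT.
have Xn0 u : (0 <= (Num.max (- X u) 0)%:E)%E by rewrite lee_fin le_max lexx orbT.
have intC (Y : T -> \bar R) : measurable_fun setT Y -> (forall t, 0 <= Y t)%E ->
    P.-integrable setT Y -> P.-integrable setT (CE Y).
  move=> mY Y0 /integrableP[_ iY]; apply/integrableP; split.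
    exact: (measurable_wrtW sF FE (measurable_CE P sF FE mY Y0)).
  rewrite (_ : (\int[P]_t _ = \int[P]_t CE Y t)%E); last first.
    by apply: eq_integral => t _; rewrite gee0_abs// CE_ge0.
  rewrite integral_CE//; last by rewrite -(measurable_FE sF).
  rewrite (_ : (\int[P]_t Y t)%E = \int[P]_t `|Y t|)%E//.
  by apply: eq_integral => t _; rewrite gee0_abs.
have iXp : P.-integrable setT (fun u => (Num.max (X u) 0)%:E).
  rewrite (_ : (fun u => _) = (EFin \o X)^\+%E); first exact: integrable_funepos.
  by apply/funext => t; rewrite funeposE -EFin_max.
have iXn : P.-integrable setT (fun u => (Num.max (- X u) 0)%:E).
  rewrite (_ : (fun u => _) = (EFin \o X)^\-%E); first exact: integrable_funeneg.
  by apply/funext => t; rewrite funenegE -EFinN -EFin_max.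
have iC1 := intC _ mp Xp0 iXp; have iC2 := intC _ mn Xn0 iXn.
pose C t := (CEr (fun u => Num.max (X u) 0) t - CEr (fun u => Num.max (- X u) 0) t)%E.
have mC : mF C by apply: (@emeasurable_funB _ TF); exact: measurable_CE.
have iC : P.-integrable setT C by exact: integrableB.
have CX A : F A -> (\int[P]_(t in A) C t = \int[P]_(t in A) (X t)%:E)%E.
  move=> FA; have mA := FE FA; rewrite integralB//; try exact: (integrableS measurableT).
  rewrite !integral_CE// -integralB//; try exact: (integrableS measurableT).
  apply: eq_integral => t _; rewrite -EFinB; congr EFin.
  by rewrite /Num.max; do 2 case: ifPn; rewrite -?leNgt; lra.
have mZE : mF (EFin \o Z) by exact/measurable_EFinP.
have le1 : \forall t \ae P, (C t <= (Z t)%:E)%E.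
  by apply: (integral_le_ae_le sF FE mC mZE iC iZ) => A FA; rewrite CX// ZX.
have le2 : \forall t \ae P, ((Z t)%:E <= C t)%E.
  by apply: (integral_le_ae_le sF FE mZE mC iZ iC) => A FA; rewrite CX// ZX.
have h1 := cond_integrable_pos sF FE iX'; have h2 := cond_integrable_neg sF FE iX'.
near=> t.
have f1 : CEr (fun u => Num.max (X u) 0) t \is a fin_num.
  by rewrite ge0_fin_numE; [near: t; exact: h1|exact: CE_ge0].
have f2 : CEr (fun u => Num.max (- X u) 0) t \is a fin_num.
  by rewrite ge0_fin_numE; [near: t; exact: h2|exact: CE_ge0].
have : (C t <= (Z t)%:E)%E by near: t; exact: le1.
have : ((Z t)%:E <= C t)%E by near: t; exact: le2.
rewrite /C condRE -(fineK f1) -(fineK f2) -EFinB !lee_fin /= => a b.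
by apply/eqP; rewrite eq_le a b.
Unshelve. all: by end_near.
Qed.

End real_conditional_expectation_theory.

(** * Conditional Orlicz spaces *)

Section L0_theory.
Context (R : realType) (d : measure_display) (T : measurableType d).
Variable P : probability T R.
Local Open Scope quotient_scope.

Lemma measurable_L0 (x : L0 P) : measurable_fun [set: T] x.
Proof. exact: measurable_funP. Qed.

Lemma L0_of_ex (g : T -> R) : measurable_fun [set: T] g ->
  exists x : L0 P, \forall t \ae P, x t = g t.
Proof.
move=> mg; pose g' : {mfun T >-> R} := mfun_Sub (mem_set mg).
exists (\pi_({mfun_ P, T >-> R}) g').
have /asboolP : ae_eq_op P (repr (\pi_({mfun_ P, T >-> R}) g')) g' by apply/eqmodP; rewrite reprK.
by apply: filterS => t; exact.
Qed.

Definition L0_of (g : T -> R) (mg : measurable_fun [set: T] g) : L0 P :=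
  sval (cid (L0_of_ex mg)).

Lemma L0_ofE (g : T -> R) (mg : measurable_fun [set: T] g) :
  \forall t \ae P, L0_of mg t = g t.
Proof. exact: (svalP (cid (L0_of_ex mg))). Qed.

End L0_theory.

Section orlicz_theory.
Context (R : realType) (d : measure_display) (T : measurableType d).
Variables (P : probability T R) (F : set_system T).
Hypotheses (sF : sigma_algebra [set: T] F) (FE : F `<=` measurable).
Local Notation mF := (measurable_wrt F).
Local Notation TF := (g_sigma_algebraType F).
Local Notation CE := (CE P F).
Implicit Types (g h : T -> R).

(** Common to [phi] and to its conjugate; the module structure of both spaces is derived from it at
    once. *)
Definition nondecreasing_ge0 (psi : R -> \bar R) :=
  (forall x, 0 <= x -> (0 <= psi x)%E) /\
  (forall x y, 0 <= x -> x <= y -> (psi x <= psi y)%E).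

(** Version of [orlicz] for functions, with a multiplier that is [F]-measurable and positive at
    every point rather than almost surely. *)
Definition orl (psi : R -> \bar R) g := measurable_fun [set: T] g /\
  exists eta : T -> R, [/\ mF eta, forall t, 0 < eta t &
    \forall t \ae P, (CE (fun u => psi `|eta u * g u|%R) t < +oo)%E].

Section one_function.
Variable psi : R -> \bar R.
Hypothesis Hpsi : nondecreasing_ge0 psi.

Let psi_ge0 (g : T -> R) t : (0 <= psi `|g t|%R)%E. Proof. exact: Hpsi.1. Qed.

Let mpsi g : measurable_fun [set: T] g -> measurable_fun [set: T] (fun t => psi `|g t|%R).
Proof. by move=> mg; apply: measurable_comp_nondecreasing => //; exact: Hpsi.2. Qed.

Let CE_psi_le g h : measurable_fun [set: T] g -> measurable_fun [set: T] h ->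
  (\forall t \ae P, `|g t| <= `|h t|) ->
  \forall t \ae P, (CE (fun u => psi `|g u|%R) t <= CE (fun u => psi `|h u|%R) t)%E.
Proof.
move=> mg mh gh; apply: (CE_le sF FE (mpsi mg) (mpsi mh) (psi_ge0 g) (psi_ge0 h)).
by apply: filterS gh => t; exact: Hpsi.2.
Qed.

Let CE_psi_eq g h : measurable_fun [set: T] g -> measurable_fun [set: T] h ->
  (\forall t \ae P, g t = h t) ->
  \forall t \ae P, CE (fun u => psi `|g u|) t = CE (fun u => psi `|h u|) t.
Proof.
move=> mg mh gh; apply: (CE_ae_eq sF FE (mpsi mg) (mpsi mh) (psi_ge0 g) (psi_ge0 h)).
by apply: filterS gh => t ->.
Qed.

Lemma orliczP (x : L0 P) : orlicz F psi x <-> orl psi x.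
Proof.
split => [[eta [[e me ee] eta0] [z [zf mzf zz] xz]]|[_ [eta [me eta0 ix]]]].
  split; first exact: measurable_L0.
  (* [eta] agrees a.s. with the [F]-measurable [e], which may fail to be positive on a null set;
     there it is reset to 1. *)
  pose e' t := if 0 < e t then e t else 1.
  have me' : mF e'.
    by apply: (@measurable_fun_ifT _ _ TF) => //; apply: (@measurable_fun_ltr _ TF).
  have e'0 t : 0 < e' t by rewrite /e'; case: ifPn.
  exists e'; split => //.
  have ee' : \forall t \ae P, eta t = e' t.
    by apply: filterS2 ee eta0 => t et; rewrite /e' -et => ->.
  have me1 := measurable_wrtW sF FE me'.
  have mx : measurable_fun setT x by exact: measurable_L0.
  have meta : measurable_fun setT eta by exact: measurable_L0.
  have h1 := cond_exp_ge0_CE P sF FE (mpsi (measurable_funM meta mx)) (psi_ge0 _).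
  have h2 : \forall t \ae P, CE (fun u => psi `|eta u * x u|%R) t = CE (fun u => psi `|e' u * x u|%R) t.
    apply: CE_psi_eq; [exact: measurable_funM|exact: measurable_funM|].
    by apply: filterS ee' => t ->.
  by apply: filterS3 h1 h2 xz => t -> -> ->; rewrite ltry.
have mx : measurable_fun setT x by exact: measurable_L0.
have me1 := measurable_wrtW sF FE me.
have metax : measurable_fun setT (fun u => psi `|eta u * x u|%R) by exact/mpsi/measurable_funM.
pose z := fine \o CE (fun u => psi `|eta u * x u|%R).
have mz : mF z.
  by exact: (measurableT_comp (fine_measurable measurableT) (measurable_CE P sF FE metax (psi_ge0 _))).
have EH := L0_ofE P me1; set H := L0_of _ _ in EH.
have EZ := L0_ofE P (measurable_wrtW sF FE mz); set Z := L0_of _ _ in EZ.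
have mH : measurable_fun setT H by exact: measurable_L0.
exists H; first by split; [exists eta|apply: filterS EH => t ->].
exists Z; first by exists z.
have h1 := cond_exp_ge0_CE P sF FE (mpsi (measurable_funM mH mx)) (psi_ge0 _).
have h2 : \forall t \ae P, CE (fun u => psi `|H u * x u|%R) t = CE (fun u => psi `|eta u * x u|%R) t.
  apply: CE_psi_eq; [exact: measurable_funM|exact: measurable_funM|].
  by apply: filterS EH => t ->.
near=> t.
transitivity (CE (fun u => psi `|H u * x u|%R) t); first by near: t; exact: h1.
transitivity (CE (fun u => psi `|eta u * x u|%R) t); first by near: t; exact: h2.
rewrite (_ : Z t = z t); last by near: t; exact: EZ.
rewrite /z /= fineK// ge0_fin_numE; first by near: t; exact: ix.
exact: (CE_ge0 P sF FE metax (psi_ge0 _)). 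
Unshelve. all: by end_near.
Qed.

Lemma orl_solid g h : measurable_fun [set: T] h ->
  (\forall t \ae P, `|h t| <= `|g t|) -> orl psi g -> orl psi h.
Proof.
move=> mh hg [mg [eta [me e0 ig]]]; split => //; exists eta; split; [exact: me|exact: e0|].
have me1 := measurable_wrtW sF FE me.
have : \forall t \ae P, (CE (fun u => psi `|eta u * h u|%R) t <=
    CE (fun u => psi `|eta u * g u|%R) t)%E.
  apply: CE_psi_le; [exact: measurable_funM|exact: measurable_funM|].
  apply: filterS hg => t hg.
  by rewrite !normrM ler_wpM2l.
by apply: filterS2 ig => t ig /le_lt_trans; apply.
Qed.

Lemma orl_ae_eq g h : measurable_fun [set: T] h ->
  (\forall t \ae P, h t = g t) -> orl psi g -> orl psi h.
Proof. by move=> mh hg; apply: orl_solid => //; apply: filterS hg => t ->. Qed.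

(** With c = min(a, b)/2, c|g + h| is at most the maximum of a|g| and b|h|; by monotonicity [psi] of
    that maximum is at most the sum of the two values. *)
Lemma orlD g h : orl psi g -> orl psi h -> orl psi (fun t => g t + h t).
Proof.
move=> [mg [a [ma a0 ig]]] [mh [b [mb b0 ih]]]; split; first exact: measurable_funD.
pose c t := Num.min (a t) (b t) / 2.
have mc : mF c.
  by apply: (@measurable_funM _ TF) => //; exact: measurable_minr.
have c0 t : 0 < c t by rewrite divr_gt0// lt_min a0 b0.
have ma1 := measurable_wrtW sF FE ma.
have mb1 := measurable_wrtW sF FE mb.
have mc1 := measurable_wrtW sF FE mc.
exists c; split; [exact: mc|exact: c0|].
have m1 := mpsi (measurable_funM ma1 mg); have m2 := mpsi (measurable_funM mb1 mh).
have h1 := CE_add P sF FE m1 m2 (psi_ge0 _) (psi_ge0 _).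
have h2 : \forall t \ae P, (CE (fun u => psi `|c u * (g u + h u)|%R) t <=
    CE (fun u => psi `|a u * g u|%R + psi `|b u * h u|%R) t)%E.
  have m3 := mpsi (measurable_funM mc1 (measurable_funD mg mh)).
  apply: (CE_le sF FE m3 (emeasurable_funD m1 m2) (psi_ge0 _)
    (fun t => adde_ge0 (psi_ge0 _ t) (psi_ge0 _ t))).
  apply: aeW => t.
  have le : `|(c t * (g t + h t))%R| <= Num.max `|(a t * g t)%R| `|(b t * h t)%R|.
    rewrite (normrM (c t)) (normrM (a t)) (normrM (b t)) (gtr0_norm (c0 t)) (gtr0_norm (a0 t)) (gtr0_norm (b0 t)).
    apply: (@le_trans _ _ (c t * (`|g t| + `|h t|))).
      by rewrite ler_wpM2l ?ler_normD// ltW.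
    have ca : c t * `|g t| <= a t * `|g t| / 2.
      by rewrite mulrAC ler_wpM2r// ler_wpM2r// ge_min lexx.
    have cb : c t * `|h t| <= b t * `|h t| / 2.
      by rewrite mulrAC ler_wpM2r// ler_wpM2r// ge_min lexx orbT.
    rewrite le_max mulrDr.
    by have [?|?] := leP (a t * `|g t|) (b t * `|h t|); apply/orP; [right|left]; lra.
  apply: (le_trans (Hpsi.2 _ _ (normr_ge0 _) le)).
  rewrite /Num.max; case: ifPn => _; first exact: (leeDr _ (psi_ge0 _ t)).
  exact: (leeDl _ (psi_ge0 _ t)).
near=> t; apply: (@le_lt_trans _ _ (CE (fun u => psi `|a u * g u|%R + psi `|b u * h u|%R) t)%E).
  by near: t; exact: h2.
rewrite (_ : CE _ t = CE (fun u => psi `|a u * g u|%R) t + CE (fun u => psi `|b u * h u|%R) t)%E.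
  by apply: lte_add_pinfty; near: t; [exact: ig|exact: ih].
by near: t; exact: h1.
Unshelve. all: by end_near.
Qed.

Lemma orlZ g (a : R) : orl psi g -> orl psi (fun t => a * g t).
Proof.
move=> [mg [e [me e0 ig]]]; split; first exact: measurable_funM.
pose c t := e t / (`|a| + 1).
have mc : mF c by exact: (@measurable_funM _ TF).
have c0 t : 0 < c t by rewrite divr_gt0.
have mc1 := measurable_wrtW sF FE mc; have me1 := measurable_wrtW sF FE me.
exists c; split; [exact: mc|exact: c0|].
have : \forall t \ae P, (CE (fun u => psi `|c u * (a * g u)|%R) t <=
    CE (fun u => psi `|e u * g u|%R) t)%E.
  apply: CE_psi_le; [exact/measurable_funM/measurable_funM|exact: measurable_funM|].
  apply: aeW => t.
  rewrite (normrM (c t)) (gtr0_norm (c0 t)) (normrM a) (normrM (e t)) (gtr0_norm (e0 t)) mulrA ler_wpM2r//.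
  by rewrite /c mulrAC ler_pdivrMr// ler_wpM2l// ?ltW// ltrDl.
by apply: filterS2 ig => t ig /le_lt_trans; apply.
Qed.

Lemma orlB g h : orl psi g -> orl psi h -> orl psi (fun t => g t - h t).
Proof.
move=> og oh; have := orlD og (orlZ (-1) oh).
by under eq_fun do rewrite mulN1r.
Qed.

(** The multipliers are pasted along the same partition, and locality gives finiteness block by
    block. *)
Lemma orl_paste A (g : nat -> T -> R) : is_partition F A ->
  (forall k, orl psi (g k)) -> orl psi (paste A g).
Proof.
move=> pA og; split; first by apply: (measurable_paste FE pA) => k; exact: (og k).1.
have [eta eP] := choice (fun k => (og k).2).
have me k : mF (eta k) by have [] := eP k.
have me1 k := measurable_wrtW sF FE (me k).
have mge := measurable_wrt_paste sF pA me; have mge1 := measurable_wrtW sF FE mge.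
have mg k : measurable_fun setT (g k) by exact: (og k).1.
exists (paste A eta); split => //; first by move=> t; have [_ + _] := eP (block A t); exact.
have loc : \forall t \ae P, forall k, A k t ->
    CE (fun u => psi `|paste A eta u * paste A g u|%R) t = CE (fun u => psi `|eta k u * g k u|%R) t.
  have mp := measurable_paste FE pA mg.
  apply: ae_foralln => k; have [FA _ _] := pA.
  apply: (CE_local P sF FE (mpsi (measurable_funM mge1 mp))
    (mpsi (measurable_funM (me1 k) (mg k))) (psi_ge0 _) (psi_ge0 _) (FA k)) => t Akt.
  by rewrite /= !(pasteE _ pA Akt).
have ik : \forall t \ae P, forall k, (CE (fun u => psi `|eta k u * g k u|%R) t < +oo)%E.
  by apply: ae_foralln => k; have [] := eP k.
by apply: filterS2 loc ik => t l ik; rewrite (l (block A t)) ?ik//; exact: (block_mem _ pA).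
Qed.

End one_function.

Lemma young_conjugate_nd (phi : R -> \bar R) : is_young phi ->
  nondecreasing_ge0 (young_conjugate phi).
Proof.
move=> Y; split => [s s0|x y x0 xy].
  apply: ereal_sup_ubound; exists 0; first exact: lexx.
  by rewrite mul0r (young0 Y) sube0.
apply: ub_ereal_sup => _ [r r0 <-].
apply: (@le_trans _ _ ((r * y)%:E - phi r)%E); last by apply: ereal_sup_ubound; exists r.
by rewrite leeB// lee_fin ler_wpM2l.
Qed.

Lemma is_young_nd (phi : R -> \bar R) : is_young phi -> nondecreasing_ge0 phi.
Proof. by move=> Y; split; [exact: young_ge0|exact: young_nd]. Qed.

Lemma young_inequality (phi : R -> \bar R) (r s : R) : 0 <= r -> (0 <= phi r)%E ->
  (0 <= young_conjugate phi s)%E ->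
  ((r * s)%:E <= phi r + young_conjugate phi s)%E.
Proof.
move=> r0 phir c0.
have : ((r * s)%:E - phi r <= young_conjugate phi s)%E by apply: ereal_sup_ubound; exists r.
case: (phi r) phir => [p _|_ _|//]; first by rewrite leeBlDl.
by rewrite addye ?leey// gt_eqF// (lt_le_trans _ c0).
Qed.

(** Young's inequality bounds ab|gh| by phi(a|g|) + psi(b|h|), where psi is the conjugate; the
    positive [F]-measurable factor ab is pulled out, and an infinite E[|gh| | F] would make the left
    side infinite. *)
Lemma cond_integrable_mul (phi : R -> \bar R) g h : is_young phi ->
  orl phi g -> orl (young_conjugate phi) h -> cond_integrable P F (fun t => g t * h t).
Proof.
move=> Y [mg [a [ma a0 ig]]] [mh [b [mb b0 ih]]]; split; first exact: measurable_funM.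
have [phi0 phind] := is_young_nd Y; have [psi0 psind] := young_conjugate_nd Y.
have ma1 := measurable_wrtW sF FE ma; have mb1 := measurable_wrtW sF FE mb.
have m1 := measurable_comp_nondecreasing phind (measurable_funM ma1 mg).
have m2 := measurable_comp_nondecreasing psind (measurable_funM mb1 mh).
have h1 := CE_add P sF FE m1 m2 (fun t => phi0 _ (normr_ge0 _)) (fun t => psi0 _ (normr_ge0 _)).
have mgh := measurable_funM mg mh.
have mab : mF (fun t => a t * b t) by exact: (@measurable_funM _ TF).
have ab0 t : 0 <= a t * b t by rewrite ltW// mulr_gt0.
have h2 := ge0_CEr_pull P sF FE (measurableT_comp (@normr_measurable R setT) mgh)
  (fun t => normr_ge0 _) mab ab0.
have mabgh : measurable_fun setT (fun t => (a t * b t * `|g t * h t|)%:E).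
  apply/measurable_EFinP/measurable_funM; first exact: (measurable_wrtW sF FE mab).
  exact: (measurableT_comp (@normr_measurable R setT) mgh).
have h3 := CE_le sF FE mabgh (emeasurable_funD m1 m2) _
   (fun t => adde_ge0 (phi0 _ (normr_ge0 _)) (psi0 _ (normr_ge0 _))) _.
near=> t.
have : ((a t * b t)%:E * CE (fun u => `|g u * h u|%:E) t < +oo)%E.
  rewrite -[X in (X < _)%E](_ : CE (fun u => (a u * b u * `|g u * h u|)%:E) t = _); last first.
    by near: t; exact: h2.
  apply: (@le_lt_trans _ _ (CE (fun u => phi `|a u * g u|%R + young_conjugate phi `|b u * h u|%R)%E t)).
    near: t; apply: h3; first by move=> t; rewrite lee_fin mulr_ge0.
    apply: aeW => t; rewrite !normrM (gtr0_norm (a0 t)) (gtr0_norm (b0 t)).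
    rewrite (_ : a t * b t * _ = (a t * `|g t|) * (b t * `|h t|)); last by ring.
    by apply: young_inequality; [|apply: phi0|apply: psi0]; rewrite mulr_ge0// ltW.
  rewrite (_ : CE _ t = CE (fun u => phi `|a u * g u|%R) t +
     CE (fun u => young_conjugate phi `|b u * h u|%R) t)%E; last by near: t; exact: h1.
  by apply: lte_add_pinfty; near: t; [exact: ig|exact: ih].
have : (0 <= CE (fun u => `|g u * h u|%:E) t)%E.
  exact: (CE_ge0 P sF FE (measurable_EFin_abs mgh) (fun u => normr_ge0 (g u * h u))).
case: (CE _ t) => [r _ _|_|//]; first by rewrite ltry.
by rewrite gt0_muley// lte_fin mulr_gt0.
Unshelve. all: by end_near.
Qed.

Lemma bounded_orl (phi : R -> \bar R) g (M : R) : is_young phi -> measurable_fun [set: T] g ->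
  (forall t, `|g t| <= M) -> orl phi g.
Proof.
move=> Y mg gM; split => //.
have [delta delta0 deltafin] : exists2 delta : R, 0 < delta & (phi delta < +oo)%E.
  have [e /= e0 he] := young_finite_near0 Y.
  exists (e / 2); first by rewrite divr_gt0.
  apply: he; last by rewrite divr_gt0.
  rewrite /ball_/= sub0r normrN gtr0_norm ?divr_gt0//.
  by rewrite gtr_pMr// invf_lt1// ltr1n.
(* [phi] is finite at [delta] and c|g| <= delta, since |g| <= M; the summand 1 keeps the denominator
   positive. *)
pose c := delta / (Num.max M 0 + 1).
have M1 : 0 < Num.max M 0 + 1 by rewrite ltr_wpDl// le_max lexx orbT.
have c0 : 0 < c by rewrite divr_gt0.
exists (cst c); split; [exact: measurable_cst|by []|].
have [phi0 phind] := is_young_nd Y.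
have m1 := measurable_comp_nondecreasing phind (measurable_funM (@measurable_cst _ _ T _ setT c) mg).
have k0 (t : T) : (0 <= cst (phi delta) t)%E by exact/phi0/ltW.
have h1 := CE_le sF FE m1 (measurable_cst (phi delta)) (fun t => phi0 _ (normr_ge0 _)) k0 _.
have h2 : \forall t \ae P, CE (cst (phi delta)) t = phi delta.
  by apply: CE_unique => //; exact: measurable_cst.
near=> t; apply: (@le_lt_trans _ _ (CE (cst (phi delta)) t)).
  near: t; apply: h1; apply: aeW => t; apply: phind => //=.
  rewrite normrM (gtr0_norm c0) /c mulrAC ler_pdivrMr// ler_wpM2l ?(ltW delta0)//.
  by rewrite (le_trans (gM t))// ler_wpDr// le_max lexx.
by rewrite (_ : CE _ t = phi delta)//; near: t; exact: h2.
Unshelve. all: by end_near.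
Qed.

End orlicz_theory.

(** * Essential suprema *)

(** The preimage of the ray above y is the ray above [expand y] if |y| <= 1, and otherwise empty or
    everything. [contract] turns extended real functions into bounded ones without changing their
    order. *)
Lemma measurable_contract d (T : measurableType d) (R : realType) (Z : T -> \bar R) :
  measurable_fun [set: T] Z -> measurable_fun [set: T] (fun t => contract (Z t)).
Proof.
move=> mZ mD; apply: (measurability _ (RGenOInfty.measurableE R)) => //.
move=> _ [_ [y ->] <-]; rewrite setTI.
have [y1|y1] := leP `|y| 1.
  rewrite (_ : _ @^-1` _ = Z @^-1` `]expand y, +oo[%classic).
    by rewrite -[X in measurable X]setTI; apply: mZ => //; exact: emeasurable_itv.
  by apply/seteqP; split => t /=; rewrite !in_itv/= !andbT lt_expandLR ?inE.
have [y0|y0] := leP 0 y.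
  rewrite (_ : _ @^-1` _ = set0)//; apply/seteqP; split => t //=.
  rewrite in_itv/= andbT => yt; have := contract_le1 (Z t).
  by move: y1; rewrite ger0_norm// ler_norml => ? /andP[_ ?]; lra.
rewrite (_ : _ @^-1` _ = setT)//; apply/seteqP; split => t //= _.
rewrite in_itv/= andbT; have := contract_le1 (Z t).
by move: y1; rewrite ltr0_norm// ler_norml => ? /andP[? _]; lra.
Qed.

Lemma measurable_ereal_sup d (T : measurableType d) (R : realType) (u : nat -> T -> \bar R) :
  (forall n, measurable_fun [set: T] (u n)) ->
  measurable_fun [set: T] (fun t => ereal_sup (range (u ^~ t))).
Proof.
move=> mu; have := measurable_fun_esups mu 0%N.
rewrite (_ : (fun t => esups _ _) = (fun t => ereal_sup (range (u ^~ t))))//.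
apply/funext => t; congr ereal_sup; apply/seteqP; split => _ [n _ <-]; by exists n.
Qed.

Section essential_supremum.
Context (R : realType) (d : measure_display) (T : measurableType d).
Variables (P : probability T R) (F : set_system T).
Hypotheses (sF : sigma_algebra [set: T] F) (FE : F `<=` measurable).
Local Notation mF := (measurable_wrt F).
Local Notation TF := (g_sigma_algebraType F).
Variable G : set (T -> \bar R).
Hypothesis mG : forall g, G g -> exists2 f, mF f & \forall t \ae P, g t = f t.
Hypothesis G0 : G !=set0.

Let ver (g : T -> \bar R) := xget (cst 0%E) [set f | mF f /\ \forall t \ae P, g t = f t].

Let verP g : G g -> mF (ver g) /\ \forall t \ae P, g t = ver g t.
Proof. by move=> /mG[f mf gf]; apply: (@xgetPex _ (cst 0%E) [set f | mF f /\ \forall t \ae P, g t = f t]); exists f. Qed.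

Let S (u : nat -> T -> \bar R) t := ereal_sup (range (fun n => ver (u n) t)).

(** Takes values in [0, 2] and is monotone. As [contract] is injective, two ordered functions with
    the same [J] agree a.s., so exhaustion needs no integrability of the family. *)
Let J (Z : T -> \bar R) := (\int[P]_t (1 + contract (Z t))%:E)%E.

Let mS u : (forall n, G (u n)) -> mF (S u).
Proof. by move=> Gu; apply: (@measurable_ereal_sup _ TF) => n; exact: (verP (Gu n)).1. Qed.

Let c_ge0 (x : \bar R) : 0 <= 1 + contract x.
Proof. by have := contract_le1 x; rewrite ler_norml => /andP[? _]; lra. Qed.

Let mc (Z : T -> \bar R) : measurable_fun setT Z ->
  measurable_fun setT (fun t => (1 + contract (Z t))%:E).
Proof. by move=> mZ; apply/measurable_EFinP/measurable_funD => //; exact: measurable_contract. Qed.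

Let J_le (Z Z' : T -> \bar R) : measurable_fun setT Z -> measurable_fun setT Z' ->
  (forall t, (Z t <= Z' t)%E) -> (J Z <= J Z')%E.
Proof.
move=> mZ mZ' ZZ'; apply: ge0_le_integral => //.
- by move=> t _; rewrite lee_fin.
- exact: mc.
- exact: mc.
- by move=> t _; rewrite lee_fin lerD2l le_contract.
Qed.

Let J_le2 (Z : T -> \bar R) : measurable_fun setT Z -> (J Z <= 2%:E)%E.
Proof.
move=> mZ; apply: (@le_trans _ _ (\int[P]_t cst 2%:E t)%E).
  apply: ge0_le_integral => //.
  - by move=> t _; rewrite lee_fin.
  - exact: mc.
  - move=> t _; rewrite lee_fin; have := contract_le1 (Z t).
    by rewrite ler_norml => /andP[_ ?]; lra.
by rewrite integral_cst//= probability_setT mule1.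
Qed.

(** Exhaustion: sequences whose suprema nearly maximise [J] are merged, through a coding of pairs,
    into one sequence [w] that attains the maximum. A further member of [G] cannot increase [J],
    hence lies below the supremum of [w]. Attainment along a sequence later turns statements on
    essential suprema into countably many events. *)
Lemma ess_sup_attained : exists u : nat -> T -> \bar R, exists Z : T -> \bar R,
  [/\ forall n, G (u n), mF Z, \forall t \ae P, Z t = ereal_sup (range (u ^~ t)) &
    is_ess_sup P G Z].
Proof.
have [g0 Gg0] := G0.
pose U := [set u : nat -> T -> \bar R | forall n, G (u n)].
pose alpha := ereal_sup [set J (S u) | u in U].
have mS' u : U u -> measurable_fun setT (S u).
  by move=> Uu; exact: (measurable_wrtW sF FE (mS Uu)).
have alphafin : alpha \is a fin_num.
  rewrite ge0_fin_numE.
    apply: (@le_lt_trans _ _ 2%:E); last exact: ltry.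
    by apply: ub_ereal_sup => _ [u Uu <-]; apply: J_le2; exact: mS'.
  apply: (@le_trans _ _ (J (S (fun=> g0)))).
    by apply: integral_ge0 => t _; rewrite lee_fin.
  by apply: ereal_sup_ubound; exists (fun=> g0).
have ex k : exists u, U u /\ (alpha - k.+1%:R^-1%:E < J (S u))%E.
  have [||_ [u Uu <-] h] := @ub_ereal_sup_adherent R [set J (S u) | u in U] (k.+1%:R^-1) => //.
  by exists u.
have [u uP] := choice ex.
pose w n := if choice.unpickle n is Some (k, m) then u k m else g0.
have Uw : U w by move=> n; rewrite /w; case: choice.unpickle => [[k m]|//]; exact: (uP k).1.
have wu k t : (S (u k) t <= S w t)%E.
  apply: ub_ereal_sup => _ [m _ <-]; apply: ereal_sup_ubound.
  by exists (choice.pickle (k, m)) => //; rewrite /w choice.pickleK.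
have Jw : (alpha <= J (S w))%E.
  apply/lee_addgt0Pr => e e0.
  have [k ke] : exists k : nat, k.+1%:R^-1 < e.
    exists (Num.bound e^-1); rewrite invf_plt ?posrE//.
    by apply: (lt_trans (archi_boundP _)); rewrite ?invr_ge0 ?ltW// ltr_nat.
  rewrite -leeBlDr//.
  apply: (@le_trans _ _ (J (S (u k)))); last exact: (J_le (mS' _ (uP k).1) (mS' _ Uw) (wu k)).
  apply: ltW; apply: le_lt_trans (uP k).2.
  by rewrite leeB// lee_fin ltW.
exists w, (S w); split => //; first exact: mS.
  have : \forall t \ae P, forall n, w n t = ver (w n) t.
    by apply: ae_foralln => n; exact: (verP (Uw n)).2.
  by apply: filterS => t h; congr ereal_sup; apply/seteqP; split => _ [n _ <-]; exists n.
split; first exact: mS'.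
  move=> g Gg; have [mg vg] := verP Gg.
  (* Prepending [g] gives another admissible sequence, whose [J] cannot exceed the maximum; so the
     suprema of [w] and [w'] agree a.s. *)
  pose w' n := if n is m.+1 then w m else g.
  have Uw' : U w' by case.
  have ww' t : (S w t <= S w' t)%E.
    by apply: ub_ereal_sup => _ [m _ <-]; apply: ereal_sup_ubound; exists m.+1.
  have mw := mc (mS' _ Uw); have mw' := mc (mS' _ Uw').
  have iw (Z : T -> \bar R) : measurable_fun setT Z ->
      P.-integrable setT (fun t => (1 + contract (Z t))%:E).
    move=> mZ; apply/integrableP; split; first exact: mc.
    rewrite (_ : (\int[P]_t _ = J Z)%E); first by apply: le_lt_trans (J_le2 mZ) (ltry _).
    by apply: eq_integral => t _; rewrite gee0_abs// lee_fin.
  have /(ae_eq_integral_abs P measurableT) :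
      (\int[P]_t `|(1 + contract (S w' t))%:E - (1 + contract (S w t))%:E| = 0)%E.
    rewrite (_ : (\int[P]_t _ = \int[P]_t ((fun t => (1 + contract (S w' t))%:E) \-
        (fun t => (1 + contract (S w t))%:E)) t)%E); last first.
      apply: eq_integral => t _ /=; rewrite ger0_norm//.
      by rewrite subr_ge0 lerD2l le_contract.
    rewrite integralB//; [|exact/iw/mS'|exact/iw/mS'].
    apply/eqP; rewrite eq_le; apply/andP; split.
      by rewrite sube_le0; apply: le_trans Jw; apply: ereal_sup_ubound; exists w'.
    rewrite sube_ge0; first exact: (J_le (mS' _ Uw) (mS' _ Uw') ww').
    by apply/orP; left; apply: integrable_fin_num => //; exact/iw/mS'.
  move=> /(_ (emeasurable_funB mw' mw)).
  apply: filterS2 vg => t -> /(_ Logic.I) /eqP.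
  rewrite -EFinB eqe subr_eq0 => /eqP /addrI /contract_inj <-.
  by apply: ereal_sup_ubound; exists 0%N.
move=> Z' mZ' GZ'.
have h1 : \forall t \ae P, forall n, (w n t <= Z' t)%E.
  by apply: ae_foralln => n; exact: GZ'.
have h2 : \forall t \ae P, forall n, w n t = ver (w n) t.
  by apply: ae_foralln => n; exact: (verP (Uw n)).2.
by apply: filterS2 h1 h2 => t h1 h2; apply: ub_ereal_sup => _ [n _ <-]; rewrite -h2.
Qed.

End essential_supremum.

(** * Conditional Koethe duality *)

Section rational_maximizers.
Context (R : realType) (phi : R -> \bar R).
Hypothesis Y : is_young phi.

(** The supremum defining the conjugate may be taken over the nonnegative rationals where [phi] is
    finite, so near-maximisers can be selected measurably by finitely many comparisons. Other codes
    give 0, where [phi] vanishes. *)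
Let q (m : nat) : R := if choice.unpickle m is Some r then
  (if (0 <= ratr r :> R) && (phi (ratr r) < +oo)%E then ratr r else 0) else 0.

Let q_ge0 m : 0 <= q m.
Proof. by rewrite /q; case: choice.unpickle => [r|]//; case: ifPn => // /andP[]. Qed.

Let phi_q m : phi (q m) \is a fin_num.
Proof.
rewrite ge0_fin_numE; last exact: (young_ge0 Y).
have p0 : (phi 0 < +oo)%E by rewrite (young0 Y).
by rewrite /q; case: choice.unpickle => [r|]//; case: ifPn => // /andP[].
Qed.

Fixpoint young_max (m : nat) (a : R) : R :=
  if m is k.+1 then Num.max (young_max k a) (q k * a - fine (phi (q k))) else 0.

Fixpoint young_argmax (m : nat) (a : R) : R :=
  if m is k.+1 then
    if young_max k a < q k * a - fine (phi (q k)) then q k else young_argmax k a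
  else 0.

Lemma young_max_ge0 m a : 0 <= young_max m a.
Proof. by elim: m => [|m ih]//=; rewrite le_max ih. Qed.

Lemma young_argmax_ge0 m a : 0 <= young_argmax m a.
Proof. by elim: m => [|m ih]//=; case: ifPn. Qed.

(** For fixed [m] only finitely many values occur, each with finite [phi]; hence a bound uniform in
    [a]. *)
Lemma young_argmax_bounded m : exists2 M : R, forall a, (phi (young_argmax m a) <= M%:E)%E & 0 <= M.
Proof.
elim: m => [|m [M ih M0]]; first by exists 0 => // a /=; rewrite (young0 Y).
exists (Num.max M (fine (phi (q m)))); last by rewrite le_max M0.
move=> a /=; case: ifPn => _; first by rewrite -[leLHS]fineK// lee_fin le_max lexx orbT.
by apply: (le_trans (ih a)); rewrite lee_fin le_max lexx.
Qed.

Lemma young_argmax_fin m a : phi (young_argmax m a) \is a fin_num.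
Proof.
have [M h _] := young_argmax_bounded m.
rewrite ge0_fin_numE; last exact/(young_ge0 Y)/young_argmax_ge0.
exact: le_lt_trans (h a) (ltry _).
Qed.

(** The equality case of Young's inequality, with the conjugate replaced by the supremum over 0 and
    the first [m] points. *)
Lemma young_argmaxE m a :
  ((young_argmax m a * a)%:E = (young_max m a)%:E + phi (young_argmax m a))%E.
Proof.
rewrite -[phi _]fineK ?young_argmax_fin// -EFinD; congr EFin.
elim: m => [|m ih] /=; first by rewrite (young0 Y) /= mul0r addr0.
by rewrite /Num.max; case: ifPn => _ //; rewrite subrK.
Qed.

Lemma young_max_nd a : nondecreasing_seq (young_max ^~ a).
Proof. by apply/nondecreasing_seqP => n /=; rewrite le_max lexx. Qed.

Lemma young_max_cvg a : 0 <= a -> (young_max m a)%:E @[m --> \oo] --> young_conjugate phi a.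
Proof.
move=> a0.
suff <- : ereal_sup (range (fun m => (young_max m a)%:E)) = young_conjugate phi a.
  by apply: ereal_nondecreasing_cvgn => m n mn; rewrite lee_fin young_max_nd.
set s := ereal_sup _.
have sge m : ((young_max m a)%:E <= s)%E by apply: ereal_sup_ubound; exists m.
apply/eqP; rewrite eq_le; apply/andP; split.
  apply: ub_ereal_sup => _ [m _ <-].
  elim: m => [|m ih] /=; first exact: (young_conjugate_nd Y).1.
  rewrite EFin_max ge_max ih/=; apply: ereal_sup_ubound; exists (q m); first exact: q_ge0.
  by rewrite EFinB fineK.
apply: ub_ereal_sup => _ [r /= r0 <-].
have [|] := ltP (phi r) +oo%E; last first.
  by rewrite leye_eq => /eqP ->; rewrite addeNy leNye.
rewrite -ge0_fin_numE; last exact: (young_ge0 Y).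
move=> /fineK phir; rewrite -phir -EFinB.
have [->|] := eqVneq r 0.
  apply: le_trans (sge 0%N); rewrite lee_fin mul0r sub0r oppr_le0.
  by apply: fine_ge0; exact: (young_ge0 Y).
move=> rn0; have {}r0 : 0 < r by rewrite lt_neqAle eq_sym rn0.
apply/lee_addgt0Pr => e e0.
have a1 : 0 < a + 1 by rewrite ltr_wpDl.
(* A rational below [r] keeps phi(z) <= phi(r), hence finite, and at distance less than e/(a + 1) it
   lowers the product with [a] by at most [e]. *)
have [z zr] := @rat_in_itvoo R (Num.max 0 (r - e / (a + 1))) r ltac:(
  by rewrite gt_max r0 gtrBl divr_gt0).
move: zr; rewrite in_itv/= gt_max -andbA => /and3P[z0 zr1 zr2].
have phz : (phi (ratr z) <= phi r)%E by apply: (young_nd Y); exact: ltW.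
have qz : q (choice.pickle z) = ratr z.
  rewrite /q choice.pickleK (ltW z0)/=; case: ifPn => //.
  by rewrite (le_lt_trans phz)// -phir ltry.
have : ((q (choice.pickle z) * a - fine (phi (q (choice.pickle z))))%:E <= s)%E.
  by apply: le_trans (sge (choice.pickle z).+1); rewrite lee_fin/= le_max lexx orbT.
rewrite -leeBlDr//; apply: le_trans; rewrite -EFinB lee_fin qz.
have : fine (phi (ratr z)) <= fine (phi r).
  by rewrite fine_le//; [rewrite -qz|rewrite -phir].
have : (r - ratr z) * a <= e.
  apply: (@le_trans _ _ (e / (a + 1) * a)).
    by rewrite ler_wpM2r//; lra.
  by rewrite mulrAC ler_pdivrMr// ler_wpM2l// ?ltW// ltrDl.
by move: (fine _) (fine _) => *; lra.
Qed.

Lemma measurable_young_max d (T : measurableType d) m (a : T -> R) :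
  measurable_fun [set: T] a -> measurable_fun [set: T] (fun t => young_max m (a t)).
Proof.
move=> ma; elim: m => [|m ih] /=; first exact: measurable_cst.
by apply: measurable_maxr => //; apply: measurable_funB => //; exact: measurable_funM.
Qed.

Lemma measurable_young_argmax d (T : measurableType d) m (a : T -> R) :
  measurable_fun [set: T] a -> measurable_fun [set: T] (fun t => young_argmax m (a t)).
Proof.
move=> ma; elim: m => [|m ih] /=; first exact: measurable_cst.
apply: measurable_fun_ifT => //; apply: measurable_fun_ltr; first exact: measurable_young_max.
by apply: measurable_funB => //; exact: measurable_funM.
Qed.

(** Convexity between [r] and 0 with weight 1/a. *)
Lemma young_div (r a : R) : 0 <= r -> 1 <= a -> (phi (r / a) <= a^-1%:E * phi r)%E.
Proof.
move=> r0 a1; have a0 : 0 < a by rewrite (lt_le_trans _ a1).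
have t01 : 0 <= a^-1 <= 1 by rewrite invr_ge0 ltW//= invf_le1.
have := young_convex Y r0 (lexx 0) t01.
by rewrite mulr0 addr0 (young0 Y) mule0 adde0 mulrC.
Qed.

End rational_maximizers.

(** The inverse is exp(-ln h), a composition of measurable maps. *)
Lemma measurable_funV (R : realType) d (S : measurableType d) (h : S -> R) : (forall t, 0 < h t) ->
  measurable_fun [set: S] h -> measurable_fun [set: S] (fun t => (h t)^-1).
Proof.
move=> h0 mh; rewrite (_ : (fun t => _) = expR \o (-%R \o (@ln R \o h))).
  apply: measurableT_comp => //; apply: measurableT_comp => //.
  by apply: measurableT_comp => //; exact: measurable_ln.
by apply/funext => t /=; rewrite expRN lnK ?posrE.
Qed.

(** * Functions pairing finitely with the Orlicz space lie in the conjugate space *)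

Section koethe_dual.
Context (R : realType) (d : measure_display) (T : measurableType d).
Variables (P : probability T R) (F : set_system T).
Hypotheses (sF : sigma_algebra [set: T] F) (FE : F `<=` measurable).
Local Notation mF := (measurable_wrt F).
Local Notation TF := (g_sigma_algebraType F).
Local Notation CE := (CE P F).
Variable phi : R -> \bar R.
Hypothesis Y : is_young phi.
Local Notation psi := (young_conjugate phi).
Variable y : T -> R.
Hypothesis my : measurable_fun [set: T] y.

Let nd_phi := is_young_nd Y.
Let nd_psi := young_conjugate_nd Y.

Let mphi (g : T -> R) : measurable_fun [set: T] g -> (forall t, 0 <= g t) ->
  measurable_fun [set: T] (fun t => phi (g t)).
Proof.
move=> mg g0; have := measurable_comp_nondecreasing nd_phi.2 mg.
rewrite (_ : (fun t => phi `|g t|) = (fun t => phi (g t)))//.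
by apply/funext => t; rewrite ger0_norm.
Qed.

Lemma CE_cst (c : \bar R) : (0 <= c)%E -> \forall t \ae P, CE (cst c) t = c.
Proof.
by move=> c0; apply: (CE_unique sF FE (measurable_cst c) (fun _ => c0)
  (@measurable_cst _ _ TF _ setT c) (fun _ => c0)).
Qed.

Let a t := `|y t|.
Let ma : measurable_fun [set: T] a. Proof. exact: measurableT_comp. Qed.

(* a conditionally normalised near-maximiser in the definition of [phi^*] *)
Lemma koethe_step (K : R) : 0 < K -> exists X : T -> R,
  [/\ measurable_fun [set: T] X, forall t, 0 <= X t,
      \forall t \ae P, (CE (fun u => phi (X u)) t <= 1)%E &
      \forall t \ae P, CE (fun u => psi `|(K^-1 * y u)%R|%R) t = +oo%E ->
        (K%:E <= CE (fun u => (X u * `|y u|)%:E) t)%E].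
Proof.
move=> K0; pose b t := `|K^-1 * y t|.
have b0 t : 0 <= b t by exact: normr_ge0.
have mb : measurable_fun [set: T] b.
  by apply: measurableT_comp => //; exact: measurable_funM.
have mpsib : measurable_fun [set: T] (fun t => psi (b t)).
  by apply: (measurable_comp_nondecreasing nd_psi.2); exact: measurable_funM.
have psib0 t : (0 <= psi (b t))%E by exact: nd_psi.1.
pose S k t := young_max phi k (b t); pose r k t := young_argmax phi k (b t).
have mS k : measurable_fun [set: T] (fun t => (S k t)%:E).
  by apply/measurable_EFinP; exact: measurable_young_max.
have mr k : measurable_fun [set: T] (r k) by exact: measurable_young_argmax.
have r0 k t : 0 <= r k t by exact: young_argmax_ge0.
have S0 k t : (0 <= (S k t)%:E)%E by rewrite lee_fin; exact: young_max_ge0.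
have hsup := CE_sup P sF FE mS mpsib S0 _ (fun t => young_max_cvg Y (b0 t)).
have {}hsup : \forall t \ae P, CE (fun u => (S n u)%:E) t @[n --> \oo] --> CE (fun u => psi (b u)) t.
  by apply: hsup => t m n mn; rewrite lee_fin; exact: (young_max_nd phi (b t)).
pose D := [set t | CE (fun u => psi (b u)) t = +oo%E].
have mCE := measurable_CE P sF FE mpsib psib0.
have FD : F D.
  rewrite -(measurable_FE sF) -[X in measurable X]setTI.
  exact: (measurable_eqe measurableT mCE (measurable_cst _)).
(* On [D] the conditional expectations of [S k] tend to infinity, so some index makes them at least
   1; off [D] nothing is claimed and any index will do. *)
pose C k := [set t | (1 <= CE (fun u => (S k u)%:E) t)%E] `|` ~` D.
have FC k : F (C k).
  rewrite -(measurable_FE sF); apply: measurableU; last first.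
    by apply: measurableC; rewrite measurable_FE.
  rewrite -[X in measurable X]setTI.
  apply: (measurable_lee measurableT (measurable_cst _)).
  exact: (measurable_CE P sF FE (mS k) (S0 k)).
have cC : \forall t \ae P, exists k, C k t.
  apply: filterS hsup => t ht.
  have [Dt|nDt] := pselect (D t); last by exists 0%N; right.
  move: ht; rewrite Dt => /cvgeyPge /(_ 1) [k _ hk].
  by exists k; left; exact: (hk k (leqnn k)).
have [A pA AC] := first_partition sF FC cC.
pose rr := paste A r; pose SS := paste A S.
have mrr : measurable_fun [set: T] rr by exact: (measurable_paste FE pA).
have rr0 t : 0 <= rr t by exact: r0.
have mSS : measurable_fun [set: T] (fun t => (SS t)%:E).
  apply/measurable_EFinP; apply: (measurable_paste FE pA) => k.
  exact: measurable_young_max.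
have SS0 t : (0 <= (SS t)%:E)%E by exact: S0.
have mprr := mphi mrr rr0.
have prr0 t : (0 <= phi (rr t))%E by exact: nd_phi.1.
pose Phi := CE (fun u => phi (rr u)).
have mPhi : mF Phi by exact: measurable_CE.
have Phifin : \forall t \ae P, Phi t \is a fin_num.
  have loc : \forall t \ae P, forall k, A k t -> Phi t = CE (fun u => phi (r k u)) t.
    apply: ae_foralln => k; have [FA _ _] := pA.
    apply: (CE_local P sF FE mprr (mphi (mr k) (r0 k)) prr0
      (fun t => nd_phi.1 _ (r0 k t)) (FA k)) => t Akt.
    by rewrite /rr (pasteE _ pA Akt).
  have bd : \forall t \ae P, forall k, (CE (fun u => phi (r k u)) t < +oo)%E.
    apply: ae_foralln => k; have [M hM M0] := young_argmax_bounded Y k.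
    have M0' (t : T) : (0 <= cst M%:E t)%E by rewrite lee_fin.
    have h1 : \forall t \ae P, (CE (fun u => phi (r k u)) t <= CE (cst M%:E) t)%E.
      apply: (CE_le sF FE (mphi (mr k) (r0 k)) (measurable_cst _)
        (fun t => nd_phi.1 _ (r0 k t)) M0').
      by apply: aeW => t; exact: hM.
    have h2 := @CE_cst M%:E M0.
    by apply: filterS2 h1 h2 => t h1 h2; rewrite (le_lt_trans h1)// h2 ltry.
  apply: filterS2 loc bd => t l bd.
  rewrite ge0_fin_numE; last exact: (CE_ge0 P sF FE mprr prr0).
  by rewrite (l _ (block_mem t pA)).
(* An [F]-measurable normaliser at least 1: by convexity, dividing [rr] by it divides E[phi(rr) | F]
   by at least as much, leaving at most 1. *)
pose al t := Num.max 1 (fine (Phi t)).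
have mal : mF al.
  apply: (@measurable_maxr _ TF) => //.
  exact: (measurableT_comp (fine_measurable measurableT) mPhi).
have al1 t : 1 <= al t by rewrite le_max lexx.
have al0 t : 0 < al t by rewrite (lt_le_trans _ (al1 t)).
have mali : mF (fun t => (al t)^-1).
  exact: (@measurable_funV _ _ TF al al0 mal).
have mali' := measurable_wrtW sF FE mali.
exists (fun t => rr t / al t).
have mX : measurable_fun [set: T] (fun t => rr t / al t) by exact: measurable_funM.
have X0 t : 0 <= rr t / al t by rewrite divr_ge0// ltW.
split => //.
  have h1 : \forall t \ae P, (CE (fun u => phi (rr u / al u)) t <=
      CE (fun u => (al u)^-1%:E * phi (rr u))%E t)%E.
    apply: CE_le => //.
    - exact: mphi.
    - by apply: emeasurable_funM => //; exact/measurable_EFinP.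
    - by move=> t; exact: nd_phi.1.
    - by move=> t; rewrite mule_ge0// lee_fin invr_ge0 ltW.
    - by apply: aeW => t; exact: (young_div Y).
  have h2 : \forall t \ae P, CE (fun u => (al u)^-1%:E * phi (rr u))%E t = ((al t)^-1%:E * Phi t)%E.
    apply: (@CE_pull _ _ _ P _ sF FE (fun t => (al t)^-1%:E)) => //.
    - exact/measurable_EFinP.
    - by move=> t; rewrite lee_fin invr_ge0 ltW.
  apply: filterS3 h1 h2 Phifin => t h1 h2 Pt; rewrite (le_trans h1)// h2.
  by rewrite -(fineK Pt) lee_fin mulrC ler_pdivrMr// mul1r le_max lexx orbT.
have mrb : measurable_fun [set: T] (fun t => rr t * b t) by exact: measurable_funM.
have rb0 t : 0 <= rr t * b t by rewrite mulr_ge0.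
have mKal : mF (fun t => K / al t) by exact: (@measurable_funM _ TF).
have h1 := ge0_CEr_pull P sF FE mrb rb0 mKal _.
have h2 := CE_add P sF FE mSS mprr SS0 prr0.
have h3 : \forall t \ae P, forall k, A k t -> CE (fun u => (SS u)%:E) t = CE (fun u => (S k u)%:E) t.
  apply: ae_foralln => k; have [FA _ _] := pA.
  apply: (CE_local P sF FE mSS (mS k) SS0 (S0 k) (FA k)) => t Akt.
  by rewrite /SS (pasteE _ pA Akt).
near=> t => Dt.
rewrite (_ : (fun u => (rr u / al u * `|y u|)%:E) = (fun u => (K / al u * (rr u * b u))%:E)); last first.
  apply/funext => u; rewrite /b normrM gtr0_norm ?invr_gt0//; congr EFin.
  by field; rewrite !gt_eqF.
rewrite (_ : CE (fun u => (K / al u * (rr u * b u))%:E) t =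
  ((K / al t)%:E * CE (fun u => (rr u * b u)%:E) t)%E); last first.
  by near: t; apply: h1 => t; rewrite divr_ge0 ?ltW.
rewrite (_ : (fun u => (rr u * b u)%:E) = (fun u => (SS u)%:E + phi (rr u))%E); last first.
  by apply/funext => u; exact: (young_argmaxE Y).
rewrite (_ : CE (fun u => (SS u)%:E + phi (rr u))%E t =
   (CE (fun u => (SS u)%:E) t + Phi t)%E); last by near: t; exact: h2.
have S1 : (1 <= CE (fun u => (SS u)%:E) t)%E.
  rewrite (_ : CE (fun u => (SS u)%:E) t = CE (fun u => (S (block A t) u)%:E) t); last first.
    move: (block_mem t pA); move: (block A t); near: t.
    by apply: filterS h3 => t h k; exact: h.
  have : C (block A t) t.
    move: (block_mem t pA); move: (block A t); near: t.
    by apply: filterS AC => t h k; exact: h.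
  by case.
have Pt : Phi t \is a fin_num by near: t; exact: Phifin.
(* The normalisation costs nothing: [al] is at most 1 + Phi, and E[SS | F] is at least 1 on [D]. *)
apply: (@le_trans _ _ ((K / al t)%:E * (1 + Phi t))%E); last first.
  by rewrite lee_wpmul2l ?leeD2r// lee_fin divr_ge0// ltW.
rewrite -(fineK Pt) -EFinD -EFinM lee_fin mulrAC ler_pdivlMr// ler_wpM2l ?(ltW K0)//.
have : 0 <= fine (Phi t) by apply: fine_ge0; exact: CE_ge0.
by rewrite /al ge_max => ?; apply/andP; split; lra.
Unshelve. all: by end_near.
Qed.

Let pow2 j : 0 < (2^-1 : R) ^+ j. Proof. by rewrite exprn_gt0. Qed.

(** Gliding hump. Where all these expectations are infinite, [koethe_step] with K = 4^j gives X_j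
    with E[phi(X_j) | F] <= 1 and E[X_j |y| | F] >= 4^j. Half the supremum of the 2^-j X_j is an
    element x of the Orlicz space, yet E[x|y| | F] >= 2^j/2 for every j. *)
Lemma CE_infinite_ae :
  (forall x : T -> R, orl P F phi x -> (forall t, 0 <= x t) ->
    \forall t \ae P, (CE (fun u => (x u * `|y u|)%:E) t < +oo)%E) ->
  \forall t \ae P, exists n, (CE (fun u => psi `|(n.+1%:R^-1 * y u)|%R) t < +oo)%E.
Proof.
move=> hfin.
have [X XP] := choice (fun j => koethe_step (exprn_gt0 j (ltr0n R 4))).
have mX j : measurable_fun [set: T] (X j) by have [] := XP j.
have X0 j t : 0 <= X j t by have [] := XP j.
pose x' j t := 2^-1 ^+ j * X j t.
have mx' j : measurable_fun [set: T] (x' j) by exact: measurable_funM.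
have x'0 j t : 0 <= x' j t by rewrite mulr_ge0// ltW.
pose V j t := ((2^-1 ^+ j)%:E * phi (X j t))%E.
have V0 j t : (0 <= V j t)%E by rewrite mule_ge0 ?lee_fin ?(ltW (pow2 j))//; exact: nd_phi.1.
have mV j : measurable_fun [set: T] (V j) by apply: measurable_funeM; exact: mphi.
have phix' j t : (phi (x' j t) <= V j t)%E.
  rewrite /x' /V mulrC -[2^-1 ^+ j]invrK -exprVn invrK.
  have := @young_div _ _ Y (X j t) (2 ^+ j) (X0 j t) (exprn_ege1 _ (ler1n R 2)).
  by [].
pose W n t := (\sum_(0 <= j < n) V j t)%E.
pose Winf t := (\sum_(j <oo) V j t)%E.
have mW n : measurable_fun [set: T] (W n) by exact: emeasurable_sum.
have W0 n t : (0 <= W n t)%E by exact: sume_ge0.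
have Wnd t : nondecreasing_seq (W ^~ t).
  by apply/nondecreasing_seqP => n; rewrite /W big_nat_recr//= leeDl.
have WW t : W ^~ t @ \oo --> Winf t by exact: is_cvg_nneseries.
have mWinf : measurable_fun [set: T] Winf by apply: ge0_emeasurable_sum.
have Winf0 t : (0 <= Winf t)%E by exact: nneseries_ge0.
have CEV j : \forall t \ae P, (CE (V j) t <= (2^-1 ^+ j)%:E)%E.
  have p0 (t : T) : (0 <= cst ((2^-1 : R) ^+ j)%:E t)%E by rewrite lee_fin ltW.
  have [_ _ + _] := XP j.
  have := @CE_pull _ _ _ P _ sF FE (cst (2^-1 ^+ j)%:E) _ (mphi (mX j) (X0 j))
    (fun t => nd_phi.1 _ (X0 j t)) (@measurable_cst _ _ TF _ setT _) p0.
  apply: filterS2 => t /= -> h.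
  by rewrite -[leRHS]mule1 lee_wpmul2l// lee_fin ltW.
have CEW : \forall t \ae P, forall n, (CE (W n) t <= (2 - 2 * 2^-1 ^+ n)%:E)%E.
  apply: ae_foralln; elim => [|n ih].
    have := CE_cst (lexx 0%E).
    rewrite (_ : W 0%N = cst 0%E); last by apply/funext => t; rewrite /W big_geq.
    by apply: filterS => t ->; rewrite expr0 mulr1 subrr.
  have := CE_add P sF FE (mW n) (mV n) (W0 n) (V0 n).
  rewrite (_ : (fun u => W n u + V n u)%E = W n.+1); last first.
    by apply/funext => t; rewrite /W big_nat_recr.
  apply: filterS3 ih (CEV n) => t ih h ->; apply: le_trans (leeD ih h) _.
  by rewrite -EFinD lee_fin exprS; lra.
have CEWinf : \forall t \ae P, (CE Winf t <= 2%:E)%E.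
  apply: filterS2 CEW (CE_sup P sF FE mW mWinf W0 Wnd WW) => t h; apply: cvge_le.
  apply: nearW => n; apply: (le_trans (h n)).
  by rewrite lee_fin gerBl mulr_ge0// ltW.
have Wfin : \forall t \ae P, (Winf t < +oo)%E.
  have iW : P.-integrable setT Winf.
    apply/integrableP; split => //.
    rewrite (_ : (\int[P]_t _ = \int[P]_t CE Winf t)%E); last first.
      rewrite integral_CE//; last by rewrite -(measurable_FE sF).
      by apply: eq_integral => t _; rewrite gee0_abs.
    apply: (@le_lt_trans _ _ (\int[P]_t cst 2%:E t)%E).
      apply: ae_ge0_le_integral => //.
      - by move=> t _; exact: CE_ge0.
      - exact: (measurable_wrtW sF FE (measurable_CE P sF FE mWinf Winf0)).
      - by move=> t _; rewrite lee_fin.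
      - by apply: filterS CEWinf.
    by rewrite integral_cst//= probability_setT mule1 ltry.
  by apply: filterS (integrable_ae measurableT iW) => t /(_ Logic.I); rewrite ge0_fin_numE.
(* A supremum instead of a sum: [phi] of half of it is bounded by a single term phi(x' j), which the
   series [Winf] dominates. *)
pose s t := ereal_sup (range (fun j => (x' j t)%:E)).
have s0 t : (0 <= s t)%E.
  by apply: (@le_trans _ _ (x' 0%N t)%:E); [rewrite lee_fin|apply: ereal_sup_ubound; exists 0%N].
pose x t := fine (s t) / 2.
have mx : measurable_fun [set: T] x.
  apply: measurable_funM => //; apply: (measurableT_comp (fine_measurable measurableT)).
  by apply: measurable_ereal_sup => j; exact/measurable_EFinP.
have x0 t : 0 <= x t by rewrite divr_ge0// fine_ge0.
have VW j t : (V j t <= Winf t)%E.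
  apply: (@le_trans _ _ (W j.+1 t)).
    by rewrite (_ : W j.+1 t = W j t + V j t)%E ?leeDr//; rewrite /W big_nat_recr.
  exact: nneseries_lim_ge.
have sfin t : (Winf t < +oo)%E -> s t \is a fin_num.
  move=> Wt; rewrite ge0_fin_numE//.
  (* Beyond some [M] the values of [phi] exceed the finite number [Winf t], whereas phi(x' j t) <=
     Winf t for all j; hence the x' j t are bounded. *)
  have := young_infty Y; move=> /cvgeyPgt /(_ (fine (Winf t))) [M [_ hM]].
  pose M' := Num.max M 0 + 1.
  have M'0 : 0 <= M' by rewrite addr_ge0// le_max lexx orbT.
  apply: (@le_lt_trans _ _ M'%:E); last exact: ltry.
  apply: ub_ereal_sup => _ [j _ <-]; rewrite lee_fin leNgt; apply/negP => h.
  have MM : M < M' by rewrite /M' (@le_lt_trans _ _ (Num.max M 0)) ?le_max ?lexx// ltrDl.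
  have := hM _ MM; rewrite fineK; last by rewrite ge0_fin_numE.
  apply/negP; rewrite -leNgt; apply: le_trans (VW j t); apply: le_trans (phix' j t).
  exact: nd_phi.2 _ _ M'0 (ltW h).
have phix t : (Winf t < +oo)%E -> (phi (x t) <= Winf t)%E.
  move=> Wt; have st := sfin _ Wt.
  have [x_0|xn0] := eqVneq (x t) 0; first by rewrite x_0 (young0 Y).
  (* Halving makes the inequality strict, so some x' j t already exceeds x t. *)
  have xs : ((x t)%:E < s t)%E.
    rewrite -(fineK st) lte_fin /x.
    have : 0 < x t by rewrite lt_neqAle eq_sym xn0 x0.
    by rewrite /x; move: (fine _) => ?; lra.
  have [_ [j _ <-] xj] := ereal_sup_gt xs.
  apply: le_trans (VW j t); apply: le_trans (phix' j t).
  by apply: nd_phi.2 => //; rewrite ltW.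
have x'x j t : (Winf t < +oo)%E -> 2^-1 * x' j t <= x t.
  move=> Wt; have st := sfin _ Wt; rewrite /x mulrC ler_wpM2r//.
  by rewrite -lee_fin fineK//; apply: ereal_sup_ubound; exists j.
have ox : orl P F phi x.
  split => //; exists (cst 1); split; [exact: measurable_cst|by move=> t; exact: ltr01|].
  have h1 : \forall t \ae P, (CE (fun u => phi `|(cst 1 u * x u)%R|%R) t <= CE Winf t)%E.
    rewrite (_ : (fun u => phi _) = (fun u => phi (x u))); last first.
      by apply/funext => u /=; rewrite mul1r ger0_norm.
    apply: (CE_le sF FE (mphi mx x0) mWinf (fun t => nd_phi.1 _ (x0 t)) Winf0).
    by apply: filterS Wfin => t; exact: phix.
  by apply: filterS2 h1 CEWinf => t h1 h2; rewrite (le_lt_trans h1)// (le_lt_trans h2)// ltry.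
have mxy (g : T -> R) : measurable_fun setT g -> measurable_fun setT (fun u => (g u * `|y u|)%:E).
  by move=> mg; apply/measurable_EFinP; exact: measurable_funM.
have hX : \forall t \ae P, forall j, CE (fun u => psi `|((4 ^+ j)^-1 * y u)%R|%R) t = +oo%E ->
   ((2^-1 * 2 ^+ j)%:E <= CE (fun u => (x u * `|y u|)%:E) t)%E.
  apply: ae_foralln => j; have [_ _ _ h1] := XP j.
  pose c := 2^-1 * 2^-1 ^+ j : R.
  have c0 : 0 <= c by rewrite mulr_ge0// ltW.
  have h2 : \forall t \ae P, CE (fun u => (c * (X j u * `|y u|))%:E) t =
      (c%:E * CE (fun u => (X j u * `|y u|)%:E) t)%E.
    apply: (ge0_CEr_pull P sF FE _ _ (@measurable_cst _ _ TF _ setT c) (fun _ => c0)).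
      exact: measurable_funM.
    by move=> t; rewrite mulr_ge0.
  have h3 : \forall t \ae P, (CE (fun u => (c * (X j u * `|y u|))%:E) t <=
      CE (fun u => (x u * `|y u|)%:E) t)%E.
    apply: CE_le => //.
    - by apply/measurable_EFinP/measurable_funM => //; exact: measurable_funM.
    - exact: mxy.
    - by move=> t; rewrite lee_fin (mulr_ge0 c0)// mulr_ge0.
    - by move=> t; rewrite lee_fin mulr_ge0.
    - apply: filterS Wfin => t Wt; rewrite lee_fin mulrA ler_wpM2r//.
      by rewrite /c -mulrA; exact: x'x.
  apply: filterS3 h1 h2 h3 => t h1 h2 h3 Dt; apply: le_trans h3; rewrite h2.
  apply: (@le_trans _ _ (c%:E * (4 ^+ j)%:E)%E); last by rewrite lee_wpmul2l ?lee_fin ?h1.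
  rewrite -EFinM lee_fin /c (_ : 4 = 2 * 2) ?exprMn -?natrM//.
  by rewrite exprVn -mulrA mulKf// expf_neq0.
have := hfin _ ox x0.
apply: filterS2 hX => t hX xy; apply: contrapT => /forallNP nf.
have inf n : CE (fun u => psi `|(n.+1%:R^-1 * y u)|%R) t = +oo%E.
  by apply/eqP; rewrite -leye_eq leNgt; apply/negP/nf.
have xyf : CE (fun u => (x u * `|y u|)%:E) t \is a fin_num.
  rewrite ge0_fin_numE//; apply: CE_ge0 => //; first exact: mxy.
  by move=> u; rewrite lee_fin mulr_ge0.
(* With this [N], 2^N >= N exceeds twice the finite expectation, against the lower bound 2^N/2. To
   be compared with the multipliers 1/(n+1), 4^N is then written as a successor. *)
pose N := Num.bound (2 * fine (CE (fun u => (x u * `|y u|)%:E) t)).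
have h4 : (4 ^+ N : R) = (4 ^ N).-1.+1%:R.
  by rewrite prednK ?expn_gt0// natrX.
have := hX N; rewrite h4 => /(_ (inf _)).
rewrite -(fineK xyf) lee_fin.
have xy0 : 0 <= 2 * fine (CE (fun u => (x u * `|y u|)%:E) t).
  rewrite mulr_ge0// fine_ge0//; apply: CE_ge0 => //; first exact: mxy.
  by move=> u; rewrite lee_fin mulr_ge0.
have := archi_boundP xy0; rewrite -/N.
have : N%:R <= (2 : R) ^+ N by rewrite -natrX ler_nat ltnW// ltn_expl.
move=> h1 h2; rewrite mulrC ler_pdivrMr// => h3.
by have := lt_le_trans (lt_le_trans h2 h1) h3; rewrite mulrC ltxx.
Qed.

(** The multiplier equals 1/(n+1) on the block where the index n works; it is [F]-measurable, and
    locality gives finiteness. *)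
Lemma koethe_dual :
  (forall x : T -> R, orl P F phi x -> (forall t, 0 <= x t) ->
    \forall t \ae P, (CE (fun u => (x u * `|y u|)%:E) t < +oo)%E) ->
  orl P F psi y.
Proof.
move=> hfin; split => //.
pose N n := CE (fun u => psi `|(n.+1%:R^-1 * y u)|%R).
have mpsi (c : T -> R) : measurable_fun setT c -> measurable_fun setT (fun u => psi `|c u * y u|%R).
  by move=> mc'; apply: (measurable_comp_nondecreasing nd_psi.2); exact: measurable_funM.
have psi0 (c : T -> R) t : (0 <= psi `|c t * y t|%R)%E by exact: nd_psi.1.
have mN n : measurable_fun setT (fun u => psi `|(n.+1%:R^-1 * y u)|%R).
  exact: (mpsi (cst n.+1%:R^-1)).
have N0 n t : (0 <= psi `|(n.+1%:R^-1 * y t)|%R)%E by exact: nd_psi.1.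
pose C n := [set t | (N n t < +oo)%E].
have FC n : F (C n).
  rewrite -(measurable_FE sF) -[X in measurable X]setTI.
  apply: (measurable_lte measurableT); last exact: measurable_cst.
  exact: (measurable_CE P sF FE (mN n) (N0 n)).
have [A pA AC] := first_partition sF FC (CE_infinite_ae hfin).
pose eta := paste A (fun n (_ : T) => n.+1%:R^-1 : R).
have meta : mF eta by apply: (measurable_wrt_paste sF pA) => k; exact: measurable_cst.
exists eta; split => //; first by move=> t; rewrite /eta /paste invr_gt0.
have loc : \forall t \ae P, forall k, A k t -> CE (fun u => psi `|eta u * y u|%R) t = N k t.
  apply: ae_foralln => k; have [FA _ _] := pA.
  apply: (CE_local P sF FE (mpsi _ (measurable_wrtW sF FE meta)) (mN k)
    (psi0 eta) (N0 k) (FA k)) => t Akt.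
  by rewrite /eta (pasteE _ pA Akt).
apply: filterS2 AC loc => t h1 h2; have At := block_mem t pA.
by rewrite (h2 _ At); exact: h1.
Qed.

End koethe_dual.

(** * Mixtures and the conditional pairing *)

Section mixtures.
Context (R : realType) (d : measure_display) (T : measurableType d).
Variables (P : probability T R) (F : set_system T).
Hypotheses (sF : sigma_algebra [set: T] F) (FE : F `<=` measurable).
Local Notation mF := (measurable_wrt F).
Local Notation TF := (g_sigma_algebraType F).
Implicit Types (A : nat -> set T) (x : nat -> L0 P) (z : L0 P).

Lemma indic_partition A j t : is_partition F A -> A j t ->
  forall k, \1_(A k) t = (k == j)%:R :> R.
Proof.
move=> pA Aj k; rewrite indicE; congr (nat_of_bool _)%:R; apply/idP/eqP => [/set_mem Ak|->].
  by rewrite -(block_uniq pA Ak) (block_uniq pA Aj).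
by rewrite mem_set.
Qed.

Lemma sum_indic_partition A j t (v : nat -> R) n : is_partition F A -> A j t ->
  (j < n)%N -> \sum_(0 <= k < n) \1_(A k) t * v k = v j.
Proof.
move=> pA Aj jn; rewrite (bigD1_seq j)/= ?mem_index_iota ?iota_uniq//.
rewrite (indic_partition pA Aj) eqxx mul1r big1 ?addr0// => k kj.
by rewrite (indic_partition pA Aj) (negbTE kj) mul0r.
Qed.

Lemma nneseries_indic_partition A j t (v : nat -> \bar R) : is_partition F A -> A j t ->
  (\sum_(k <oo) (\1_(A k) t)%:E * v k)%E = v j.
Proof.
move=> pA Aj; apply/cvg_lim => //; apply: cvg_near_cst; exists j.+1 => // n /= jn.
rewrite (bigD1_seq j)/= ?mem_index_iota ?iota_uniq//.
rewrite (indic_partition pA Aj) eqxx mul1e big1 ?adde0// => k kj.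
by rewrite (indic_partition pA Aj) (negbTE kj) mul0e.
Qed.

(** At a given point only the block containing it contributes, so the partial sums are eventually
    constant. *)
Lemma is_mixtureP A x z : is_partition F A ->
  is_mixture A x z <-> \forall t \ae P, forall k, A k t -> z t = x k t.
Proof.
move=> pA; split; apply: filterS => t h.
  move=> j Aj; apply: cvg_unique h _ => //.
  by apply: cvg_near_cst; exists j.+1 => // n /= jn; exact: (sum_indic_partition (x ^~ t) pA Aj jn).
have Aj := block_mem t pA; rewrite (h _ Aj).
apply: cvg_near_cst; exists (block A t).+1 => // n /= jn.
exact: (sum_indic_partition (x ^~ t) pA Aj jn).
Qed.

Lemma mixture_ex A x : is_partition F A ->
  exists z, \forall t \ae P, forall k, A k t -> z t = x k t.
Proof.
move=> pA; have mp := measurable_paste FE pA (fun k => measurable_L0 (x k)).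
exists (L0_of P mp); apply: filterS (L0_ofE P mp) => t -> k Ak.
by rewrite (pasteE _ pA Ak).
Qed.

Lemma mixture_setP A (U : nat -> set (L0 P)) z : is_partition F A ->
  mixture_set A U z <-> exists2 y : nat -> L0 P, forall k, U k (y k) &
    \forall t \ae P, forall k, A k t -> z t = y k t.
Proof.
by move=> pA; split => -[y Uy yz]; exists y => //; exact/(is_mixtureP _ _ pA).
Qed.

(** Refines block i of [A] by a partition that may depend on i. Numbers that are not codes of pairs
    give empty blocks, which keeps the family disjoint. *)
Definition pair_partition A (A' : nat -> nat -> set T) n :=
  if @choice.pickle_inv (nat * nat)%type n is Some (i, j) then A i `&` A' i j else set0.

Lemma pair_partition_pickle A (A' : nat -> nat -> set T) i j :
  pair_partition A A' (choice.pickle (i, j)) = A i `&` A' i j.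
Proof. by rewrite /pair_partition choice.pickleK_inv. Qed.

Lemma pair_partition_mem A (A' : nat -> nat -> set T) n t : pair_partition A A' n t ->
  exists i j, [/\ n = choice.pickle (i, j), A i t & A' i j t].
Proof.
rewrite /pair_partition; have := @choice.pickle_invK (nat * nat)%type n.
by case: choice.pickle_inv => [[i j]|//] /= ij [Ai A'j]; exists i, j.
Qed.

Lemma pair_partitionP A (A' : nat -> nat -> set T) : is_partition F A ->
  (forall i, is_partition F (A' i)) -> is_partition F (pair_partition A A').
Proof.
move=> pA pA'; have [FA tA cA] := pA.
split.
- move=> n; rewrite -(measurable_FE sF) /pair_partition.
  case: choice.pickle_inv => [[i j]|]; last exact: measurable0.
  by have [FA' _ _] := pA' i; apply: measurableI; rewrite measurable_FE.
- move=> m n _ _ [t [/pair_partition_mem[i [j [-> Ai A'j]]]]].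
  move=> /pair_partition_mem[i' [j' [-> Ai' A'j']]].
  move: A'j'; rewrite -(block_uniq pA Ai') (block_uniq pA Ai) => A'j'.
  by rewrite -(block_uniq (pA' i) A'j) (block_uniq (pA' i) A'j').
- apply/seteqP; split => // t _.
  exists (choice.pickle (block A t, block (A' (block A t)) t)) => //.
  by rewrite pair_partition_pickle; split; [exact: block_mem pA|exact: block_mem (pA' _)].
Qed.

Lemma trivial_partition : is_partition F (fun n => if n is 0%N then [set: T] else set0).
Proof.
split.
- move=> [|n]; rewrite -(measurable_FE sF); [exact: measurableT|exact: measurable0].
- by move=> [|m] [|n] _ _ [t []].
- by apply/seteqP; split => // t _; exists 0%N.
Qed.

End mixtures.

(** * The conditional pairing E[xy | F] *)

Section conditional_pairing.
Context (R : realType) (d : measure_display) (T : measurableType d).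
Variables (P : probability T R) (F : set_system T).
Hypotheses (sF : sigma_algebra [set: T] F) (FE : F `<=` measurable).
Local Notation mF := (measurable_wrt F).
Local Notation TF := (g_sigma_algebraType F).
Variable phi : R -> \bar R.
Hypothesis Yphi : is_young phi.
Local Notation psi := (young_conjugate phi).
Local Notation Lphi := (orl P F phi).
Local Notation Lpsi := (orl P F psi).
Implicit Types (x y z : T -> R).

Definition pairing x y := condR P F (fun u => x u * y u).

Let im x y : Lphi x -> Lpsi y -> cond_integrable P F (fun u => x u * y u).
Proof. exact: cond_integrable_mul. Qed.

(** [x] is first replaced by a version equal to [y] everywhere on [B], to which [condR_local]
    applies. *)
Lemma condR_local_ae x y B : cond_integrable P F x -> measurable_fun [set: T] y -> F B ->
  (\forall t \ae P, B t -> x t = y t) ->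
  \forall t \ae P, B t -> condR P F x t = condR P F y t.
Proof.
move=> ix my FB xy; have [mx _] := ix.
pose x' t := if t \in B then y t else x t.
have mx' : measurable_fun [set: T] x'.
  apply: measurable_fun_ifT => //; apply: (measurable_fun_bool true).
  rewrite setTI (_ : _ @^-1` _ = B); first exact: FE.
  by apply/seteqP; split => t /=; [exact: set_mem|exact: mem_set].
have xx' : \forall t \ae P, x t = x' t.
  by apply: filterS xy => t h; rewrite /x'; case: ifPn => // /set_mem /h.
have h1 := condR_ae_eq sF FE ix mx' xx'.
have h2 : \forall t \ae P, B t -> condR P F x' t = condR P F y t.
  by apply: condR_local => // t Bt; rewrite /x' mem_set.
by apply: filterS2 h1 h2 => t -> .
Qed.

Lemma measurable_pairing x y : measurable_fun [set: T] x -> measurable_fun [set: T] y ->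
  mF (pairing x y).
Proof. by move=> mx my; apply: measurable_condR => //; exact: measurable_funM. Qed.

Lemma pairing_local x y z B : Lphi x -> Lpsi y -> measurable_fun [set: T] z -> F B ->
  (\forall t \ae P, B t -> y t = z t) ->
  \forall t \ae P, B t -> pairing x y t = pairing x z t.
Proof.
move=> ox oy mz FB yz; apply: condR_local_ae => //; first exact: im.
  by apply: measurable_funM => //; exact: ox.1.
by apply: filterS yz => t h /h ->.
Qed.

Lemma pairing_mixture x A (Y : nat -> T -> R) z : Lphi x -> (forall k, Lpsi (Y k)) ->
  measurable_fun [set: T] z -> is_partition F A ->
  (\forall t \ae P, forall k, A k t -> z t = Y k t) ->
  \forall t \ae P, forall k, A k t -> pairing x z t = pairing x (Y k) t.
Proof.
move=> ox oY mz pA zY; apply: ae_foralln => k; have [FA _ _] := pA.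
have : \forall t \ae P, A k t -> pairing x (Y k) t = pairing x z t.
  by apply: pairing_local => //; apply: filterS zY => t h /h ->.
by apply: filterS => t h /h.
Qed.

Lemma pairing_ae_eq x y z : Lphi x -> Lpsi y -> measurable_fun [set: T] z ->
  (\forall t \ae P, y t = z t) -> \forall t \ae P, pairing x y t = pairing x z t.
Proof.
move=> ox oy mz yz; apply: condR_ae_eq => //; first exact: im.
  by apply: measurable_funM => //; exact: ox.1.
by apply: filterS yz => t ->.
Qed.

Lemma pairingBr x y z : Lphi x -> Lpsi y -> Lpsi z ->
  \forall t \ae P, pairing x (fun u => y u - z u) t = pairing x y t - pairing x z t.
Proof.
move=> ox oy oz; have := condRB sF FE (im ox oy) (im ox oz).
rewrite /pairing (_ : (fun u => x u * (y u - z u)) = (fun u => x u * y u - x u * z u))//.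
by apply/funext => u; rewrite mulrBr.
Qed.

Lemma pairingDl x y z : Lphi x -> Lphi y -> Lpsi z ->
  \forall t \ae P, pairing (fun u => x u + y u) z t = pairing x z t + pairing y z t.
Proof.
move=> ox oy oz; have := condRD sF FE (im ox oz) (im oy oz).
rewrite /pairing (_ : (fun u => (x u + y u) * z u) = (fun u => x u * z u + y u * z u))//.
by apply/funext => u; rewrite mulrDl.
Qed.

Lemma pairingZl (a : R) x z : Lphi x -> Lpsi z ->
  \forall t \ae P, pairing (fun u => a * x u) z t = a * pairing x z t.
Proof.
move=> ox oz; have := condRZ sF FE a (im ox oz).
rewrite /pairing (_ : (fun u => a * x u * z u) = (fun u => a * (x u * z u)))//.
by apply/funext => u; rewrite mulrA.
Qed.

Lemma pairing_locall x y z B : Lphi x -> Lpsi z -> measurable_fun [set: T] y -> F B ->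
  (\forall t \ae P, B t -> x t = y t) ->
  \forall t \ae P, B t -> pairing x z t = pairing y z t.
Proof.
move=> ox oz my FB xy; apply: condR_local_ae => //; first exact: im.
  by apply: measurable_funM => //; exact: oz.1.
by apply: filterS xy => t h /h ->.
Qed.

End conditional_pairing.

(** * The stable weak topology *)

Section stable_neighbourhoods.
Context (R : realType) (d : measure_display) (T : measurableType d).
Variables (P : probability T R) (F : set_system T).
Hypotheses (sF : sigma_algebra [set: T] F) (FE : F `<=` measurable).
Local Notation mF := (measurable_wrt F).
Local Notation TF := (g_sigma_algebraType F).
Variable phi : R -> \bar R.
Hypothesis Yphi : is_young phi.
Local Notation psi := (young_conjugate phi).
Local Notation Lphi := (@orlicz R d T P F phi).
Local Notation Lpsi := (@orlicz R d T P F psi).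
Local Notation pairing := (pairing P F).
Local Notation W := (w_space P F phi).
Implicit Types (x y z u : L0 P) (G : nat -> set (L0 P)) (A : nat -> set T).

Lemma orl_phi x : Lphi x -> orl P F phi x.
Proof. by move=> /(orliczP sF FE (is_young_nd Yphi)). Qed.

Lemma orl_psi y : Lpsi y -> orl P F psi y.
Proof. by move=> /(orliczP sF FE (young_conjugate_nd Yphi)). Qed.

Lemma ae_in_finite (I : choiceType) (D : set I) (Q : I -> T -> Prop) : finite_set D ->
  (forall i, D i -> \forall t \ae P, Q i t) -> \forall t \ae P, forall i, D i -> Q i t.
Proof.
move=> /finite_seqP[s ->]; elim: s => [|i s ih] h; first exact: aeW.
have h1 := h i (mem_head _ _).
have h2 : \forall t \ae P, forall j, [set` s] j -> Q j t.
  by apply: ih => j js; apply: h; rewrite /= inE; apply/orP; right.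
apply: filterS2 h1 h2 => t q1 q2 j /=; rewrite inE => /orP[/eqP -> //|].
exact: q2.
Qed.

Definition ball_data G A (eps : L0 P) :=
  [/\ forall k, [/\ finite_set (G k), G k !=set0 & G k `<=` Lphi],
      is_partition F A & L0Fpp F eps].

(** [v x] is a pairing with [x] or a difference of two such pairings; only finitely many [x] are
    constrained on each block. *)
Definition close G A (eps : L0 P) (v : L0 P -> T -> R) :=
  \forall t \ae P, forall k, A k t -> forall x, G k x -> `|v x t| < eps t.

(** At a point the series reduces to the block containing it. The essential supremum of a finite
    family is a.s. at most its pointwise maximum, so the strict bound holds for it exactly when it
    holds for every member. *)
Lemma w_ballP G A eps u : ball_data G A eps ->
  w_ball F phi G A eps u <-> Lpsi u /\ close G A eps (fun x => pairing x u).
Proof.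
move=> [GP pA [_ eps0]].
suff h : Lpsi u -> \forall t \ae P, forall k,
    (ess_sup_family P [set (fun w => `|cond_exp P F (fun v => (x v * u v)%:E) w|%E) | x in G k] t
      < (eps t)%:E)%E <-> forall x, G k x -> `|pairing x u t| < eps t.
  split=> -[Lu hu]; split => //; apply: filterS2 (h Lu) hu => t {}h hu.
    move=> k Ak; apply/h; move: hu.
    by rewrite (nneseries_indic_partition _ pA Ak).
  have Ak := block_mem t pA; rewrite (nneseries_indic_partition _ pA Ak).
  by apply/h; exact: hu.
move=> Lu; apply: ae_foralln => k; have [finG G0 GL] := GP k.
set H := [set _ | x in _].
have ceE x : G k x -> \forall t \ae P,
    `|cond_exp P F (fun v => (x v * u v)%:E) t|%E = `|pairing x u t|%:E.
  move=> Gx; have ix := cond_integrable_mul sF FE Yphi (orl_phi (GL _ Gx)) (orl_psi Lu).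
  by apply: filterS (cond_exp_condR sF FE ix) => t ->.
have mH g : H g -> exists2 f, mF f & \forall t \ae P, g t = f t.
  move=> [x Gx <-]; exists (fun t => `|pairing x u t|%:E); last exact: ceE.
  apply/measurable_EFinP; apply: measurableT_comp => //.
  by apply: measurable_pairing => //; exact: measurable_L0.
have H0 : H !=set0 by have [x Gx] := G0; exists (fun w => `|cond_exp P F (fun v => (x v * u v)%:E) w|%E); exists x.
have [_ [Z [_ _ _ eZ]]] := ess_sup_attained sF FE mH H0.
have [mE ub lub] : is_ess_sup P H (ess_sup_family P H).
  exact: (xgetPex (cst -oo%E) (ex_intro _ Z eZ)).
have ub' : \forall t \ae P, forall x, G k x -> (`|pairing x u t|%:E <= ess_sup_family P H t)%E.
  apply: ae_in_finite => // x Gx.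
  by apply: filterS2 (ceE _ Gx) (ub _ (ex_intro2 _ _ x Gx erefl)) => t <-.
have [s Gs] : exists s : seq (L0 P), G k = [set` s] by apply/finite_seqP.
pose Z' t := \big[maxe/-oo%E]_(x <- s) `|pairing x u t|%:E.
have mZ' : measurable_fun [set: T] Z'.
  rewrite /Z' {Z'}; elim: s {Gs} => [|x s ih].
    by under eq_fun do rewrite big_nil; exact: measurable_cst.
  under eq_fun do rewrite big_cons; apply: measurable_maxe => //.
  apply/measurable_EFin_abs; apply: (measurable_wrtW sF FE).
  by apply: measurable_pairing => //; exact: measurable_L0.
have leZ' : \forall t \ae P, (ess_sup_family P H t <= Z' t)%E.
  apply: lub => // _ [x Gx <-]; apply: filterS (ceE _ Gx) => t ->.
  by apply: le_bigmax_seq => //; rewrite Gs in Gx.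
apply: filterS2 ub' leZ' => t ub' leZ'; split => [lt x Gx|hx].
  by rewrite -lte_fin; apply: le_lt_trans lt; exact: ub'.
apply: le_lt_trans leZ' _; rewrite /Z' big_seq; elim/big_ind: _ => //.
- by rewrite ltNyr.
- by move=> a b ha hb; rewrite gt_max ha.
- by move=> x xs; rewrite lte_fin; apply: hx; rewrite Gs.
Qed.

Definition near_set y G A (eps : L0 P) := [set z | Lpsi z /\
  close G A eps (fun x t => pairing x z t - pairing x y t)].

Lemma w_space_psi (y : W) : Lpsi (val y).
Proof. by have := valP y; rewrite inE. Qed.

(** Linearity of the pairing in its second argument, with u = z - y. *)
Lemma near_setP (y : W) G A eps (z : W) : ball_data G A eps ->
  near_set (val y) G A eps (val z) <->
  (val @^-1` translate (val y) (w_ball F phi G A eps) : set W) z.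
Proof.
move=> bd; have Ly := w_space_psi y; have Lz := w_space_psi z.
have [GP pA _] := bd.
have oy := orl_psi Ly; have oz := orl_psi Lz.
have ozy := orlB sF FE (young_conjugate_nd Yphi) oz oy.
split=> [[_ zy]|[u ub zyu]].
  have EU := L0_ofE P (ozy.1); set u := L0_of _ _ in EU.
  have Lu : Lpsi u.
    apply/(orliczP sF FE (young_conjugate_nd Yphi)).
    exact: (orl_ae_eq sF FE (young_conjugate_nd Yphi) (measurable_L0 u) EU ozy).
  exists u; last by apply: filterS EU => t ->; rewrite subrKC.
  apply/w_ballP => //; split => //.
  have pu : \forall t \ae P, forall k x, G k x -> pairing x u t = pairing x (val z) t - pairing x (val y) t.
    apply: ae_foralln => k; have [finG _ GL] := GP k.
    apply: ae_in_finite => // x Gx.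
    have h1 := pairingBr sF FE Yphi (orl_phi (GL _ Gx)) oz oy.
    have EU' : \forall t \ae P, val z t - val y t = u t by apply: filterS EU => t ->.
    have h2 := pairing_ae_eq sF FE Yphi (orl_phi (GL _ Gx)) ozy (measurable_L0 u) EU'.
    by apply: filterS2 h1 h2 => t -> ->.
  by apply: filterS2 pu zy => t pu zy k Ak x Gx; rewrite (pu k)//; exact: (zy k).
split => //; move/w_ballP: ub => /(_ bd)[Lu cu].
have pu : \forall t \ae P, forall k x, G k x -> pairing x u t = pairing x (val z) t - pairing x (val y) t.
  apply: ae_foralln => k; have [finG _ GL] := GP k.
  apply: ae_in_finite => // x Gx.
  have h1 := pairingBr sF FE Yphi (orl_phi (GL _ Gx)) oz oy.
  have EU' : \forall t \ae P, val z t - val y t = u t.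
    by apply: filterS zyu => t ->; rewrite addrC addKr.
  have h2 := pairing_ae_eq sF FE Yphi (orl_phi (GL _ Gx)) ozy (measurable_L0 u) EU'.
  by apply: filterS2 h1 h2 => t <- <-.
by apply: filterS2 pu cu => t pu cu k Ak x Gx; rewrite -(pu k)//; exact: (cu k).
Qed.

Lemma nbhs_near_set (y : W) G A eps : ball_data G A eps ->
  nbhs y (val @^-1` near_set (val y) G A eps : set W).
Proof.
move=> bd; have [GP pA [eF eps0]] := bd.
rewrite nbhsE; exists (val @^-1` translate (val y) (w_ball F phi G A eps) : set W).
  split.
    set B := _ @^-1` _.
    have BB : w_base B by exists y, G, A, eps; split.
    exists [set B]; last by rewrite bigcup_set1.
    by move=> _ ->; exact: finI_from1.
  apply/near_setP => //; split; first exact: w_space_psi.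
  by apply: filterS eps0 => t e0 k Ak x Gx; rewrite subrr normr0.
by move=> z /near_setP; exact.
Qed.

Lemma L0Fpp_ex (f : T -> R) : mF f -> (\forall t \ae P, 0 < f t) ->
  exists2 eps : L0 P, L0Fpp F eps & \forall t \ae P, eps t = f t.
Proof.
move=> mf f0; have Ef := L0_ofE P (measurable_wrtW sF FE mf).
exists (L0_of P (measurable_wrtW sF FE mf)) => //.
by split; [exists f|apply: filterS2 Ef f0 => t ->].
Qed.

(** A basic set is a neighbourhood of each of its points: the new radius is, on block k, [eps] minus
    the largest distance between the pairings of [y] and [y0] with members of [G k]. Finiteness of
    [G k] keeps it positive and [F]-measurable. *)
Lemma near_set_single (y : W) (y0 : W) G A eps : ball_data G A eps ->
  (val @^-1` translate (val y0) (w_ball F phi G A eps) : set W) y ->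
  exists2 eps', ball_data G A eps' & forall z : W, near_set (val y) G A eps' (val z) ->
   (val @^-1` translate (val y0) (w_ball F phi G A eps) : set W) z.
Proof.
move=> bd /near_setP => /(_ bd) [_ yy0]; have [GP pA [[f mf ef] eps0]] := bd.
have /choice[s Gs] : forall k, exists s : seq (L0 P), G k = [set` s].
  by move=> k; apply/finite_seqP; have [] := GP k.
pose v (x : L0 P) t := `|pairing x (val y) t - pairing x (val y0) t|.
have mv x : mF (v x).
  apply: measurableT_comp => //; apply: (@measurable_funB _ TF);
  by apply: measurable_pairing => //; exact: measurable_L0.
pose M k t := \big[Num.max/0]_(x <- s k) v x t.
have mM k : mF (M k).
  rewrite /M; elim: (s k) => [|x r ih].
    by under eq_fun do rewrite big_nil; exact: measurable_cst.
  under eq_fun do rewrite big_cons.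
  by apply: (@measurable_maxr _ TF); [exact: mv|exact: ih].
have vM k x t : G k x -> v x t <= M k t.
  by rewrite Gs /= => xs; exact: (@le_bigmax_seq _ _ _ _ 0 x xpredT (fun x => v x t) xs).
pose g := paste A (fun k t => f t - M k t).
have mg : mF g by apply: (measurable_wrt_paste sF pA) => k;
  apply: (@measurable_funB _ TF); [exact: mf|exact: mM].
have g0 : \forall t \ae P, 0 < g t.
  apply: filterS3 ef eps0 yy0 => t ef eps0 h; have At := block_mem t pA.
  rewrite /g /paste -ef subr_gt0 /M big_seq; elim/big_ind: _ => //.
    by move=> a b ha hb; rewrite gt_max ha.
  by move=> x xs; apply: (h _ At); rewrite Gs.
have [eps' eF' Eg] := L0Fpp_ex mg g0.
exists eps'; first by split.
move=> z [Lz zy]; apply: (near_setP y0 z bd).1; split; first exact: Lz.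
apply: filterS3 zy Eg ef => t zy Eg ef k Ak x Gx.
have := zy k Ak x Gx; rewrite Eg /g (pasteE _ pA Ak) ef => h.
have := vM k x t Gx; rewrite /v => h'.
rewrite -(subrKA (pairing x (val y) t)).
apply: le_lt_trans (ler_normD _ _) _.
by move: h h'; move: `|_| `|_| (f t) (M k t) => *; lra.
Qed.

(** On the common refinement of the two partitions, take unions of the finite sets and the minimum
    of the radii. Where the index is no code the block is empty and [G] is arbitrary. *)
Lemma near_set_refine G1 A1 e1 G2 A2 e2 : ball_data G1 A1 e1 -> ball_data G2 A2 e2 ->
  exists G A e, ball_data G A e /\ forall y z, near_set y G A e z ->
    near_set y G1 A1 e1 z /\ near_set y G2 A2 e2 z.
Proof.
move=> [GP1 pA1 [[f1 mf1 ef1] e10]] [GP2 pA2 [[f2 mf2 ef2] e20]].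
pose G n := if @choice.pickle_inv (nat * nat)%type n is Some (i, j) then G1 i `|` G2 j else G1 0%N.
have [||e eF Ee] := @L0Fpp_ex (fun t => Num.min (f1 t) (f2 t)).
- exact: (@measurable_minr _ TF).
- by near=> t; rewrite lt_min; apply/andP; split; near: t;
    [apply: filterS2 ef1 e10 => t <-|apply: filterS2 ef2 e20 => t <-].
exists G, (pair_partition A1 (fun=> A2)), e; split.
  split => //; last exact: pair_partitionP.
  move=> n; rewrite /G; case: choice.pickle_inv => [[i j]|//].
  have [f_1 [x G1x] s1] := GP1 i; have [f_2 _ s2] := GP2 j; split.
  - by rewrite finite_setU.
  - by exists x; left.
  - by rewrite subUset.
have {}Ee : \forall t \ae P, e t = Num.min (e1 t) (e2 t).
  by apply: filterS3 Ee ef1 ef2 => t -> -> ->.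
move=> y z [Lz h]; split; split => //.
- apply: filterS2 h Ee => t h Ee i Ai x Gx; have A2t := block_mem t pA2.
  have := h (choice.pickle (i, block A2 t)); rewrite pair_partition_pickle => /(_ (conj Ai A2t) x).
  rewrite /G choice.pickleK_inv => /(_ (or_introl Gx)).
  by rewrite Ee lt_min => /andP[].
- apply: filterS2 h Ee => t h Ee i Ai x Gx; have A1t := block_mem t pA1.
  have := h (choice.pickle (block A1 t, i)); rewrite pair_partition_pickle => /(_ (conj A1t Ai) x).
  rewrite /G choice.pickleK_inv => /(_ (or_intror Gx)).
  by rewrite Ee lt_min => /andP[].
Unshelve. all: by end_near.
Qed.

Lemma ball_data_ex : exists G A e, ball_data G A e.
Proof.
have m1 : measurable_fun [set: T] (cst 0 : T -> R) by exact: measurable_cst.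
have E0 := L0_ofE P m1; set x := L0_of _ _ in E0.
have [||e eF _] := @L0Fpp_ex (cst 1); [exact: measurable_cst|exact: aeW|].
exists (fun=> [set x]), (fun n => if n is 0%N then [set: T] else set0), e; split => //.
  move=> _; split; [exact: finite_set1|by exists x|move=> _ ->].
  apply/(orliczP sF FE (is_young_nd Yphi)).
  apply: (orl_ae_eq sF FE (is_young_nd Yphi) (measurable_L0 x) E0).
  by apply: (bounded_orl P sF FE (M := 0) Yphi m1) => t; rewrite normr0.
exact: trivial_partition.
Qed.

(** An open set is a union of finite intersections of members of [w_base]; induction on the finite
    intersection recentres each member at [y] and merges the constraints, so that one [near_set]
    suffices. *)
Lemma nbhs_near_set_inv (y : W) (B : set W) : nbhs y B -> exists G A eps,
  ball_data G A eps /\ forall z : W, near_set (val y) G A eps (val z) -> B z.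
Proof.
rewrite nbhsE => -[U [oU Uy] UB].
have [D' sD' UE] := oU.
have : (\bigcup_(i in D') i) y by rewrite UE.
move=> [V D'V Vy]; have [D sD VE] := sD' _ D'V.
suff [G [A [eps [bd h]]]] : exists G A eps,
    ball_data G A eps /\ forall z : W, near_set (val y) G A eps (val z) -> V z.
  by exists G, A, eps; split => // z /h Vz; apply: UB; rewrite -UE; exists V.
have {sD} sD C : C \in finmap.enum_fset D -> w_base C by move=> /sD /set_mem.
have yC C : C \in finmap.enum_fset D -> C y by move=> CD; move: Vy; rewrite -VE; exact.
suff [G [A [eps [bd h]]]] : exists G A eps, ball_data G A eps /\
    forall z : W, near_set (val y) G A eps (val z) -> forall C, C \in finmap.enum_fset D -> C z.
  by exists G, A, eps; split => // z /h zC; rewrite -VE => C CD; exact: zC.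
elim: (finmap.enum_fset D) sD yC => [|C s ih] sD yC.
  by have [G [A [e bd]]] := ball_data_ex; exists G, A, e; split.
have [||G1 [A1 [e1 [bd1 h1]]]] := ih.
- by move=> C' C's; apply: sD; rewrite inE C's orbT.
- by move=> C' C's; apply: yC; rewrite inE C's orbT.
have [y0 [G0 [A0 [e0 [GP0 pA0 eF0 CE]]]]] := sD C (mem_head _ _).
have Cy := yC C (mem_head _ _); rewrite CE in Cy.
have [e2 bd2 h2] := near_set_single (And3 GP0 pA0 eF0) Cy.
have [G [A [e [bd h]]]] := near_set_refine bd1 bd2.
exists G, A, e; split => // z /h[n1 n2] C'; rewrite inE => /orP[/eqP ->|]; last exact: h1.
by rewrite CE; exact: h2.
Qed.

End stable_neighbourhoods.

(** * Maximal stable filter bases *)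

Section maximal_stable_filter.
Context (R : realType) (d : measure_display) (T : measurableType d).
Variables (P : probability T R) (F : set_system T).
Hypotheses (sF : sigma_algebra [set: T] F) (FE : F `<=` measurable).
Implicit Types (A : nat -> set T) (U V K : set (L0 P)) (z : L0 P) (H B : set (set (L0 P))).

Lemma stable_mixture_ex A U (y : nat -> L0 P) : is_partition F A -> is_stable F U ->
  (forall k, U (y k)) -> exists2 z, U z & \forall t \ae P, forall k, A k t -> z t = y k t.
Proof.
move=> pA [_ sU] Uy; have [z zy] := mixture_ex FE y pA; exists z => //.
by apply: (sU _ pA); apply/(mixture_setP _ _ pA); exists y.
Qed.

Lemma mixture_set_nonempty A (U : nat -> set (L0 P)) : is_partition F A ->
  (forall k, U k !=set0) -> mixture_set A U !=set0.
Proof.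
move=> pA /choice[y Uy]; have [z zy] := mixture_ex FE y pA.
by exists z; apply/(mixture_setP _ _ pA); exists y.
Qed.

Lemma mixture_set_sub A (U : nat -> set (L0 P)) K : is_partition F A -> is_stable F K ->
  (forall k, U k `<=` K) -> mixture_set A U `<=` K.
Proof.
move=> pA [_ sK] UK z /(mixture_setP _ _ pA)[y Uy zy]; apply: (sK _ pA).
by apply/(mixture_setP _ _ pA); exists y => // k; exact: UK.
Qed.

(** The two partitions are interchanged: for each k the ingredients lying in [U k] are first mixed
    along [B] inside this stable set, and the results are then mixed along [A]. *)
Lemma stable_mixture_set A (U : nat -> set (L0 P)) : is_partition F A ->
  (forall k, is_stable F (U k)) -> is_stable F (mixture_set A U).
Proof.
move=> pA sU; split; first by apply: mixture_set_nonempty => // k; have [] := sU k.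
move=> B pB z /(mixture_setP _ _ pB)[y Uy zy].
have /choice[u uP] : forall n, exists u : nat -> L0 P, (forall k, U k (u k)) /\
    \forall t \ae P, forall k, A k t -> y n t = u k t.
  by move=> n; have /(mixture_setP _ _ pA)[u] := Uy n; exists u.
have /choice[w wP] : forall k, exists w, U k w /\ \forall t \ae P, forall n, B n t -> w t = u n k t.
  move=> k; have [w Uw wu] := @stable_mixture_ex B (U k) (fun n => u n k) pB (sU k) (fun n => (uP n).1 k).
  by exists w.
apply/(mixture_setP _ _ pA); exists w; first by move=> k; exact: (wP k).1.
have h1 := ae_foralln (fun n => (uP n).2); have h2 := ae_foralln (fun k => (wP k).2).
apply: filterS3 zy h1 h2 => t zy h1 h2 k Ak; have Bt := block_mem t pB.
by rewrite (zy _ Bt) (h1 _ _ Ak) (h2 k _ Bt).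
Qed.

Lemma stableI U V : is_stable F U -> is_stable F V -> U `&` V !=set0 -> is_stable F (U `&` V).
Proof.
move=> [_ sU] [_ sV] UV; split => // A pA z [y UVy yz]; split.
  by apply: (sU _ pA); exists y => // k; have [] := UVy k.
by apply: (sV _ pA); exists y => // k; have [] := UVy k.
Qed.

Variable K : set (L0 P).
Hypothesis sK : is_stable F K.

(** The stable filter base generated by [H] inside [K]. Mixtures are built in because a union of a
    chain of stable filter bases is not obviously closed under countable mixtures of members from
    different terms of the chain. *)
Definition generated_filter H := [set V | [/\ is_stable F V, V `<=` K &
  exists A (U : nat -> set (L0 P)), [/\ is_partition F A, forall k, H (U k) & mixture_set A U `<=` V]]].

Section generated.
Variable H : set (set (L0 P)).
Hypotheses (H0 : H !=set0) (sH : forall U, H U -> is_stable F U)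
  (HK : forall U, H U -> U `<=` K)
  (HI : forall U V, H U -> H V -> exists2 W, H W & W `<=` U `&` V).

Lemma sub_generated_filter U : H U -> generated_filter H U.
Proof.
move=> HU; split; [exact: sH|exact: HK|].
exists (fun n => if n is 0%N then [set: T] else set0), (fun=> U); split => //.
  exact: trivial_partition.
exact: (mixture_set_sub (trivial_partition sF) (sH HU) (fun k => @subset_refl _ U)).
Qed.

(** For an intersection, each pair of blocks of the two partitions receives a member of [H]
    contained in both sets. For condition (iii), a mixture of mixtures is a mixture along the
    refined partition. *)
Lemma generated_filter_base : is_stable_filter_base F (generated_filter H).
Proof.
split.
- by have [U HU] := H0; exists U; exact: sub_generated_filter.
- by move=> U [[]].
- move=> V1 V2 [sV1 _ [A [U [pA HU UV]]]] [sV2 _ [A' [U' [pA' HU' UV']]]].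
  have /choice[W WP] : forall n : nat * nat, exists W, H W /\ W `<=` U n.1 `&` U' n.2.
    by move=> n; have [W HW WU] := HI (HU n.1) (HU' n.2); exists W.
  pose A'' := pair_partition A (fun=> A').
  have pA'' : is_partition F A'' by apply: (pair_partitionP sF).
  pose W' n := if @choice.pickle_inv (nat * nat)%type n is Some p then W p else W (0, 0)%N.
  have HW' n : H (W' n) by rewrite /W'; case: choice.pickle_inv => [p|]; exact: (WP _).1.
  have W'E i j : W' (choice.pickle (i, j)) = W (i, j) by rewrite /W' choice.pickleK_inv.
  exists (mixture_set A'' W').
    split; first by apply: stable_mixture_set => // k; exact: sH.
      by apply: mixture_set_sub => // k; exact: HK.
    by exists A'', W'; split.
  move=> z /(mixture_setP _ _ pA'')[w Ww zw].
  have {}Ww i j : W (i, j) (w (choice.pickle (i, j))) by rewrite -W'E.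
  split.
  (* For fixed i the pieces indexed by j all lie in the stable set [U i], so they can be glued along
     [A'] without leaving it. *)
  + apply: UV; apply/(mixture_setP _ _ pA).
    have /choice[y yP] : forall i, exists y, U i y /\
        \forall t \ae P, forall j, A' j t -> y t = w (choice.pickle (i, j)) t.
      move=> i; have [//|y Uy yw] := @stable_mixture_ex A' (U i) (fun j => w (choice.pickle (i, j))) pA' (sH (HU i)).
        by move=> j; have [] := (WP (i, j)).2 _ (Ww i j).
      by exists y.
    exists y; first by move=> k; exact: (yP k).1.
    apply: filterS2 zw (ae_foralln (fun k => (yP k).2)) => t zw yw i Ai.
    have A't := block_mem t pA'; rewrite (yw i _ A't); apply: zw.
    by rewrite /A'' pair_partition_pickle.
  + apply: UV'; apply/(mixture_setP _ _ pA').
    have /choice[y yP] : forall j, exists y, U' j y /\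
        \forall t \ae P, forall i, A i t -> y t = w (choice.pickle (i, j)) t.
      move=> j; have [//|y Uy yw] := @stable_mixture_ex A (U' j) (fun i => w (choice.pickle (i, j))) pA (sH (HU' j)).
        by move=> i; have [] := (WP (i, j)).2 _ (Ww i j).
      by exists y.
    exists y; first by move=> k; exact: (yP k).1.
    apply: filterS2 zw (ae_foralln (fun k => (yP k).2)) => t zw yw j A'j.
    have At := block_mem t pA; rewrite (yw j _ At); apply: zw.
    by rewrite /A'' pair_partition_pickle.
- by move=> U [].
- move=> A V pA GV; split.
    by apply: stable_mixture_set => // k; have [] := GV k.
    by apply: mixture_set_sub => // k; have [] := GV k.
  have /choice[A' /choice[U AU]] : forall k, exists A (U : nat -> set (L0 P)), [/\ is_partition F A, forall k, H (U k) & mixture_set A U `<=` V k].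
    by move=> k; have [] := GV k.
  have pA' k : is_partition F (A' k) by have [] := AU k.
  pose A'' := pair_partition A A'.
  have pA'' : is_partition F A'' by apply: (pair_partitionP sF).
  pose U' n := if @choice.pickle_inv (nat * nat)%type n is Some (i, j) then U i j else U 0%N 0%N.
  have HU k j : H (U k j) by have [] := AU k.
  exists A'', U'; split => //; first by move=> n; rewrite /U'; case: choice.pickle_inv => [[i j]|].
  move=> z /(mixture_setP _ _ pA'')[w Uw zw].
  have {}Uw i j : U i j (w (choice.pickle (i, j))).
    by have := Uw (choice.pickle (i, j)); rewrite /U' choice.pickleK_inv.
  have /choice[y yP] : forall i, exists y, V i y /\
      \forall t \ae P, forall j, A' i j t -> y t = w (choice.pickle (i, j)) t.
    move=> i; have [y yw] := mixture_ex FE (fun j => w (choice.pickle (i, j))) (pA' i).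
    exists y; split => //; have [_ _] := AU i; apply; apply/(mixture_setP _ _ (pA' i)).
    by exists (fun j => w (choice.pickle (i, j))).
  apply/(mixture_setP _ _ pA); exists y; first by move=> k; exact: (yP k).1.
  apply: filterS2 zw (ae_foralln (fun k => (yP k).2)) => t zw yw i Ai.
  have A't := block_mem t (pA' i); rewrite (yw i _ A't); apply: zw.
  by rewrite /A'' pair_partition_pickle.
Qed.

End generated.

Definition finer B B' := forall U, B U -> exists2 V, B' V & V `<=` U.

(** Zorn's lemma for the preorder [finer]; a chain is bounded by the filter base generated by its
    union. If [C] meets every member of [M], the sets U [&] C generate a base finer than [M], hence
    by maximality equivalent to it, and some member of [M] lies in [C]. *)
Lemma maximal_stable_filter B : is_stable_filter_base F B -> (forall U, B U -> U `<=` K) ->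
  exists M, [/\ is_stable_filter_base F M, forall U, M U -> U `<=` K, finer B M &
    forall C, is_stable F C -> C `<=` K -> (forall U, M U -> U `&` C !=set0) ->
      exists2 V, M V & V `<=` C].
Proof.
move=> fB BK.
pose ok (M : set (set (L0 P))) := [/\ is_stable_filter_base F M, forall U, M U -> U `<=` K & finer B M].
pose FB := {M : set (set (L0 P)) | ok M}.
have finer_refl M : finer M M by move=> U MU; exists U.
have finer_trans M1 M2 M3 : finer M1 M2 -> finer M2 M3 -> finer M1 M3.
  by move=> h12 h23 U /h12[V /h23[W M3W WV] VU]; exists W => //; exact: subset_trans VU.
have okB : ok B by split.
pose rl (M M' : FB) := `[< finer (sval M) (sval M') >].
have [|||[M [fM MK BM]] Mmax] := @ZL_preorder FB (exist _ B okB) rl.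
- by move=> M; apply/asboolP.
- by move=> M1 M2 M3 /asboolP h1 /asboolP h2; apply/asboolP; exact: finer_trans h2.
- move=> chain tot; have [[M0 cM0]|nc] := pselect (chain !=set0); last first.
    by exists (exist _ B okB) => M cM; exfalso; apply: nc; exists M.
  pose H := \bigcup_(M in chain) (sval M).
  have H0 : H !=set0.
    by have [[[U MU] _ _ _ _] _ _] := svalP M0; exists U; exists M0.
  have sH U : H U -> is_stable F U.
    by move=> [M cM MU]; have [[_ _ _ + _] _ _] := svalP M; apply.
  have HK U : H U -> U `<=` K by move=> [M cM MU]; have [_ + _] := svalP M; apply.
  have HI U V : H U -> H V -> exists2 W, H W & W `<=` U `&` V.
    move=> [M1 cM1 M1U] [M2 cM2 M2V].
    have [/asboolP h|/asboolP h] := tot _ _ cM1 cM2.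
      have [U' M2U' U'U] := h _ M1U.
      have [[_ _ + _ _] _ _] := svalP M2; move=> /(_ _ _ M2U' M2V)[W M2W WU'].
      by exists W; [exists M2|move=> z /WU'[/U'U]].
    have [V' M1V' V'V] := h _ M2V.
    have [[_ _ + _ _] _ _] := svalP M1; move=> /(_ _ _ M1U M1V')[W M1W WU'].
    by exists W; [exists M1|move=> z /WU'[? /V'V]].
  have okG : ok (generated_filter H).
    split; [exact: generated_filter_base|by move=> U []|].
    have [_ _ BM0] := svalP M0; apply: (finer_trans _ _ _ BM0) => U M0U.
    by exists U => //; apply: sub_generated_filter => //; exists M0.
  exists (exist _ _ okG) => M cM; apply/asboolP => U MU.
  by exists U => //; apply: sub_generated_filter => //; exists M.
exists M; split => // C sC CK MC.
have [M0 MI sM] : [/\ M !=set0, forall U V, M U -> M V -> exists2 W, M W & W `<=` U `&` V &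
  forall U, M U -> is_stable F U] by have [] := fM.
pose H := [set U `&` C | U in M].
have H0 : H !=set0 by have [U MU] := M0; exists (U `&` C); exists U.
have sH U : H U -> is_stable F U.
  by move=> [V MV <-]; apply: stableI => //; [exact: sM|exact: MC].
have HK U : H U -> U `<=` K by move=> [V MV <-] z [_ /CK].
have HI U V : H U -> H V -> exists2 W, H W & W `<=` U `&` V.
  move=> [U' MU' <-] [V' MV' <-]; have [W MW WUV] := MI _ _ MU' MV'.
  by exists (W `&` C); [exists W|move=> z [/WUV[? ?] ?]].
have MG : finer M (generated_filter H).
  move=> U MU; exists (U `&` C); last by move=> z [].
  by apply: sub_generated_filter => //; exists U.
have okG : ok (generated_filter H).
  by split; [exact: generated_filter_base|by move=> U []|exact: finer_trans MG].
have /asboolP fG : rl (exist _ _ okG) (exist [eta ok] M (And3 fM MK BM)).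
  by apply: Mmax; exact/asboolP.
have [U MU] := M0.
have [|V MV VUC] := fG (U `&` C).
  by apply: sub_generated_filter => //; exists U.
by exists V => // z /VUC[].
Qed.

End maximal_stable_filter.

(** * Closures in the stable weak topology and limits along a maximal stable filter *)

Section stable_closure.
Context (R : realType) (d : measure_display) (T : measurableType d).
Variables (P : probability T R) (F : set_system T).
Hypotheses (sF : sigma_algebra [set: T] F) (FE : F `<=` measurable).
Local Notation mF := (measurable_wrt F).
Local Notation TF := (g_sigma_algebraType F).
Variable phi : R -> \bar R.
Hypothesis Yphi : is_young phi.
Local Notation psi := (young_conjugate phi).
Local Notation Lphi := (@orlicz R d T P F phi).
Local Notation Lpsi := (@orlicz R d T P F psi).
Local Notation pairing := (pairing P F).
Local Notation W := (w_space P F phi).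
Local Notation w_closure := (@w_closure R d T P F phi).
Local Notation orl_phi := (@orl_phi R d T P F sF FE phi Yphi).
Local Notation orl_psi := (@orl_psi R d T P F sF FE phi Yphi).
Implicit Types (S U : set (L0 P)) (z : L0 P).

Lemma w_closureP S z : S `<=` Lpsi -> w_closure S z <->
  Lpsi z /\ forall G A eps, ball_data F phi G A eps ->
    exists2 s, S s & near_set F phi z G A eps s.
Proof.
move=> SL; split=> [[w cw <-]|[Lz h]].
  split; first exact: w_space_psi.
  move=> G A eps bd.
  by have [s [Ss ns]] := cw _ (nbhs_near_set sF FE Yphi w bd); exists (val s).
pose w : W := exist _ z (mem_set Lz).
exists w => // B /(nbhs_near_set_inv sF FE Yphi)[G [A [eps [bd hB]]]].
have [s Ss ns] := h _ _ _ bd.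
by exists (exist _ s (mem_set (SL _ Ss))); split => //; exact: hB.
Qed.

Lemma sub_w_closure S : S `<=` Lpsi -> S `<=` w_closure S.
Proof.
move=> SL z Sz; apply/(w_closureP _ SL); split; first exact: SL.
move=> G A eps [_ _ [_ e0]]; exists z => //; split; first exact: SL.
by apply: filterS e0 => t e0 k Ak x Gx; rewrite subrr normr0.
Qed.

Lemma w_closure_psi S : w_closure S `<=` Lpsi.
Proof. by move=> z [w _ <-]; exact: w_space_psi. Qed.

Lemma w_closureS S S' : S `<=` S' -> w_closure S `<=` w_closure S'.
Proof. by move=> SS' z [w cw <-]; exists w => //; apply: closureS cw => v; exact: SS'. Qed.

Lemma w_closure_closure S : w_closure (w_closure S) `<=` w_closure S.
Proof.
move=> z [w cw <-]; exists w => //; rewrite (iffLR (closure_id _) (@closed_closure _ _)).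
apply: closureS cw => v [v' cv' vv'].
by rewrite -(val_inj vv').
Qed.

Lemma pairing_mixture_all (G : nat -> set (L0 P)) A (eps : L0 P) (B : nat -> set T) (Y : nat -> L0 P) z :
  ball_data F phi G A eps -> is_partition F B -> (forall k, Lpsi (Y k)) ->
  (\forall t \ae P, forall k, B k t -> z t = Y k t) ->
  \forall t \ae P, forall k, B k t -> forall j x, G j x -> pairing x z t = pairing x (Y k) t.
Proof.
move=> [GP _ _] pB LY zY.
have h : \forall t \ae P, forall j x, G j x -> forall k, B k t -> pairing x z t = pairing x (Y k) t.
  apply: ae_foralln => j; have [finG _ GL] := GP j.
  apply: ae_in_finite => // x Gx.
  exact: (pairing_mixture sF FE Yphi (orl_phi (GL _ Gx)) (fun k => orl_psi (LY k)) (measurable_L0 z) pB zY).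
by apply: filterS h => t h k Bk j x Gx; exact: (h j x Gx k Bk).
Qed.

Lemma Lpsi_mixture (B : nat -> set T) (Y : nat -> L0 P) z : is_partition F B ->
  (forall k, Lpsi (Y k)) -> (\forall t \ae P, forall k, B k t -> z t = Y k t) -> Lpsi z.
Proof.
move=> pB LY zY; have nd := young_conjugate_nd Yphi.
apply/(orliczP sF FE nd).
apply: (orl_ae_eq sF FE nd (measurable_L0 z) _ (orl_paste sF FE nd pB (fun k => orl_psi (LY k)))).
by apply: filterS zY => t h; exact: (h _ (block_mem t pB)).
Qed.

(** Approximants of the ingredients, all taken for the same [G], [A] and [eps], are mixed inside
    [S]; since the pairing is local, the mixture approximates the mixture. *)
Lemma stable_w_closure S : S `<=` Lpsi -> is_stable F S -> is_stable F (w_closure S).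
Proof.
move=> SL sS; have [[s0 Ss0] _] := sS; split; first by exists s0; exact: sub_w_closure.
move=> B pB z /(mixture_setP _ _ pB)[Y cY zY].
have LY k : Lpsi (Y k) by exact: w_closure_psi (cY k).
apply/(w_closureP _ SL); split; first exact: Lpsi_mixture zY.
move=> G A eps bd.
have /choice[s sP] : forall k, exists s, S s /\ near_set F phi (Y k) G A eps s.
  by move=> k; have /(w_closureP _ SL)[_ /(_ _ _ _ bd)[s Ss ns]] := cY k; exists s.
have [v Sv vs] := stable_mixture_ex FE pB sS (fun k => (sP k).1).
exists v => //; split; first exact: SL.
have h1 := pairing_mixture_all bd pB LY zY.
have h2 := pairing_mixture_all bd pB (fun k => SL _ (sP k).1) vs.
have h3 := ae_foralln (fun k => (sP k).2.2).
apply: filterS3 h1 h2 h3 => t h1 h2 h3 k Ak x Gx; have Bt := block_mem t pB.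
by rewrite (h1 _ Bt _ _ Gx) (h2 _ Bt _ _ Gx); exact: (h3 _ _ Ak _ Gx).
Qed.

(* the limit of the pairing along a maximal stable filter is its upper limit *)
Lemma limit_maximal_filter (K : set (L0 P)) (M : set (set (L0 P))) (x : T -> R) (p : T -> R) :
  K `<=` Lpsi -> is_stable F K -> is_stable_filter_base F M -> (forall U, M U -> U `<=` K) ->
  (forall C, is_stable F C -> C `<=` K -> (forall U, M U -> U `&` C !=set0) ->
     exists2 V, M V & V `<=` C) ->
  orl P F phi x -> (forall y, K y -> \forall t \ae P, `|pairing x y t| <= p t) ->
  exists2 f : T -> R, mF f & forall eps : T -> R, mF eps -> (forall t, 0 < eps t) ->
    exists2 V, M V & forall y, V y -> \forall t \ae P, `|pairing x y t - f t| < eps t.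
Proof.
move=> KL sK fM MK Mmax ox xp.
have [M0 MU0 MI sM Mmix] := fM.
have mp (y : L0 P) : mF (pairing x y).
  exact: (measurable_pairing P sF FE ox.1 (measurable_L0 y)).
have mpE (y : L0 P) : mF (fun t => (pairing x y t)%:E) by apply/measurable_EFinP; exact: mp.
have /choice[s sP] : forall U : set (L0 P), exists Z : T -> \bar R, M U ->
    [/\ mF Z, exists y : nat -> L0 P, (forall n, U (y n)) /\
          \forall t \ae P, Z t = ereal_sup (range (fun n => (pairing x (y n) t)%:E)) &
        forall y, U y -> \forall t \ae P, ((pairing x y t)%:E <= Z t)%E].
  move=> U; have [MU|nMU] := pselect (M U); last by exists (cst 0%E) => /nMU.
  pose G := [set (fun t => (pairing x y t)%:E) | y in U].
  have mG g : G g -> exists2 f, mF f & \forall t \ae P, g t = f t.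
    by move=> [y Uy <-]; exists (fun t => (pairing x y t)%:E) => //; exact: aeW.
  have G0 : G !=set0 by have [y Uy] := MU0 _ MU; exists (fun t => (pairing x y t)%:E), y.
  have [u [Z [Gu mZ Zu [_ ub _]]]] := ess_sup_attained sF FE mG G0.
  exists Z => _; split => //; last by move=> y Uy; apply: ub; exists y.
  have /choice[y yP] : forall n, exists y, U y /\ (fun t => (pairing x y t)%:E) = u n.
    by move=> n; have [y Uy <-] := Gu n; exists y.
  exists y; split; first by move=> n; exact: (yP n).1.
  by apply: filterS Zu => t ->; congr ereal_sup; apply/seteqP; split => _ [n _ <-];
    exists n => //; rewrite -(yP n).2.
(* [s U] is the essential supremum of the pairing over [U]. The essential supremum [Z] of the
   opposites makes [f] = -Z the essential infimum of the [s U], that is, the upper limit along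
   [M]. *)
pose G := [set (fun t => - s U t)%E | U in M].
have mG g : G g -> exists2 f, mF f & \forall t \ae P, g t = f t.
  move=> [U MU <-]; exists (fun t => - s U t)%E; last exact: aeW.
  by have [ms _ _] := sP U MU; exact: (measurableT_comp (@oppe_measurable R setT) ms).
have G0 : G !=set0 by have [U MU] := M0; exists (fun t => - s U t)%E, U.
have [v [Z [Gv mZ Zv [_ ub _]]]] := ess_sup_attained sF FE mG G0.
have /choice[Un UnP] : forall n, exists U, M U /\ v n = (fun t => - s U t)%E.
  by move=> n; have [U MU <-] := Gv n; exists U.
have sb U : M U -> \forall t \ae P, ((- p t)%:E <= s U t)%E /\ (s U t <= (p t)%:E)%E.
  move=> MU; have [_ [y [Uy sy]] _] := sP U MU.
  have h : \forall t \ae P, forall n, `|pairing x (y n) t| <= p t.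
    by apply: ae_foralln => n; apply: xp; exact: MK (Uy n).
  apply: filterS2 sy h => t -> h; split.
    apply: (@le_trans _ _ (pairing x (y 0%N) t)%:E); last by apply: ereal_sup_ubound; exists 0%N.
    by rewrite lee_fin; have := h 0%N; rewrite ler_norml => /andP[].
  apply: ub_ereal_sup => _ [n _ <-]; rewrite lee_fin.
  by apply: le_trans (ler_norm _) (h n).
have Zb : \forall t \ae P, Z t \is a fin_num.
  have h : \forall t \ae P, forall n, ((- p t)%:E <= s (Un n) t)%E /\ (s (Un n) t <= (p t)%:E)%E.
    by apply: ae_foralln => n; exact/sb/(UnP n).1.
  apply: filterS2 Zv h => t -> h.
  rewrite fin_numE; apply/andP; split.
    rewrite gt_eqF// (@lt_le_trans _ _ (v 0%N t))//; last by apply: ereal_sup_ubound; exists 0%N.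
    by rewrite (UnP 0%N).2 lteNr (le_lt_trans (h 0%N).2)// ltry.
  rewrite lt_eqF// (@le_lt_trans _ _ (p t)%:E) ?ltry//.
  apply: ub_ereal_sup => _ [n _ <-]; rewrite (UnP n).2 leeNl.
  exact: (h n).1.
pose f t := - fine (Z t).
have mf : mF f.
  by apply: (@measurable_funN _ TF); exact: (measurableT_comp (fine_measurable measurableT) mZ).
exists f => // eps meps eps0.
pose C := [set y | K y /\ \forall t \ae P, `|pairing x y t - f t| < eps t].
have key U : M U -> U `&` C !=set0.
  move=> MU.
  (* Almost surely some [Un n] has its supremum below f + eps. Mixing the [Un n] along the first
     such index gives a member of [M] on which the upper estimate holds. *)
  pose D n := [set t | (s (Un n) t < (f t + eps t)%:E)%E].
  have FD n : F (D n).
    have [ms _ _] := sP _ (UnP n).1.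
    rewrite -(measurable_FE sF) -[X in measurable X]setTI.
    apply: (measurable_lte measurableT ms); apply/measurable_EFinP.
    exact: (@measurable_funD _ TF).
  have cD : \forall t \ae P, exists n, D n t.
    apply: filterS2 Zv Zb => t Zt Zf.
    have : (Z t - (eps t)%:E < Z t)%E by rewrite -(fineK Zf) -EFinB lte_fin gtrBl.
    rewrite {2}Zt => /ereal_sup_gt[_ [n _ <-]]; rewrite (UnP n).2 => h.
    exists n; rewrite /D /= /f; move: h; rewrite -(fineK Zf) -EFinB.
    by rewrite lteNr -EFinN opprB addrC.
  have [A pA AD] := first_partition sF FD cD.
  have MV : M (mixture_set A Un) by apply: Mmix => // k; exact: (UnP k).1.
  (* Since [s N] is at least [f], elements of [N] with pairing above f - eps exist locally; glued
     inside the stable [N], they form a point of [U] satisfying both estimates. *)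
  have [N MN NUV] := MI _ _ MU MV.
  have [msN [y [Ny sy]] _] := sP N MN.
  pose E n := [set t | f t - eps t < pairing x (y n) t].
  have FE' n : F (E n).
    rewrite -(measurable_FE sF) -[X in measurable X]setTI.
    have := @measurable_fun_ltr _ TF R setT _ _ (@measurable_funB _ TF _ _ _ _ mf meps) (mp (y n)).
    by move=> /(_ measurableT [set true] Logic.I); congr measurable; apply/seteqP; split => t [].
  have cE : \forall t \ae P, exists n, E n t.
    have ubN : \forall t \ae P, (- s N t <= Z t)%E by apply: ub; exists N.
    apply: filterS3 sy Zb ubN => t st Zf; rewrite leeNl => Zs.
    have : ((f t - eps t)%:E < s N t)%E.
      apply: lt_le_trans Zs; rewrite -(fineK Zf) -EFinN lte_fin /f.
      by rewrite gtrBl.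
    by rewrite st => /ereal_sup_gt[_ [n _ <-]]; rewrite lte_fin => h; exists n.
  have [B pB BE] := first_partition sF FE' cE.
  have [w Nw wy] := stable_mixture_ex FE pB (sM _ MN) Ny.
  have [Uw /(mixture_setP _ _ pA)[u Uu wu]] := NUV _ Nw.
  exists w; split => //; split; first exact: MK Uw.
  have LU V y' : M V -> V y' -> orl P F psi y' by move=> MV' Vy'; apply/orl_psi/KL/(MK _ MV').
  have h1 := pairing_mixture sF FE Yphi ox (fun n => LU _ _ MN (Ny n)) (measurable_L0 w) pB wy.
  have h2 := pairing_mixture sF FE Yphi ox (fun n => LU _ _ (UnP n).1 (Uu n)) (measurable_L0 w) pA wu.
  have h3 : \forall t \ae P, forall n, ((pairing x (u n) t)%:E <= s (Un n) t)%E.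
    by apply: ae_foralln => n; have [_ _] := sP _ (UnP n).1; apply.
  near=> t.
  rewrite ltr_norml; apply/andP; split.
    have Bt := block_mem t pB.
    have : pairing x w t = pairing x (y (block B t)) t.
      by move: (block B t) Bt; near: t; exact: h1.
    have : E (block B t) t by move: (block B t) Bt; near: t; exact: BE.
    by rewrite /E /= => h ->; rewrite ltrBrDl.
  have At := block_mem t pA.
  have : pairing x w t = pairing x (u (block A t)) t.
    by move: (block A t) At; near: t; exact: h2.
  have : D (block A t) t by move: (block A t) At; near: t; exact: AD.
  have : ((pairing x (u (block A t)) t)%:E <= s (Un (block A t)) t)%E.
    by move: (block A t); near: t; exact: h3.
  by move=> h4 h5 ->; rewrite ltrBlDl -lte_fin; exact: le_lt_trans h4 h5.
have sC : is_stable F C.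
  split; first by have [U MU] := M0; have [y [_ Cy]] := key _ MU; exists y.
  move=> A pA z /(mixture_setP _ _ pA)[y Cy zy]; split.
    have [_ sK'] := sK; apply: (sK' _ pA); apply/(mixture_setP _ _ pA).
    by exists y => // k; exact: (Cy k).1.
  have h1 := pairing_mixture sF FE Yphi ox (fun n => orl_psi (KL _ (Cy n).1)) (measurable_L0 z) pA zy.
  apply: filterS2 h1 (ae_foralln (fun k => (Cy k).2)) => t h1 h2.
  by rewrite (h1 _ (block_mem t pA)).
have [|V MV VC] := Mmax C sC _ key; first by move=> y [].
by exists V => // y /VC[].
Unshelve. all: by end_near.
Qed.

End stable_closure.

(** * Representation of dominated local functionals *)

Section representation.
Context (R : realType) (d : measure_display) (T : measurableType d).
Variables (P : probability T R) (F : set_system T).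
Hypotheses (sF : sigma_algebra [set: T] F) (FE : F `<=` measurable).
Local Notation mF := (measurable_wrt F).
Local Notation TF := (g_sigma_algebraType F).
Local Notation CE := (CE P F).
Variable phi : R -> \bar R.
Hypothesis Yphi : is_young phi.
Local Notation psi := (young_conjugate phi).
Local Notation ophi := (orl P F phi).
Local Notation pairing := (pairing P F).
Local Notation one := (cst (1 : R)%R : T -> R).
Implicit Types (x : T -> R).

Variables (f : (T -> R) -> T -> R) (Pi : (T -> R) -> T -> \bar R).
Hypothesis mf : forall x, ophi x -> mF (f x).
Hypothesis fD : forall x x', ophi x -> ophi x' ->
  \forall t \ae P, f (fun u => x u + x' u) t = f x t + f x' t.
Hypothesis fZ : forall (a : R) x, ophi x -> \forall t \ae P, f (fun u => a * x u) t = a * f x t.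
Hypothesis f_local : forall x x' B, ophi x -> ophi x' -> F B ->
  (\forall t \ae P, B t -> x t = x' t) -> \forall t \ae P, B t -> f x t = f x' t.
Hypothesis fPi : forall x, ophi x -> \forall t \ae P, (`|f x t|%:E <= Pi x t)%E.
Hypothesis mPi : forall x, ophi x -> mF (Pi x).
Hypothesis Pi_fin : forall x, ophi x -> \forall t \ae P, (Pi x t < +oo)%E.
Hypothesis Pi_le : forall x x', ophi x -> ophi x' ->
  (\forall t \ae P, `|x t| <= `|x' t|) -> \forall t \ae P, (Pi x t <= Pi x' t)%E.
Hypothesis Pi_cont : forall x : nat -> T -> R, (forall n, ophi (x n)) ->
  (\forall t \ae P, nonincreasing_seq (x ^~ t) /\ (x ^~ t) @ \oo --> (0 : R)) ->
  \forall t \ae P, (Pi (x n) t @[n --> \oo] --> 0)%E.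

Let FT : F setT. Proof. by rewrite -(measurable_FE sF). Qed.

Let ndphi := is_young_nd Yphi.

Let oindic (A : set T) : measurable A -> ophi \1_A.
Proof.
move=> mA; apply: (bounded_orl P sF FE (M := 1) Yphi); first exact: measurable_indic.
by move=> t; rewrite indicE; case: (_ \in _); rewrite /= ?normr1 ?normr0.
Qed.

Let ocst (c : R) : ophi (cst c).
Proof. exact: (bounded_orl P sF FE (M := `|c|) Yphi). Qed.

Let f_ae_eq x x' : ophi x -> ophi x' -> (\forall t \ae P, x t = x' t) ->
  \forall t \ae P, f x t = f x' t.
Proof.
move=> ox ox' xx'.
have xx : \forall t \ae P, setT t -> x t = x' t by apply: filterS xx'.
by apply: filterS (f_local ox ox' FT xx) => t; exact.
Qed.

Let f0 x : ophi x -> (\forall t \ae P, x t = 0) -> \forall t \ae P, f x t = 0.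
Proof.
move=> ox x0.
have h1 : \forall t \ae P, f x t = f (cst 0) t by exact: f_ae_eq.
have h2 : \forall t \ae P, f (fun u => 0 * (cst 0 : T -> R) u) t = 0 * f (cst 0) t by exact: fZ.
rewrite (_ : (fun u => _) = cst 0) in h2; last by apply/funext => u; rewrite mul0r.
by apply: filterS2 h1 h2 => t -> ->; rewrite mul0r.
Qed.

(** [fine] and the absolute value keep the weight in ]0, 1] at every point, even where [Pi one] is
    infinite. *)
Let c t : R := (1 + `|fine (Pi one t)|)^-1.

Let c0 t : 0 < c t. Proof. by rewrite invr_gt0 ltr_pwDl. Qed.

Let mc : mF c.
Proof.
apply: (@measurable_funV _ _ TF) => [t|]; first by rewrite ltr_pwDl.
apply: (@measurable_funD _ TF) => //.
apply: measurableT_comp => //.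
exact: (measurableT_comp (fine_measurable measurableT) (mPi (ocst 1))).
Qed.

Let cf_le1 x : ophi x -> (forall t, `|x t| <= 1) -> \forall t \ae P, `|c t * f x t| <= 1.
Proof.
move=> ox x1.
have h : \forall t \ae P, (Pi x t <= Pi one t)%E.
  by apply: (Pi_le ox (ocst 1)); apply: aeW => t; rewrite /= normr1.
apply: filterS3 (fPi ox) h (Pi_fin (ocst 1)) => t h1 h2 h3.
have h4 := le_trans h1 h2.
have Pf : Pi one t \is a fin_num.
  by rewrite ge0_fin_numE// (le_trans _ h4)// lee_fin.
rewrite normrM (gtr0_norm (c0 t)) /c mulrC ler_pdivrMr ?ltr_pwDl// mul1r.
move: h4; rewrite -{1}(fineK Pf) lee_fin => /le_trans; apply.
by rewrite (le_trans (ler_norm _))// lerDr.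
Qed.

Let mcf x : ophi x -> mF (fun t => c t * f x t).
Proof. by move=> ox; apply: (@measurable_funM _ TF) => //; exact: mf. Qed.

Let icf x : ophi x -> (forall t, `|x t| <= 1) -> P.-integrable setT (fun t => (c t * f x t)%:E).
Proof.
move=> ox x1; have m := measurable_wrtW sF FE (mcf ox).
apply/integrableP; split; first exact/measurable_EFinP.
apply: (@le_lt_trans _ _ (\int[P]_t cst 1%:E t)%E); last first.
  by rewrite integral_cst//= probability_setT mule1 ltry.
apply: ae_ge0_le_integral => //.
  by apply: measurableT_comp => //; exact/measurable_EFinP.
by apply: filterS (cf_le1 ox x1) => t; rewrite lee_fin.
Qed.

Let indic1 (A : set T) t : `|\1_A t : R| <= 1.
Proof. by rewrite indicE; case: (_ \in _); rewrite /= ?normr1 ?normr0. Qed.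

Let nu (A : set T) : \bar R := (\int[P]_t (c t * f \1_A t)%:E)%E.

Let nu0 : nu set0 = 0%E.
Proof.
have h : \forall t \ae P, f \1_(set0 : set T) t = 0.
  by apply: f0; [exact: oindic|apply: aeW => t; rewrite indic0].
rewrite /nu (ae_eq_integral (cst 0%E)) ?integral0//.
  by apply/measurable_EFinP; exact: (measurable_wrtW sF FE (mcf (oindic measurable0))).
by apply: filterS h => t -> _; rewrite mulr0.
Qed.

Let nufin A : measurable A -> nu A \is a fin_num.
Proof. by move=> mA; apply: integrable_fin_num => //; apply: icf; [exact: oindic|]. Qed.

Let nuD A B : measurable A -> measurable B -> A `&` B = set0 ->
  nu (A `|` B) = (nu A + nu B)%E.
Proof.
move=> mA mB AB0; have oA := oindic mA; have oB := oindic mB.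
rewrite /nu -integralD//; [|exact: icf|exact: icf].
apply: ae_eq_integral => //.
- by apply/measurable_EFinP; exact: (measurable_wrtW sF FE (mcf (oindic (measurableU _ _ mA mB)))).
- by apply: emeasurable_funD; apply/measurable_EFinP; exact: (measurable_wrtW sF FE (mcf _)).
have := fD oA oB.
rewrite (_ : (fun u => _) = \1_(A `|` B)).
  by apply: filterS => t -> _; rewrite -EFinD mulrDr.
apply/funext => u; rewrite !indicE in_setU.
have : ~~ ((u \in A) && (u \in B)).
  by apply/negP => /andP[/set_mem Au /set_mem Bu]; have : (A `&` B) u by []; rewrite AB0.
by case: (u \in A); case: (u \in B); rewrite //= ?addr0 ?add0r.
Qed.

(** The indicators of the tails [tl n] decrease to 0, so [Pi_cont] forces [f] of them to 0; the
    weighted functions are bounded by 1, and dominated convergence sends the charge of the tails to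
    0. *)
Let nusig : semi_sigma_additive nu.
Proof.
move=> /= E mE tE mUE.
pose Q n := \big[setU/set0]_(0 <= i < n) E i.
have mQ n : measurable (Q n) by rewrite /Q big_mkord; apply: bigsetU_measurable.
pose tl n := \bigcup_k E k `\` Q n.
have mtl n : measurable (tl n) by exact: measurableD.
have sumQ n : (\sum_(0 <= i < n) nu (E i))%E = nu (Q n).
  elim: n => [|n ih]; first by rewrite /Q !big_geq// nu0.
  rewrite /Q !big_nat_recr//= ih nuD//; first exact: mQ.
  apply/seteqP; split => // t; rewrite big_mkord -bigcup_mkord => -[[i /= ni Ei] En].
  have := tE i n Logic.I Logic.I (ex_intro _ t (conj Ei En)) => ein.
  by rewrite ein ltnn in ni.
have QU n : Q n `<=` \bigcup_k E k.
  by rewrite /Q big_mkord -bigcup_mkord; apply: bigcup_sub => i _; exact: bigcup_sup.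
have nutl n : (nu (Q n) = nu (\bigcup_k E k) - nu (tl n))%E.
  have := nuD (mQ n) (mtl n); rewrite setDIK setDUK// => -> //.
  by rewrite addeK//; exact: nufin.
under eq_fun do rewrite sumQ nutl.
suff : (nu (\bigcup_k E k) - nu (tl n))%E @[n --> \oo] --> (nu (\bigcup_k E k) - 0)%E.
  by rewrite sube0.
apply: cvgeB => //; first by rewrite fin_num_adde_defl// nufin.
  exact: cvg_cst.
have tl0 t : nonincreasing_seq (fun n => \1_(tl n) t : R) /\ (fun n => \1_(tl n) t : R) @ \oo --> (0 : R).
  split.
    apply/nonincreasing_seqP => n; rewrite !indicE ler_nat.
    suff : (t \in tl n.+1) -> (t \in tl n) by case: (t \in tl n.+1) => // ->.
    move=> /set_mem[Ut nQ]; apply/mem_set; split => // Qn; apply: nQ.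
    by rewrite /Q big_nat_recr//=; left.
  have [[k _ Ekt]|nU] := pselect ((\bigcup_k E k) t); last first.
    by apply: cvg_near_cst; apply: nearW => n; rewrite indicE memNset// => -[].
  apply: cvg_near_cst; exists k.+1 => // n /= kn; rewrite indicE memNset// => -[_]; apply.
  by rewrite /Q big_mkord -bigcup_mkord; exists k.
have cPi : \forall t \ae P, (Pi \1_(tl n) t @[n --> \oo] --> 0)%E.
  by apply: Pi_cont => [n|]; [exact: oindic|exact: aeW].
have hPi : \forall t \ae P, forall n, (`|f \1_(tl n) t|%:E <= Pi \1_(tl n) t)%E.
  by apply: ae_foralln => n; exact/fPi/oindic.
have c1 t : c t <= 1 by rewrite invf_le1 ?ltr_pwDl// lerDl.
have [] := @dominated_convergence _ _ _ P setT measurableT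
  (fun n t => (c t * f \1_(tl n) t)%:E) (cst 0%E) (cst 1%E).
- by move=> n; apply/measurable_EFinP; exact: (measurable_wrtW sF FE (mcf (oindic (mtl n)))).
- exact: measurable_cst.
- apply: filterS2 cPi hPi => t cP hP _.
  have cPN : (- Pi \1_(tl n) t @[n --> \oo] --> 0)%E by rewrite -oppe0; exact: cvgeN.
  have hc n : (`|c t * f \1_(tl n) t|%:E <= Pi \1_(tl n) t)%E.
    apply: le_trans (hP n); rewrite lee_fin normrM (gtr0_norm (c0 t)).
    by rewrite -[leRHS]mul1r ler_wpM2r.
  apply: (squeeze_cvge _ cPN cP); apply: nearW => n.
  rewrite leeNl -EFinN; apply/andP; split; apply: le_trans (hc n); rewrite lee_fin.
    by rewrite -normrN ler_norm.
  exact: ler_norm.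
- exact: finite_measure_integrable_cst.
- have h : \forall t \ae P, forall n, `|c t * f \1_(tl n) t| <= 1.
    by apply: ae_foralln => n; apply: cf_le1; [exact: oindic|].
  by apply: filterS h => t h n _; rewrite lee_fin.
by move=> _ _; rewrite integral0.
Qed.

HB.instance Definition _ := isCharge.Build _ _ _ nu nu0 nufin nusig.

Let nu_dom : nu `<< P.
Proof.
apply/null_content_dominatesP => A mA A0.
have oA := oindic mA.
have h : \forall t \ae P, f \1_A t = 0.
  apply: f0 => //; exists A; split => // t /= h; apply: contrapT => nA; apply: h.
  by rewrite indicE memNset.
rewrite /nu (ae_eq_integral (cst 0%E)) ?integral0//.
  by apply/measurable_EFinP; exact: (measurable_wrtW sF FE (mcf oA)).
by apply: filterS h => t -> _; rewrite mulr0.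
Qed.

Lemma representing_density : exists h : T -> R,
  P.-integrable setT (EFin \o h) /\
  forall A, measurable A -> (\int[P]_t (c t * f \1_A t)%:E = \int[P]_(t in A) (h t)%:E)%E.
Proof.
pose g := Radon_Nikodym nu P.
have gfin t : g t \is a fin_num by exact: Radon_Nikodym_fin_num.
have gE : EFin \o (fine \o g) = g by apply/funext => t /=; rewrite fineK.
exists (fine \o g); split; first by rewrite gE; exact: Radon_Nikodym_integrable.
move=> A mA; rewrite -[LHS]/(nu A) (Radon_Nikodym_integral nu_dom mA).
by apply: eq_integral => t _; rewrite -[RHS]/((EFin \o (fine \o g)) t) gE.
Qed.

(** Locality turns the Radon-Nikodym identity into a conditional one for indicators, and linearity
    extends it to simple functions. The passage to nonnegative x uses monotone convergence for the
    expectations and [Pi_cont] for [f]; it also gives the finiteness that places [y] in the dual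
    space. *)
Lemma representation : exists2 y : T -> R, orl P F psi y &
  forall x, ophi x -> \forall t \ae P, f x t = pairing x y t.
Proof.
have [h [ih hE]] := representing_density.
have ich : cond_integrable P F h by exact: integrable_cond_integrable.
pose ci t : R := 1 + `|fine (Pi one t)|.
have ci0 t : 0 < ci t by rewrite ltr_pwDl.
have cci t : ci t * c t = 1 by rewrite /c divff// gt_eqF.
have mci : mF ci.
  apply: (@measurable_funD _ TF) => //; apply: measurableT_comp => //.
  exact: (measurableT_comp (fine_measurable measurableT) (mPi (ocst 1))).
pose y t := ci t * h t.
have icy : cond_integrable P F y by exact: cond_integrable_pull.
have my : measurable_fun setT y by case: icy.
have indic_case (A : set T) : measurable A -> cond_integrable P F (fun t => \1_A t * y t) /\
    \forall t \ae P, f \1_A t = pairing \1_A y t.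
  move=> mA; have oA := oindic mA.
  have restrE : (EFin \o h) \_ A = EFin \o (fun t => \1_A t * h t).
    by apply/funext => t; rewrite patchE /= indicE; case: ifPn; rewrite ?mul1r ?mul0r.
  have iA : P.-integrable setT (EFin \o (fun t => \1_A t * h t)).
    rewrite -restrE; apply/(integrable_mkcond _ mA).1; exact: integrableS ih.
  have icA := integrable_cond_integrable sF FE iA.
  have mZ := mcf oA.
  (* On [B] the value f 1_A agrees with f of the indicator of A [&] B, which vanishes off [B];
     restricting to [B] therefore amounts to applying [representing_density] to A [&] B. *)
  have ZX B : F B -> (\int[P]_(t in B) (c t * f \1_A t)%:E = \int[P]_(t in B) (\1_A t * h t)%:E)%E.
    move=> FB; have mB := FE FB; have mAB := measurableI _ _ mA mB; have oAB := oindic mAB.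
    transitivity (\int[P]_(t in A `&` B) (h t)%:E)%E; last first.
      rewrite setIC integral_mkcondr; apply: eq_integral => t _.
      by rewrite -[LHS]/(((EFin \o h) \_ A) t) restrE.
    rewrite -hE//.
    have h1 : \forall t \ae P, B t -> f \1_A t = f \1_(A `&` B) t.
      apply: (f_local oA oAB FB); apply: aeW => t Bt.
      by rewrite !indicE in_setI (mem_set Bt) andbT.
    have h2 : \forall t \ae P, (~` B) t -> f \1_(A `&` B) t = f (cst 0) t.
      apply: (f_local oAB (ocst 0)).
        by rewrite -(measurable_FE sF); apply: measurableC; rewrite measurable_FE.
      apply: aeW => t nBt; rewrite indicE memNset// => -[_ /nBt]; exact.
    have h3 : \forall t \ae P, f (cst 0) t = 0 by apply: f0; [exact: ocst|exact: aeW].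
    rewrite integral_mkcond; apply: ae_eq_integral => //.
    - apply/(measurable_restrictT _ mB).1; apply: measurable_funTS.
      by apply/measurable_EFinP; exact: (measurable_wrtW sF FE mZ).
    - by apply/measurable_EFinP; exact: (measurable_wrtW sF FE (mcf oAB)).
    - apply: filterS3 h1 h2 h3 => t h1 h2 h3 _; rewrite patchE; case: ifPn => tB.
        by rewrite h1//; exact: set_mem.
      rewrite h2 ?h3 ?mulr0//; move=> Bt; move: tB; by rewrite mem_set.
  have h1 := condR_unique sF FE iA mZ (icf oA (indic1 A)) ZX.
  have E : (fun u => ci u * (\1_A u * h u)) = (fun u => \1_A u * y u).
    by apply/funext => u; rewrite /y; ring.
  have h2 := condR_pull sF FE icA mci (fun t => ltW (ci0 t)).
  split; first by rewrite -E; exact: cond_integrable_pull.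
  rewrite E in h2; apply: filterS2 h1 h2 => t h1; rewrite h1 => h2.
  by rewrite /pairing h2 mulrA cci mul1r.
have simple (g : {nnsfun T >-> R}) : [/\ ophi g, cond_integrable P F (fun t => g t * y t) &
    \forall t \ae P, f g t = pairing g y t].
  pose Q (g : T -> R) := [/\ ophi g, cond_integrable P F (fun t => g t * y t) &
    \forall t \ae P, f g t = pairing g y t].
  suff : Q g by [].
  apply: nnsfun_rect_indic.
    have o0 := ocst 0; split; first exact: o0.
      rewrite (_ : (fun t => _) = cst 0); first exact: cond_integrable_cst0.
      by apply/funext => t /=; rewrite mul0r.
    have h0 : \forall t \ae P, f (cst 0) t = 0 by apply: f0; [exact: o0|exact: aeW].
    have h1 := condR0 P sF FE.
    rewrite /pairing (_ : (fun u => cst 0 u * y u) = cst 0); last first.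
      by apply/funext => t /=; rewrite mul0r.
    by apply: filterS2 h0 h1 => t -> ->.
  move=> a A g' a0 mA mg' g'0 [og' ig' fg'].
  have [iA fA] := indic_case _ mA; have oA := oindic mA.
  have oaA := orlZ sF FE ndphi a oA.
  have iaA := cond_integrableZ sF FE a iA.
  split; first exact: orlD.
    have := cond_integrableD sF FE iaA ig'.
    by congr (cond_integrable P F _); apply/funext => t; rewrite mulrDl mulrA.
  have h1 := fD oaA og'; have h2 := fZ a oA.
  have h3 := condRD sF FE iaA ig'; have h4 := condRZ sF FE a iA.
  have pE w : pairing w y = condR P F (fun u => w u * y u) by [].
  rewrite !pE (_ : (fun u => (a * \1_A u + g' u) * y u) =
    (fun u => a * (\1_A u * y u) + g' u * y u)); last by apply/funext => u; ring.
  near=> t.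
  transitivity (f (fun u => a * \1_A u) t + f g' t); first by near: t; exact: h1.
  transitivity (condR P F (fun u => a * (\1_A u * y u)) t + condR P F (fun u => g' u * y u) t); last first.
    by apply/esym; near: t; exact: h3.
  congr (_ + _); last by near: t; exact: fg'.
  transitivity (a * f \1_A t); first by near: t; exact: h2.
  transitivity (a * condR P F (fun u => \1_A u * y u) t); last by apply/esym; near: t; exact: h4.
  by congr (_ * _); near: t; exact: fA.
(* on the part where [y] has a given sign [s], monotone convergence applies *)
have signed_case (s : R) (w : T -> R) : s ^+ 2 = 1 -> ophi w -> (forall t, 0 <= w t) ->
    (forall t, 0 <= w t * (s * y t)) ->
    \forall t \ae P, CE (fun u => (w u * (s * y u))%:E) t = (s * f w t)%:E.
  move=> s1 ow w0 wy0; have mw : measurable_fun setT w by case: ow.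
  have mwE : measurable_fun setT (EFin \o w) by exact/measurable_EFinP.
  pose g := nnsfun_approx measurableT mwE.
  have gw n t : g n t <= w t.
    have := @le_approx _ T R setT (EFin \o w) n t (fun t _ => w0 t) Logic.I.
    by rewrite -nnsfun_approxE lee_fin.
  have g0 n t : 0 <= g n t by [].
  have gnd t : nondecreasing_seq (g ^~ t).
    by move=> m n mn; exact/lefP/nd_nnsfun_approx.
  have gcvg t : (g n t)%:E @[n --> \oo] --> (w t)%:E.
    by exact: (@cvg_nnsfun_approx _ _ _ _ measurableT _ mwE (fun t _ => w0 t)).
  (* The sign of s y is known only where [w] is positive; elsewhere [g n] vanishes along with
     [w]. *)
  have gy0 n t : 0 <= g n t * (s * y t).
    have := wy0 t; have [wt0|wt0] := eqVneq (w t) 0.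
      have -> : g n t = 0 by apply/eqP; rewrite eq_le g0 -wt0 gw.
      by rewrite mul0r.
    by rewrite pmulr_rge0 ?lt_neqAle 1?eq_sym ?wt0 ?w0// => sy0; rewrite mulr_ge0.
  have msy : measurable_fun setT (fun t => s * y t) by exact: measurable_funM.
  have gyC n : \forall t \ae P, CE (fun u => (g n u * (s * y u))%:E) t = (s * f (g n) t)%:E.
    have [og ig fg] := simple (g n).
    have isg := cond_integrableZ sF FE s ig.
    have E : (fun u => s * (g n u * y u)) = (fun u => g n u * (s * y u)).
      by apply/funext => u; rewrite mulrCA.
    rewrite E in isg; have h1 := condRZ sF FE s ig; rewrite E in h1.
    have h2 := ge0_condR_fine sF FE isg.1 (gy0 n).
    have h3 : \forall t \ae P, (CE (fun u => (g n u * (s * y u))%:E) t < +oo)%E.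
      have [_] := isg; rewrite (_ : (fun u => `|g n u * (s * y u)|%:E) = (fun u => (g n u * (s * y u))%:E))//.
      by apply/funext => u; rewrite ger0_norm.
    near=> t.
    transitivity ((condR P F (fun u => g n u * (s * y u)) t)%:E);  first by apply/esym; near: t; exact: (h2 P h3).
    congr EFin; transitivity (s * condR P F (fun u => g n u * y u) t); first by near: t; exact: h1.
    by congr (_ * _); apply/esym; near: t; exact: fg.
  have mwy : measurable_fun setT (fun u => (w u * (s * y u))%:E).
    by apply/measurable_EFinP; exact: measurable_funM.
  have mgy n : measurable_fun setT (fun u => (g n u * (s * y u))%:E).
    by apply/measurable_EFinP; exact: measurable_funM.
  have cCE : \forall t \ae P, CE (fun u => (g n u * (s * y u))%:E) t @[n --> \oo] -->
      CE (fun u => (w u * (s * y u))%:E) t.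
    apply: CE_sup => //.
    - move=> t m n mn; rewrite lee_fin.
      have [wt0|wt0] := eqVneq (w t) 0.
        have z k : g k t = 0 by apply/eqP; rewrite eq_le g0 -wt0 gw.
        by rewrite !z !mul0r.
      apply: ler_wpM2r; last exact: gnd.
      by rewrite -(@pmulr_rge0 _ (w t))// lt_neqAle eq_sym wt0 w0.
    - move=> t; under eq_fun do rewrite EFinM; rewrite EFinM.
      by apply: cvgeZr => //; exact: gcvg.
  have og n : ophi (g n) by have [] := simple (g n).
  have owg n : ophi (fun t => w t - g n t) by exact: orlB.
  (* The errors w - g n decrease to 0, so [Pi] of them, and with it f w - f (g n), tends to 0. *)
  have cPi : \forall t \ae P, (Pi (fun u => (w u - g n u)%R) t @[n --> \oo] --> 0)%E.
    apply: Pi_cont => //; apply: aeW => t; split.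
      by move=> m n mn; rewrite lerD2l lerN2 gnd.
    rewrite -(subrr (w t)); apply: cvgB; first exact: cvg_cst.
    by have /fine_cvgP[] := gcvg t.
  have hPi : \forall t \ae P, forall n, (`|f (fun u => (w u - g n u)%R) t|%:E <= Pi (fun u => (w u - g n u)%R) t)%E.
    by apply: ae_foralln => n; exact: fPi.
  have fB : \forall t \ae P, forall n, f w t = f (fun u => w u - g n u) t + f (g n) t.
    apply: ae_foralln => n; have := fD (owg n) (og n).
    by rewrite (_ : (fun u => _) = w)//; apply/funext => u; rewrite subrK.
  have cf : \forall t \ae P, (s * f (g n) t)%:E @[n --> \oo] --> (s * f w t)%:E.
    apply: filterS3 cPi hPi fB => t cP hP fBt.
    apply: cvg_EFin; first exact: nearW.
    apply: cvgMr; apply/cvgrPdist_le => e e0.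
    have /fine_cvgP[fP /cvgrPdist_le/(_ _ e0)] := cP; apply: filterS2 fP => n Pf.
    rewrite sub0r normrN => hn; rewrite (fBt n) addrK.
    have := hP n; rewrite -(fineK Pf) lee_fin => /le_trans; apply.
    exact: le_trans (ler_norm _) hn.
  have gyC' := ae_foralln gyC.
  apply: filterS3 cCE cf gyC' => t h1 h2 h3.
  have h4 : (fun n => CE (fun u => (g n u * (s * y u))%:E) t) = (fun n => (s * f (g n) t)%:E) by exact/funext.
  rewrite h4 in h1; exact: cvg_unique h1 h2.
have repr_ge0 x : ophi x -> (forall t, 0 <= x t) ->
    \forall t \ae P, (CE (fun u => (x u * `|y u|)%:E) t < +oo)%E /\ f x t = pairing x y t.
  move=> ox x0; have mx : measurable_fun setT x by case: ox.
  (* [x] is cut according to the sign of [y]; the two parts have opposite signs for xy, and adding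
     their finite expectations bounds E[x|y| | F]. *)
  pose E := [set t | 0 <= y t].
  have mE : measurable E.
    rewrite -[X in measurable X]setTI.
    have := measurable_fun_ler (measurable_cst (0 : R)) my.
    by move=> /(_ measurableT [set true] Logic.I); congr measurable; apply/seteqP; split => t [].
  pose u t := x t * \1_E t; pose v t := x t * \1_(~` E) t.
  have mnE := measurableC mE.
  have u0 t : 0 <= u t by rewrite mulr_ge0.
  have v0 t : 0 <= v t by rewrite mulr_ge0.
  have ux t : `|u t| <= `|x t|.
    by rewrite normrM ler_piMr.
  have vx t : `|v t| <= `|x t|.
    by rewrite normrM ler_piMr.
  have mu : measurable_fun setT u by apply: measurable_funM => //; exact: measurable_indic.
  have mv : measurable_fun setT v by apply: measurable_funM => //; exact: measurable_indic.
  have ou : ophi u by apply: (orl_solid sF FE ndphi mu _ ox); exact: aeW.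
  have ov : ophi v by apply: (orl_solid sF FE ndphi mv _ ox); exact: aeW.
  have uy t : u t * (1 * y t) = x t * Num.max (y t) 0.
    rewrite /u mul1r -mulrA indicE; congr (_ * _); case: (boolP (t \in E)) => [/set_mem|/negP tE].
      by rewrite /E /= => yt; rewrite mul1r max_l.
    rewrite mul0r max_r// ltW// ltNge; apply/negP => yt; apply: tE; exact: mem_set.
  have vy t : v t * (-1 * y t) = x t * Num.max (- y t) 0.
    rewrite /v mulN1r -mulrA indicE in_setC; congr (_ * _); case: (boolP (t \in E)) => [/set_mem|/negP tE].
      by rewrite /E /= => yt; rewrite mul0r max_r// oppr_le0.
    rewrite mul1r max_l// oppr_ge0 ltW// ltNge; apply/negP => yt; apply: tE; exact: mem_set.
  have max0 (a : R) : 0 <= Num.max a 0 by rewrite le_max lexx orbT.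
  have h1 := @signed_case 1 u (expr1n _ _) ou u0 (fun t => ltac:(by rewrite uy mulr_ge0)).
  have h2 := @signed_case (-1) v (sqrr_sign _ 1) ov v0 (fun t => ltac:(by rewrite vy mulr_ge0)).
  have h3 := fD ou ov.
  rewrite (_ : (fun t => u t + v t) = x) in h3; last first.
    apply/funext => t; rewrite /u /v -mulrDr !indicE in_setC.
    by case: (t \in E); rewrite /= ?addr0 ?add0r mulr1.
  have mU : measurable_fun setT (fun t => u t * (1 * y t)).
    by apply: measurable_funM => //; exact: measurable_funM.
  have mV : measurable_fun setT (fun t => v t * (-1 * y t)).
    by apply: measurable_funM => //; exact: measurable_funM.
  have U0 t : 0 <= u t * (1 * y t) by rewrite uy mulr_ge0.
  have V0 t : 0 <= v t * (-1 * y t) by rewrite vy mulr_ge0.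
  have h4 := @CE_add _ _ _ P _ sF FE (fun t => (u t * (1 * y t))%:E) (fun t => (v t * (-1 * y t))%:E)
    (iffRL (measurable_EFinP _ _) mU) (iffRL (measurable_EFinP _ _) mV) U0 V0.
  have Ufin : \forall t \ae P, (CE (fun t => (u t * (1 * y t))%:E) t < +oo)%E.
    by apply: filterS h1 => t ->; rewrite ltry.
  have Vfin : \forall t \ae P, (CE (fun t => (v t * (-1 * y t))%:E) t < +oo)%E.
    by apply: filterS h2 => t ->; rewrite ltry.
  have xyE t : x t * y t = u t * (1 * y t) - v t * (-1 * y t).
    rewrite uy vy -mulrBr; congr (_ * _).
    by rewrite /Num.max; do 2 case: ifPn; rewrite -?leNgt; lra.
  have h5 := condR_diff sF FE (measurable_funM mx my) mU mV U0 V0 Ufin Vfin (aeW _ xyE).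
  near=> t; split.
    rewrite (_ : (fun u => (x u * `|y u|)%:E) = (fun t => (u t * (1 * y t))%:E + (v t * (-1 * y t))%:E)%E); last first.
      apply/funext => r; rewrite uy vy -EFinD -mulrDr; congr (_ * _)%:E.
      have [yr|yr] := leP 0 (y r).
        by rewrite ger0_norm// max_r ?oppr_le0// addr0.
      by rewrite ltr0_norm// max_l ?oppr_ge0 ?ltW// add0r.
    rewrite (_ : CE _ t = CE (fun t => (u t * (1 * y t))%:E) t + CE (fun t => (v t * (-1 * y t))%:E) t)%E.
      by apply: lte_add_pinfty; near: t; [exact: Ufin|exact: Vfin].
    by near: t; exact: h4.
  transitivity (f u t + f v t); first by near: t; exact: h3.
  transitivity (fine (CE (fun t => (u t * (1 * y t))%:E) t) - fine (CE (fun t => (v t * (-1 * y t))%:E) t)); last first.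
    by apply/esym; near: t; exact: h5.
  rewrite (_ : CE (fun t => (u t * (1 * y t))%:E) t = (1 * f u t)%:E); last by near: t; exact: h1.
  rewrite (_ : CE (fun t => (v t * (-1 * y t))%:E) t = (-1 * f v t)%:E); last by near: t; exact: h2.
  by rewrite /= mul1r mulN1r opprK.
have oy : orl P F psi y.
  apply: (koethe_dual sF FE Yphi my) => x ox x0.
  by apply: filterS (repr_ge0 _ ox x0) => t [].
exists y => // x ox; have mx : measurable_fun setT x by case: ox.
pose xp t := Num.max (x t) 0; pose xn t := Num.max (- x t) 0.
have max0 (a : R) : 0 <= Num.max a 0 by rewrite le_max lexx orbT.
have oxp : ophi xp.
  apply: (orl_solid sF FE ndphi _ _ ox); first exact: measurable_maxr.
  by apply: aeW => t; rewrite (ger0_norm (max0 _)) ge_max ler_norm normr_ge0.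
have oxn : ophi xn.
  apply: (orl_solid sF FE ndphi _ _ ox).
    by apply: measurable_maxr => //; exact: measurable_funN.
  by apply: aeW => t; rewrite (ger0_norm (max0 _)) ge_max -normrN ler_norm normr_ge0.
have h1 := repr_ge0 _ oxp (fun t => max0 _); have h2 := repr_ge0 _ oxn (fun t => max0 _).
have onx := orlZ sF FE ndphi (-1) oxn.
have h3 := fD oxp onx; have h4 := fZ (-1) oxn.
have h5 := pairingDl sF FE Yphi oxp onx oy; have h6 := pairingZl sF FE Yphi (-1) oxn oy.
rewrite (_ : (fun u => xp u + -1 * xn u) = x) in h3 h5; last first.
  apply/funext => t; rewrite /xp /xn mulN1r.
  by rewrite /Num.max; do 2 case: ifPn; rewrite -?leNgt; lra.
near=> t.
transitivity (f xp t + f (fun u => -1 * xn u) t); first by near: t; exact: h3.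
transitivity (pairing xp y t + pairing (fun u => -1 * xn u) y t); last by apply/esym; near: t; exact: h5.
congr (_ + _).
  by near: t; apply: filterS h1 => t [].
transitivity (-1 * f xn t); first by near: t; exact: h4.
transitivity (-1 * pairing xn y t); last by apply/esym; near: t; exact: h6.
by congr (_ * _); near: t; apply: filterS h2 => t [].
Unshelve. all: by end_near.
Qed.

End representation.

(** * Compactness *)

Section compactness.
Context (R : realType) (d : measure_display) (T : measurableType d).
Variables (P : probability T R) (F : set_system T).
Hypotheses (sF : sigma_algebra [set: T] F) (FE : F `<=` measurable).
Local Notation mF := (measurable_wrt F).
Local Notation TF := (g_sigma_algebraType F).
Local Notation CE := (CE P F).
Variable phi : R -> \bar R.
Hypothesis Yphi : is_young phi.
Local Notation psi := (young_conjugate phi).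
Local Notation ophi := (orl P F phi).
Local Notation Lphi := (@orlicz R d T P F phi).
Local Notation Lpsi := (@orlicz R d T P F psi).
Local Notation pairing := (pairing P F).
Local Notation w_closure := (@w_closure R d T P F phi).
Local Notation orl_phi := (@orl_phi R d T P F sF FE phi Yphi).
Local Notation orl_psi := (@orl_psi R d T P F sF FE phi Yphi).
Variable S : set (L0 P).
Hypotheses (S_sub : S `<=` Lpsi) (S_stable : is_stable F S).
Hypothesis S_cont : forall x : nat -> L0 P,
  (forall n, orlicz F phi (x n)) ->
  (\forall t \ae P, nonincreasing_seq (fun n => x n t) /\
                    (x n t : R) @[n --> \oo] --> (0 : R)) ->
  \forall t \ae P,
    ess_sup_family P
      [set cond_exp P F (fun u => `|x n u * y u|%:E) | y in S] t
    @[n --> \oo] --> 0%E.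

Let mxy (x : T -> R) (y : L0 P) : measurable_fun [set: T] x ->
  measurable_fun [set: T] (fun u => `|x u * y u|%:E).
Proof.
move=> mx; apply/measurable_EFinP; apply: measurableT_comp => //.
by apply: measurable_funM => //; exact: measurable_L0.
Qed.

Let xy0 (x : T -> R) (y : L0 P) (t : T) : (0 <= `|x t * y t|%:E)%E.
Proof. by rewrite lee_fin. Qed.

(** [Pi x] is an essential supremum over [S], chosen for functions x rather than classes. Continuity
    is the hypothesis transported to functions; finiteness follows by scaling, as Pi x <= (n+1) Pi
    (|x|/(n+1)) and the second factor tends to 0. *)
Lemma dominating_functional : exists Pi : (T -> R) -> T -> \bar R,
  [/\ forall x, ophi x -> mF (Pi x) /\ \forall t \ae P, (Pi x t < +oo)%E,
      forall x x', ophi x -> ophi x' -> (\forall t \ae P, `|x t| <= `|x' t|) ->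
        \forall t \ae P, (Pi x t <= Pi x' t)%E,
      forall x : nat -> T -> R, (forall n, ophi (x n)) ->
        (\forall t \ae P, nonincreasing_seq (x ^~ t) /\ (x ^~ t) @ \oo --> (0 : R)) ->
        \forall t \ae P, (Pi (x n) t @[n --> \oo] --> 0)%E &
      forall x y, ophi x -> S y ->
        \forall t \ae P, (CE (fun u => `|x u * y u|%:E) t <= Pi x t)%E].
Proof.
pose G (x : T -> R) := [set CE (fun u => `|x u * y u|%:E) | y in S].
have mG (x : T -> R) : measurable_fun setT x -> forall g, G x g -> exists2 f, mF f & \forall t \ae P, g t = f t.
  move=> mx _ [y Sy <-]; exists (CE (fun u => `|x u * y u|%:E)); last exact: aeW.
  exact: (measurable_CE P sF FE (mxy y mx) (xy0 x y)).
have G0 x : G x !=set0.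
  by have [[y Sy] _] := S_stable; exists (CE (fun u => `|x u * y u|%:E)), y.
have /choice[Pi PiP] : forall x, exists Z, measurable_fun setT x -> mF Z /\ is_ess_sup P (G x) Z.
  move=> x; have [mx|nmx] := pselect (measurable_fun setT x); last by exists (cst 0%E).
  by have [_ [Z [_ mZ _ eZ]]] := ess_sup_attained sF FE (mG x mx) (G0 x); exists Z.
have Pi_ub (x : T -> R) (y : L0 P) : measurable_fun setT x -> S y ->
    \forall t \ae P, (CE (fun u => `|x u * y u|%:E) t <= Pi x t)%E.
  by move=> mx Sy; have [_ [_ ub _]] := PiP x mx; apply: ub; exists y.
have mPi (x : T -> R) : measurable_fun setT x -> measurable_fun setT (Pi x).
  by move=> mx; have [_ []] := PiP x mx.
have Pi_min (x : T -> R) (Z : T -> \bar R) : measurable_fun setT x -> measurable_fun setT Z ->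
    (forall y, S y -> \forall t \ae P, (CE (fun u => `|x u * y u|%:E) t <= Z t)%E) ->
    \forall t \ae P, (Pi x t <= Z t)%E.
  by move=> mx mZ h; have [_ [_ _ lub]] := PiP x mx; apply: lub => // _ [y Sy <-]; exact: h.
have Pi_cont (x : nat -> T -> R) : (forall n, ophi (x n)) ->
    (\forall t \ae P, nonincreasing_seq (x ^~ t) /\ (x ^~ t) @ \oo --> (0 : R)) ->
    \forall t \ae P, (Pi (x n) t @[n --> \oo] --> 0)%E.
  move=> ox xd; have mx n : measurable_fun setT (x n) by case: (ox n).
  pose X n := L0_of P (mx n).
  have XE : \forall t \ae P, forall n, X n t = x n t by apply: ae_foralln => n; exact: L0_ofE.
  have LX n : Lphi (X n).
    apply/(orliczP sF FE (is_young_nd Yphi)).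
    exact: (orl_ae_eq sF FE (is_young_nd Yphi) (measurable_L0 _) (L0_ofE P (mx n)) (ox n)).
  have Xd : \forall t \ae P, nonincreasing_seq (fun n => X n t) /\ (X n t : R) @[n --> \oo] --> (0 : R).
    apply: filterS2 XE xd => t Xx; rewrite (_ : (fun n => X n t) = x ^~ t)//.
    by apply/funext => n; exact: Xx.
  (* The families built from [cond_exp] on classes and from [CE] on functions agree a.s. member by
     member, so minimality identifies their essential suprema. *)
  have eE n : \forall t \ae P, ess_sup_family P
      [set cond_exp P F (fun u => `|X n u * y u|%:E) | y in S] t = Pi (x n) t.
    set H := [set _ | _ in S].
    have hE (y : L0 P) : \forall t \ae P,
        cond_exp P F (fun u => `|X n u * y u|%:E) t = CE (fun u => `|x n u * y u|%:E) t.
      have h1 := cond_exp_ge0_CE P sF FE (mxy y (measurable_L0 (X n))) (xy0 (X n) y).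
      have h2 : \forall t \ae P, CE (fun u => `|X n u * y u|%:E) t = CE (fun u => `|x n u * y u|%:E) t.
        apply: (CE_ae_eq sF FE (mxy y (measurable_L0 (X n))) (mxy y (mx n)) (xy0 (X n) y) (xy0 (x n) y)).
        by apply: filterS (L0_ofE P (mx n)) => t ->.
      by apply: filterS2 h1 h2 => t ->.
    have eH : is_ess_sup P H (Pi (x n)).
      split; first exact: mPi.
        by move=> _ [y Sy <-]; apply: filterS2 (hE y) (Pi_ub _ y (mx n) Sy) => t ->.
      move=> Z mZ hZ; apply: Pi_min => // y Sy.
      by apply: filterS2 (hE y) (hZ _ (ex_intro2 _ _ y Sy erefl)) => t <-.
    have [m1 u1 l1] : is_ess_sup P H (ess_sup_family P H).
      exact: (xgetPex (cst -oo%E) (ex_intro _ (Pi (x n)) eH)).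
    have [m2 u2 l2] := eH.
    by apply: filterS2 (l1 _ m2 u2) (l2 _ m1 u1) => t a b; apply/eqP; rewrite eq_le a.
  apply: filterS2 (S_cont LX Xd) (ae_foralln eE) => t h e.
  by rewrite (_ : (fun n => Pi (x n) t) = (fun n => ess_sup_family P
    [set cond_exp P F (fun u => `|X n u * y u|%:E) | y in S] t))//; apply/funext => n; rewrite e.
exists Pi; split.
- move=> x ox; have [mx _] := ox; split; first by have [] := PiP x mx.
  pose xs n t := n.+1%:R^-1 * `|x t|.
  have oxs n : ophi (xs n).
    have m : measurable_fun setT (xs n) by apply: measurable_funM => //; exact: measurableT_comp.
    apply: (orl_solid sF FE (is_young_nd Yphi) m _ ox); apply: aeW => t.
    rewrite /xs normrM normr_id ler_piMl// ger0_norm ?invr_ge0//.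
    by rewrite invf_le1// ler1n.
  have xsd : \forall t \ae P, nonincreasing_seq (xs ^~ t) /\ (xs ^~ t) @ \oo --> (0 : R).
    apply: aeW => t; split.
      by move=> m n mn; rewrite ler_wpM2r// lef_pV2 ?posrE// ler_nat.
    by rewrite -(mul0r `|x t|); apply: cvgMl; exact: cvg_harmonic.
  have Pi_scale : \forall t \ae P, forall n, (Pi x t <= n.+1%:R%:E * Pi (xs n) t)%E.
    apply: ae_foralln => n; have mxs := (oxs n).1.
    apply: Pi_min => //.
      by apply: emeasurable_funM => //; exact: mPi.
    move=> y Sy.
    have h1 := ge0_CEr_pull P sF FE (X := fun u => `|xs n u * y u|) (h := cst n.+1%:R).
    have E : (fun u => `|x u * y u|%:E) = (fun u => (cst n.+1%:R u * `|xs n u * y u|)%:E).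
      apply/funext => u; rewrite /xs !normrM normr_id (ger0_norm (x := _^-1)) ?invr_ge0//=.
      by rewrite !mulrA divff ?mul1r// pnatr_eq0.
    rewrite E; have h2 := h1 (iffLR (measurable_EFinP _ _) (mxy y mxs)) (fun t => normr_ge0 _)
      (@measurable_cst _ _ TF R setT _) (fun t => ler0n _ _).
    apply: filterS2 h2 (Pi_ub _ y mxs Sy) => t -> le.
    by apply: lee_wpmul2l => //; rewrite lee_fin.
  apply: filterS2 (Pi_cont _ oxs xsd) Pi_scale => t /fine_cvgP[[N _ Nf] _] h.
  apply: le_lt_trans (h N) _; rewrite -(fineK (Nf N (leqnn N))) -EFinM.
  exact: ltry.
- move=> x x' [mx _] [mx' _] xx'; apply: Pi_min => //; first exact: mPi.
  move=> y Sy; have h : \forall t \ae P, (`|x t * y t|%:E <= `|x' t * y t|%:E)%E.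
    by apply: filterS xx' => t xx'; rewrite lee_fin !normrM ler_wpM2r.
  have h1 := CE_le sF FE (mxy y mx) (mxy y mx') (xy0 x y) (xy0 x' y) h.
  apply: filterS2 h1 (Pi_ub _ y mx' Sy) => t; exact: le_trans.
- exact: Pi_cont.
- by move=> x y [mx _]; exact: Pi_ub.
Qed.

(** [z] is approximated by some s in [S] with an error 1/(n+1) in the pairing with [x]; the bound
    for s passes to [z] as n tends to infinity. *)
Lemma dominated_w_closure (p : T -> \bar R) (x : T -> R) z : ophi x ->
  (\forall t \ae P, p t < +oo)%E ->
  (forall y, S y -> \forall t \ae P, (CE (fun u => `|x u * y u|%:E) t <= p t)%E) ->
  w_closure S z -> \forall t \ae P, (`|pairing x z t|%:E <= p t)%E.
Proof.
move=> ox pfin hp /(w_closureP sF FE Yphi z S_sub)[Lz near_z]; have [mx _] := ox.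
have FT : F setT by rewrite -(measurable_FE sF).
pose X := L0_of P mx; have XE := L0_ofE P mx.
have xX : \forall t \ae P, setT t -> x t = X t by apply: filterS XE => t ->.
have LX : Lphi X.
  apply/(orliczP sF FE (is_young_nd Yphi)).
  exact: (orl_ae_eq sF FE (is_young_nd Yphi) (measurable_L0 _) XE ox).
have pX y : Lpsi y -> \forall t \ae P, pairing x y t = pairing X y t.
  move=> Ly; have := pairing_locall sF FE Yphi ox (orl_psi Ly) (measurable_L0 X) FT xX.
  by apply: filterS => t; exact.
have h n : \forall t \ae P, (`|pairing x z t|%:E <= p t + (n.+1%:R^-1)%:E)%E.
  have n0 : 0 < n.+1%:R^-1 :> R by rewrite invr_gt0 ltr0n.
  have [||eps eF epsE] := @L0Fpp_ex _ _ _ P _ sF FE (cst n.+1%:R^-1); [exact: measurable_cst|exact: aeW|].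
  have bd : ball_data F phi (fun=> [set X]) (fun n => if n is 0%N then [set: T] else set0) eps.
    split; [move=> _|exact: trivial_partition|exact: eF].
    by split; [exact: finite_set1|exists X|move=> _ ->].
  have [s Ss [Ls zs]] := near_z _ _ _ bd.
  have ixs := cond_integrable_mul sF FE Yphi ox (orl_psi Ls).
  have h1 := condR_abs sF FE ixs.
  near=> t.
  have e1 : pairing x z t = pairing X z t by near: t; exact: pX.
  have e2 : pairing x s t = pairing X s t by near: t; exact: pX.
  have e3 : `|pairing X s t - pairing X z t| < eps t.
    suff h' : forall k, (if k is 0%N then [set: T] else set0) t -> forall x0, [set X] x0 ->
      `|pairing x0 s t - pairing x0 z t| < eps t by exact: (h' 0%N).
    by near: t; exact: zs.
  have e4 : eps t = n.+1%:R^-1 by near: t; exact: epsE.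
  have e5 : (`|pairing x s t|%:E <= CE (fun u => `|x u * s u|%:E) t)%E by near: t; exact: h1.
  have e6 : (CE (fun u => `|x u * s u|%:E) t <= p t)%E by near: t; exact: hp.
  apply: (@le_trans _ _ (`|pairing x s t|%:E + (n.+1%:R^-1)%:E)%E); last first.
    by apply: leeD => //; exact: le_trans e6.
  rewrite -EFinD lee_fin e1 e2 -e4.
  rewrite -[X in `|X| <= _](subKr (pairing X s t)).
  by apply: le_trans (ler_normB _ _) _; rewrite lerD2l ltW.
apply: filterS2 pfin (ae_foralln h) => t pt ht.
have pf : p t \is a fin_num.
  rewrite fin_numElt pt andbT ltNye; apply/eqP => pN.
  by have := ht 0%N; rewrite pN addNye leNgt ltNyr.
rewrite -(fineK pf) lee_fin; apply/ler_addgt0Pr => e e0.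
have [n ne] : exists n, n.+1%:R^-1 < e.
  by have [n _ hn] := near_infty_natSinv_lt (PosNum e0); exists n; exact: (hn n (leqnn n)).
apply: (@le_trans _ _ (fine (p t) + n.+1%:R^-1)); last by rewrite lerD2l ltW.
by have := ht n; rewrite -(fineK pf) -EFinD lee_fin.
Unshelve. all: by end_near.
Qed.

End compactness.

(** * Limit functionals of a stable filter base and its cluster points *)

Section cluster_points.
Context (R : realType) (d : measure_display) (T : measurableType d).
Variables (P : probability T R) (F : set_system T).
Hypotheses (sF : sigma_algebra [set: T] F) (FE : F `<=` measurable).
Local Notation mF := (measurable_wrt F).
Local Notation TF := (g_sigma_algebraType F).
Local Notation CE := (CE P F).
Variable phi : R -> \bar R.
Hypothesis Yphi : is_young phi.
Local Notation psi := (young_conjugate phi).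
Local Notation ophi := (orl P F phi).
Local Notation Lphi := (@orlicz R d T P F phi).
Local Notation Lpsi := (@orlicz R d T P F psi).
Local Notation pairing := (pairing P F).
Local Notation w_closure := (@w_closure R d T P F phi).
Local Notation orl_phi := (@orl_phi R d T P F sF FE phi Yphi).
Local Notation orl_psi := (@orl_psi R d T P F sF FE phi Yphi).

(** One member of [M] serves for each error, but the null set may still depend on its point [y]. *)
Definition filter_limit (M : set (set (L0 P))) (f : (T -> R) -> T -> R) := forall x, ophi x ->
  mF (f x) /\ forall eps : T -> R, mF eps -> (forall t, 0 < eps t) ->
    exists2 V, M V & forall y, V y -> \forall t \ae P, `|pairing x y t - f x t| < eps t.

Variables (M : set (set (L0 P))) (f : (T -> R) -> T -> R).
Hypotheses (fM : is_stable_filter_base F M) (Mf : filter_limit M f).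

Lemma filter_limit_common (I : eqType) (x : I -> T -> R) (s : seq I) (eps : T -> R) :
  (forall i, i \in s -> ophi (x i)) -> mF eps -> (forall t, 0 < eps t) ->
  exists2 V, M V & forall y, V y -> forall i, i \in s ->
    \forall t \ae P, `|pairing (x i) y t - f (x i) t| < eps t.
Proof.
move=> + meps eps0; have [M0 _ MI _ _] := fM; elim: s => [|i s ih] ox.
  by have [V MV] := M0; exists V.
have [j js|V1 MV1 hV1] := ih; first by apply: ox; rewrite inE js orbT.
have [_ /(_ _ meps eps0)[V2 MV2 hV2]] := Mf (ox i (mem_head _ _)).
have [V MV V12] := MI _ _ MV1 MV2; exists V => // y /V12[V1y V2y] j.
by rewrite inE => /orP[/eqP ->|js]; [exact: hV2|exact: hV1].
Qed.

(** Errors 1/(n+1) give a sequence along which finitely many pairings converge a.s. at once. Only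
    countably many null sets are involved, so linearity and locality pass from the pairing to
    [f]. *)
Lemma filter_limit_seq (I : eqType) (x : I -> T -> R) (s : seq I) :
  (forall i, i \in s -> ophi (x i)) ->
  exists2 Y : nat -> L0 P, forall n, exists2 V, M V & V (Y n) &
    forall i, i \in s -> \forall t \ae P, pairing (x i) (Y n) t @[n --> \oo] --> f (x i) t.
Proof.
move=> ox; have [_ MU0 _ _ _] := fM.
have /choice[Y YP] : forall n : nat, exists y : L0 P, (exists2 V, M V & V y) /\
    forall i, i \in s -> \forall t \ae P, `|pairing (x i) y t - f (x i) t| < n.+1%:R^-1.
  move=> n; have [||V MV hV] := @filter_limit_common I x s (cst n.+1%:R^-1) ox.
  - exact: measurable_cst.
  - by move=> t; rewrite invr_gt0 ltr0n.
  by have [y Vy] := MU0 _ MV; exists y; split; [exists V|exact: hV].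
exists Y => [n|i si]; first exact: (YP n).1.
have h := ae_foralln (fun n => (YP n).2 i si).
apply: filterS h => t h; apply/cvgrPdist_lt => e e0.
have [N _ hN] := near_infty_natSinv_lt (PosNum e0).
exists N => // n Nn; rewrite distrC; exact: lt_trans (h n) (hN n Nn).
Qed.

Hypothesis ML : forall U, M U -> U `<=` Lpsi.

Let oM (Y : nat -> L0 P) n : (exists2 V, M V & V (Y n)) -> orl P F psi (Y n).
Proof. by move=> [V MV VY]; exact: (orl_psi (ML MV VY)). Qed.

Lemma filter_limitD x x' : ophi x -> ophi x' ->
  \forall t \ae P, f (fun u => x u + x' u) t = f x t + f x' t.
Proof.
move=> ox ox'; have oxx := orlD sF FE (is_young_nd Yphi) ox ox'.
pose xs : seq (T -> R) := [:: x; x'; fun u => x u + x' u].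
have [[|[|[|]]]//|Y MY h] := @filter_limit_seq nat (nth x xs) [:: 0%N; 1%N; 2%N].
have h0 := h 0%N isT; have h1 := h 1%N isT; have h2 := h 2%N isT; rewrite /= in h0 h1 h2.
have hp := ae_foralln (fun n => pairingDl sF FE Yphi ox ox' (oM (MY n))).
near=> t; apply: (@cvg_unique _ (@norm_hausdorff _ R) ((fun n => pairing (fun u => x u + x' u) (Y n) t) @ \oo)).
  by near: t; exact: h2.
rewrite (_ : (fun n => _) = (fun n => pairing x (Y n) t + pairing x' (Y n) t)); last first.
  by apply/funext; near: t; exact: hp.
by apply: cvgD; near: t; [exact: h0|exact: h1].
Unshelve. all: by end_near.
Qed.

Lemma filter_limitZ a x : ophi x -> \forall t \ae P, f (fun u => a * x u) t = a * f x t.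
Proof.
move=> ox; have oax := orlZ sF FE (is_young_nd Yphi) a ox.
pose xs : seq (T -> R) := [:: x; fun u => a * x u].
have [[|[|]]//|Y MY h] := @filter_limit_seq nat (nth x xs) [:: 0%N; 1%N].
have h0 := h 0%N isT; have h1 := h 1%N isT; rewrite /= in h0 h1.
have hp := ae_foralln (fun n => pairingZl sF FE Yphi a ox (oM (MY n))).
near=> t; apply: (@cvg_unique _ (@norm_hausdorff _ R) ((fun n => pairing (fun u => a * x u) (Y n) t) @ \oo)).
  by near: t; exact: h1.
rewrite (_ : (fun n => _) = (fun n => a * pairing x (Y n) t)); last first.
  by apply/funext; near: t; exact: hp.
by apply: cvgMr; near: t; exact: h0.
Unshelve. all: by end_near.
Qed.

Lemma filter_limit_local x x' B : ophi x -> ophi x' -> F B ->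
  (\forall t \ae P, B t -> x t = x' t) -> \forall t \ae P, B t -> f x t = f x' t.
Proof.
move=> ox ox' FB xx'.
pose xs : seq (T -> R) := [:: x; x'].
have [[|[|]]//|Y MY h] := @filter_limit_seq nat (nth x xs) [:: 0%N; 1%N].
have h0 := h 0%N isT; have h1 := h 1%N isT; rewrite /= in h0 h1.
have hp := ae_foralln (fun n => pairing_locall sF FE Yphi ox (oM (MY n)) ox'.1 FB xx').
apply: filterS3 h0 h1 hp => t h0 h1 hp Bt.
have E : (fun n => pairing x (Y n) t) = (fun n => pairing x' (Y n) t).
  by apply/funext => n; exact: hp.
by rewrite E in h0; exact: cvg_unique h0 h1.
Qed.

Lemma filter_limit_le (p : T -> \bar R) x : ophi x -> (\forall t \ae P, p t < +oo)%E ->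
  (forall V y, M V -> V y -> \forall t \ae P, (`|pairing x y t|%:E <= p t)%E) ->
  \forall t \ae P, (`|f x t|%:E <= p t)%E.
Proof.
move=> ox pfin hp.
have [[|]//|Y MY h] := @filter_limit_seq nat (nth x [:: x]) [:: 0%N].
have h0 := h 0%N isT; rewrite /= in h0.
have h1 : \forall t \ae P, forall n, (`|pairing x (Y n) t|%:E <= p t)%E.
  by apply: ae_foralln => n; have [V MV VY] := MY n; exact: hp VY.
apply: filterS3 pfin h0 h1 => t pt h0 h1.
have pf : p t \is a fin_num.
  rewrite fin_numElt pt andbT ltNye; apply/eqP => pN.
  by have := h1 0%N; rewrite pN leNgt ltNyr.
rewrite -(fineK pf) lee_fin.
have cn : `|pairing x (Y n) t| @[n --> \oo] --> `|f x t| by exact: cvg_norm.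
rewrite -(cvg_lim (@norm_hausdorff _ R) cn); apply: limr_le; first by apply/cvg_ex; exists `|f x t|.
by apply: nearW => n; rewrite -lee_fin fineK.
Qed.

(** On block k one member [V k] of [M] handles the finite set [G k]. The mixture of the [V k]
    belongs to [M] and handles all blocks together; it meets [V0], and any common point is close to
    [y]. *)
Lemma filter_limit_cluster (U : set (L0 P)) (V0 : set (L0 P)) y :
  U `<=` Lpsi -> M V0 -> V0 `<=` U -> Lpsi y ->
  (forall x, ophi x -> \forall t \ae P, f x t = pairing x y t) -> w_closure U y.
Proof.
move=> UL MV0 V0U Ly fy; have [_ MU0 MI _ Mmix] := fM.
apply/(w_closureP sF FE Yphi _ UL); split => // G A eps bd; have [GP pA [[e me ee] eps0]] := bd.
(* [filter_limit] requires an error that is [F]-measurable and positive at every point; [eps] has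
   this only up to a null set. *)
pose e' t := if 0 < e t then e t else 1.
have me' : mF e'.
  by apply: (@measurable_fun_ifT _ _ TF) => //; apply: (@measurable_fun_ltr _ TF).
have e'0 t : 0 < e' t by rewrite /e'; case: ifPn.
have ee' : \forall t \ae P, eps t = e' t.
  by apply: filterS2 ee eps0 => t et; rewrite /e' -et => ->.
have /choice[V VP] : forall k, exists V, M V /\ forall z, V z ->
    \forall t \ae P, forall x, G k x -> `|pairing x z t - f x t| < e' t.
  move=> k; have [finG _ GL] := GP k; have /finite_seqP[s Gs] := finG.
  have [|V MV hV] := @filter_limit_common (L0 P) (@L0_fun R d T P) s e' _ me' e'0.
    by move=> x xs; apply/orl_phi/GL; rewrite Gs.
  exists V; split => // z Vz; apply: ae_in_finite => // x; rewrite Gs => xs.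
  exact: hV.
have MV := Mmix _ _ pA (fun k => (VP k).1).
have [W MW WV] := MI _ _ MV MV0.
have [z Wz] := MU0 _ MW; have [/(mixture_setP _ _ pA)[u Vu zu] V0z] := WV _ Wz.
exists z; first exact: V0U.
split; first exact: UL (V0U _ V0z).
have h1 := pairing_mixture_all sF FE Yphi bd pA (fun k => ML (VP k).1 (Vu k)) zu.
have h2 := ae_foralln (fun k => (VP k).2 _ (Vu k)).
have h3 : \forall t \ae P, forall k x, G k x -> f x t = pairing x y t.
  apply: ae_foralln => k; have [finG _ GL] := GP k.
  by apply: ae_in_finite => // x Gx; apply: fy; exact/orl_phi/GL.
apply: filterS3 h1 h2 (filterI h3 ee') => t {}h1 {}h2 [{}h3 et] k Ak x Gx.
by rewrite et (h1 _ Ak _ _ Gx) -(h3 _ _ Gx); exact: h2.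
Qed.

End cluster_points.

Theorem theorem5p2 (R : realType) (d : measure_display) (T : measurableType d)
    (P : probability T R) (F : set_system T)
    (sF : sigma_algebra [set: T] F) (FE : F `<=` measurable)
    (phi : R -> \bar R) (phi_young : is_young phi)
    (S : set (L0 P)) (S_sub : S `<=` orlicz F (young_conjugate phi))
    (S_stable : is_stable F S)
    (S_cont : forall x : nat -> L0 P,
      (forall n, orlicz F phi (x n)) ->
      (\forall t \ae P, nonincreasing_seq (fun n => x n t) /\
                        (x n t : R) @[n --> \oo] --> (0 : R)) ->
      \forall t \ae P,
        ess_sup_family P
          [set cond_exp P F (fun u => `|x n u * y u|%:E) | y in S] t
        @[n --> \oo] --> 0%E) :
  is_relatively_stably_compact F phi S.
Proof.
have KL : w_closure F phi S `<=` orlicz F (young_conjugate phi) by exact: w_closure_psi.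
have sK := stable_w_closure sF FE phi_young S_sub S_stable.
split; [exact: KL|exact: sK|] => B fB BK.
have [Pi [Pi_fin Pi_le Pi_cont Pi_ub]] := dominating_functional sF FE phi_young S_stable S_cont.
have PiK x z : orl P F phi x -> w_closure F phi S z ->
    \forall t \ae P, (`|pairing P F x z t|%:E <= Pi x t)%E.
  move=> ox; have [_ pfin] := Pi_fin x ox.
  exact: (dominated_w_closure sF FE phi_young S_sub ox pfin (fun y => Pi_ub x y ox)).
have [M [fM MK BM Mmax]] := maximal_stable_filter sF FE sK fB BK.
have ML U : M U -> U `<=` orlicz F (young_conjugate phi) by move=> MU z /(MK _ MU); exact: KL.
(* [Pi x] bounds the pairings over the whole closure of [S], hence over the members of [M], so the
   limit exists for every x in the Orlicz space; elsewhere 0 is a dummy value. *)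
have /choice[f Mf] : forall x, exists g : T -> R, orl P F phi x -> measurable_wrt F g /\
    forall eps : T -> R, measurable_wrt F eps -> (forall t, 0 < eps t) ->
    exists2 V, M V & forall y, V y -> \forall t \ae P, `|pairing P F x y t - g t| < eps t.
  move=> x; have [ox|nox] := pselect (orl P F phi x); last by exists (cst 0).
  have [|g mg hg] := @limit_maximal_filter _ _ _ P F sF FE phi phi_young _ M x (fun t => fine (Pi x t))
    KL sK fM MK Mmax ox; last by exists g.
  move=> y Ky; have [_ pfin] := Pi_fin x ox.
  apply: filterS2 pfin (PiK x y ox Ky) => t pt h.
  have pf : Pi x t \is a fin_num by rewrite ge0_fin_numE// (le_trans _ h)// lee_fin.
  by rewrite -lee_fin fineK.
have fPi x : orl P F phi x -> \forall t \ae P, (`|f x t|%:E <= Pi x t)%E.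
  move=> ox; have [_ pfin] := Pi_fin x ox.
  apply: (filter_limit_le fM Mf ox pfin) => V y MV Vy; apply: PiK => //; exact: MK Vy.
have [y oy fy] := representation sF FE phi_young (fun x ox => (Mf x ox).1)
  (filter_limitD sF FE phi_young fM Mf ML) (filter_limitZ sF FE phi_young fM Mf ML)
  (filter_limit_local sF FE phi_young fM Mf ML) fPi (fun x ox => (Pi_fin x ox).1)
  (fun x ox => (Pi_fin x ox).2) Pi_le Pi_cont.
have nd := young_conjugate_nd phi_young.
pose z := L0_of P oy.1; have zy := L0_ofE P oy.1.
have oz : orl P F (young_conjugate phi) z by exact: (orl_ae_eq sF FE nd (measurable_L0 z) zy oy).
have Lz : orlicz F (young_conjugate phi) z by apply/(orliczP sF FE nd).
have fz x : orl P F phi x -> \forall t \ae P, f x t = pairing P F x z t.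
  move=> ox; have yz : \forall t \ae P, y t = z t by apply: filterS zy => t ->.
  have h := pairing_ae_eq sF FE phi_young ox oy (measurable_L0 z) yz.
  by apply: filterS2 (fy x ox) h => t -> ->.
have Bz U : B U -> w_closure F phi U z.
  move=> BU; have [V MV VU] := BM U BU.
  apply: (filter_limit_cluster sF FE phi_young fM Mf ML _ MV VU Lz fz).
  by move=> u /(BK _ BU); exact: KL.
(* Members of [B] lie in the closure of [S], so [z] lies in the closure of that closure, which is
   the same set. *)
exists z => //; apply: w_closure_closure.
have [[U BU] _ _ _ _] := fB; exact: (w_closureS (BK _ BU) (Bz _ BU)).
Qed.
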